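(* Let $\varepsilon'_0$ and $\varepsilon_i$, $i\in\mathbb{Z}$, be independent and identically distributed real random variables, and let $X_k=g(\dots,\varepsilon_{k-1},\varepsilon_k)$, $k\in\mathbb{Z}$, where $g$ is measurable and each $X_k$ is a well-defined random variable. Assume the distribution function $F$ of $X_k$ has a square integrable density $f$ with square integrable derivative $f'$, and that for every $k\ge1$ the conditional distribution function $F_k(x\mid\xi_0)=\mathbb{P}(X_k\le x\mid \xi_0)$ has a derivative $f_k(x\mid\xi_0)$ in $x$ (almost surely). Let $(b_n)$ be positive numbers with $b_n\to0$ and $\log n=O(nb_n)$. Assume there is a constant $c_0>0$ such that $\sup_{x\in\mathbb{R}} f_1(x\mid\xi_0)\le c_0$ almost surely, and that $$\sum_{k=1}^{\infty}\Big[\int_{\mathbb{R}}(1+\theta^2)\,\big\|\varphi_k(\theta\mid\xi_0)-\varphi_k(\theta\mid\xi_0^* )\big\|^2\,d\theta\Big]^{1/2}<\infty.$$ Let $\iota(n)=(\log n)^{1/2}\log\log n$. Then $$\Delta_n(b_n)=O_{\mathrm{a.s.}}\big(\sqrt{b_n\log n}\big)+o_{\mathrm{a.s.}}\big(b_n\,\iota(n)\big),$$ i.e. $\Delta_n(b_n)\le A_n+B_n$ where $\limsup_n A_n/\sqrt{b_n\log n}<\infty$ almost surely and $B_n/(b_n\iota(n))\to0$ almost surely.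
   Context: Notation: $\xi_k=(\dots,\varepsilon_{k-1},\varepsilon_k)$ for $k\in\mathbb{Z}$; for $k\ge0$, $\xi_k^*=(\xi_{-1},\varepsilon'_0,\varepsilon_1,\dots,\varepsilon_k)$ (i.e. $\xi_k$ with $\varepsilon_0$ replaced by $\varepsilon'_0$). $f_1(x\mid\xi_0)$ is the conditional density of $X_1$ given $\xi_0$. The conditional characteristic function is $\varphi_k(\theta\mid\xi_0)=\mathbb{E}(e^{\sqrt{-1}\theta X_k}\mid\xi_0)$, and $\varphi_k(\theta\mid\xi_0^* )$ denotes the same function of the history evaluated at $\xi_0^*$ (equivalently the conditional characteristic function of $X_k^*=g(\xi_k^* )$ given $\xi_0^*$). $\|Z\|=(\mathbb{E}|Z|^2)^{1/2}$. Empirical distribution function $F_n(x)=n^{-1}\sum_{i=1}^n\mathbf{1}_{X_i\le x}$, $G_n(x)=\sqrt n[F_n(x)-F(x)]$, and modulus of continuity $\Delta_n(b)=\sup_{x,y\in\mathbb{R},\,|x-y|\le b}|G_n(x)-G_n(y)|$. *)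

(* Defs.v *)
From HB Require Import structures.
From mathcomp Require Import all_boot all_order all_algebra.
From mathcomp Require Import all_classical all_reals all_analysis.
Set Implicit Arguments. Unset Strict Implicit. Unset Printing Implicit Defensive.
Import Order.TTheory GRing.Theory Num.Theory.
Import numFieldNormedType.Exports.
Local Open Scope classical_set_scope.
Local Open Scope ring_scope.

Section Defs.
Context {d : measure_display} {Omega : measurableType d} {R : realType}.
Variable P : probability Omega R.

Definition fam (eps : int -> Omega -> R) (eps0' : Omega -> R) (o : option int)
  : Omega -> R := match o with None => eps0' | Some i => eps i end.

Definition iid_family (I : eqType) (e : I -> Omega -> R) : Prop :=
  (forall i, measurable_fun setT (e i)) /\
  (forall i j (A : set R), measurable A -> P (e i @^-1` A) = P (e j @^-1` A)) /\
  (forall (J : seq I) (A : I -> set R), uniq J -> (forall j, measurable (A j)) ->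
     P (\bigcap_(j in [set j | j \in J]) (e j @^-1` A j)) =
     \prod_(j <- J) P (e j @^-1` A j))%E.

(* product (cylinder) sigma-algebra on sequences s : nat -> R, where
   s 0 is the most recent innovation, s 1 the previous one, ... *)
Definition cylinders : set (set (nat -> R)) :=
  [set C | exists i (A : set R), measurable A /\ C = (fun s => s i) @^-1` A].

Definition seq_measurable (g : (nat -> R) -> R) : Prop :=
  forall B : set R, measurable B -> <<s cylinders >> (g @^-1` B).

Definition Xproc (g : (nat -> R) -> R) (eps : int -> Omega -> R) (k : int)
  (w : Omega) : R := g (fun j : nat => eps (k - j%:Z)%R w).

Definition xi0 (eps : int -> Omega -> R) (w : Omega) : nat -> R :=
  fun j => eps (- j%:Z)%R w.
Definition xi0star (eps : int -> Omega -> R) (eps0' : Omega -> R) (w : Omega)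
  : nat -> R := fun j => if j == 0%N then eps0' w else eps (- j%:Z)%R w.

(* xi_k built from a past s (playing the role of xi_0) and eps_1..eps_k(w') *)
Definition fut (eps : int -> Omega -> R) (k : nat) (s : nat -> R) (w' : Omega)
  : nat -> R := fun j => if (j < k)%N then eps (k - j)%:Z w' else s (j - k)%N.

(* Conditional distribution function F_k(x | xi_0 = s) (regular version,
   obtained by integrating out the independent eps_1..eps_k) *)
Definition condF (g : (nat -> R) -> R) (eps : int -> Omega -> R) (k : nat)
  (s : nat -> R) (x : R) : R :=
  fine (P [set w' | g (fut eps k s w') <= x]).

Definition condphi_re g eps (k : nat) (s : nat -> R) (th : R) : R :=
  Rintegral P setT (fun w' => cos (th * g (fut eps k s w'))).
Definition condphi_im g eps (k : nat) (s : nat -> R) (th : R) : R :=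
  Rintegral P setT (fun w' => sin (th * g (fut eps k s w'))).

Definition phidiff2 g eps eps0' (k : nat) (th : R) : \bar R :=
  (\int[P]_w ((condphi_re g eps k (xi0 eps w) th
               - condphi_re g eps k (xi0star eps eps0' w) th) ^+ 2
           + (condphi_im g eps k (xi0 eps w) th
               - condphi_im g eps k (xi0star eps eps0' w) th) ^+ 2)%:E)%E.

Definition Ik g eps eps0' (k : nat) : \bar R :=
  (\int[lebesgue_measure]_th ((1 + th ^+ 2)%:E * phidiff2 g eps eps0' k th))%E.

Definition Fn g eps (n : nat) (w : Omega) (x : R) : R :=
  n%:R^-1 * \sum_(1 <= i < n.+1) (((Xproc g eps i%:Z w <= x)%R : bool)%:R : R).

Definition Gn g eps (F : R -> R) (n : nat) (w : Omega) (x : R) : R :=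
  Num.sqrt n%:R * (Fn g eps n w x - F x).

Definition Deltan g eps F (n : nat) (b : R) (w : Omega) : R :=
  sup [set z : R | exists x y : R,
        `|x - y| <= b /\ z = `|Gn g eps F n w x - Gn g eps F n w y|].

(* distribution function F of X_k (same for all k; taken at k = 0) *)
Definition distF g eps (x : R) : R := fine (P [set w | Xproc g eps 0 w <= x]).

End Defs.

Definition iota_fun {R : realType} (n : nat) : R :=
  Num.sqrt (ln (n%:R : R)) * ln (ln (n%:R : R)).

(* Main.v *)
Require Import Defs.
From HB Require Import structures.
From mathcomp Require Import all_boot all_order all_algebra.
From mathcomp Require Import all_classical all_reals all_analysis measurable_realfun.
From mathcomp Require Import ring lra zify.

(** The increment [G_n(y) - G_n(x)] splits into a martingale part (indicators
minus their conditional probabilities given the previous innovations) and a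
predictable part.

Martingale part.  The conditional variance of one increment over [(x, y]] is at
most [c0 (y - x)].  The recursion for [E (e^{tM} + e^{-tM} - 2)] starts at [0],
so the resulting tail bound is proportional to [P (x < X <= y)] and can be
summed over an infinite grid without truncation.  Borel--Cantelli and
monotonicity between grid points give [O (sqrt (b_n log n))].

Predictable part.  Smoothing with a Cauchy kernel and Fourier inversion bound
the increment by [|y - x|] times the square root of
[Lam_n = int (1 + theta^2) |H_n (theta)|^2 dtheta], where [H_n] is the centred
sum of the conditional characteristic functions.  Decomposing [H_n] along the
innovations, Doob's inequality for each lag, triviality of the remote past and
a weighted Cauchy--Schwarz inequality yield [E max_{m <= n} Lam_m = O (n)].
Dyadic blocks and [sum 1 / (r log^2 r) < oo] turn this into
[Lam_n = o (n log n (log log n)^2)] almost surely. *)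

Set Implicit Arguments. Unset Strict Implicit. Unset Printing Implicit Defensive.
Import Order.TTheory GRing.Theory Num.Theory.
Import numFieldNormedType.Exports.
Local Open Scope classical_set_scope.
Local Open Scope ring_scope.

(** * Bounded measurable functions and their integrals *)

(** Conditional expectations are concrete throughout: a past is a point [s] of the sequence space,
    and conditioning on it averages over fresh innovations. Each identity thus reduces to one fact,
    the invariance of the law of the past under prepending an innovation, and functions stay bounded
    until frequencies are integrated. The predictable part involves infinitely many lags. The lag
    expansion is stopped at a finite [K] and, for fixed [n], the remainder is removed by letting [K]
    grow, so that no infinite series of martingale differences has to converge. The weights in the
    Cauchy--Schwarz inequality are essentially the terms of the summability hypothesis, and the
    weighted sum of squares is then at most that same series. The Cauchy kernel is convenient
    because both its Fourier transform and its primitive are elementary: inversion needs only the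
    fundamental theorem of calculus and dominated convergence. The resulting bound does not depend
    on the scale of the kernel, which can therefore tend to 0. *)

Definition bmf {d} {T : measurableType d} {R : realType} (h : T -> R) : Prop :=
  measurable_fun setT h /\ exists M : R, forall x, `|h x| <= M.

Notation Ex P h := (Rintegral P setT h).

Section bounded_measurable.
Context {d} {T : measurableType d} {R : realType}.
Implicit Types h k : T -> R.

Lemma bmf_measurable h : bmf h -> measurable_fun setT h.
Proof. by case. Qed.

Lemma bmf_cst (c : R) : bmf (fun _ : T => c).
Proof. by split; [exact: measurable_cst|exists `|c|]. Qed.

Lemma bmfD h k : bmf h -> bmf k -> bmf (fun x => h x + k x).
Proof.
move=> [mh [M hM]] [mk [N kN]]; split; first exact: measurable_funD.
by exists (M + N) => x; rewrite (le_trans (ler_normD _ _))// lerD.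
Qed.

Lemma bmfN h : bmf h -> bmf (fun x => - h x).
Proof.
move=> [mh [M hM]]; split; first exact: measurableT_comp.
by exists M => x; rewrite normrN.
Qed.

Lemma bmfB h k : bmf h -> bmf k -> bmf (fun x => h x - k x).
Proof. by move=> bh bk; apply: bmfD => //; exact: bmfN. Qed.

Lemma bmfM h k : bmf h -> bmf k -> bmf (fun x => h x * k x).
Proof.
move=> [mh [M hM]] [mk [N kN]]; split; first exact: measurable_funM.
by exists (M * N) => x; rewrite normrM ler_pM.
Qed.

Lemma bmfX h n : bmf h -> bmf (fun x => h x ^+ n).
Proof.
move=> bh; elim: n => [|n ih]; first exact: bmf_cst.
rewrite (_ : (fun x => _) = (fun x => h x * h x ^+ n)); first exact: bmfM.
by apply/funext => x; rewrite exprS.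
Qed.

Lemma bmf_max h k : bmf h -> bmf k -> bmf (fun x => Num.max (h x) (k x)).
Proof.
move=> [mh [M hM]] [mk [N kN]]; split; first exact: measurable_maxr.
exists (Num.max M N) => x; rewrite maxEle; case: ifPn => _;
  by rewrite le_max ?hM ?kN ?orbT.
Qed.

Lemma bmf_norm h : bmf h -> bmf (fun x => `|h x|).
Proof.
move=> [mh [M hM]]; split; first exact: measurableT_comp.
by exists M => x; rewrite normr_id.
Qed.

Lemma bmf_sum (I : Type) (r : seq I) (Q : pred I) (F : I -> T -> R) :
  (forall i, Q i -> bmf (F i)) -> bmf (fun x => \sum_(i <- r | Q i) F i x).
Proof.
move=> bF; elim: r => [|i r ih].
  rewrite (_ : (fun x => _) = fun=> 0); first exact: bmf_cst.
  by apply/funext => x; rewrite big_nil.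
have [Qi|Qi] := boolP (Q i); last first.
  by rewrite (_ : (fun x => _) = fun x => \sum_(i <- r | Q i) F i x)//;
    apply/funext => x; rewrite big_cons (negbTE Qi).
rewrite (_ : (fun x => _) = fun x => F i x + \sum_(i <- r | Q i) F i x).
  by apply: bmfD => //; exact: bF.
by apply/funext => x; rewrite big_cons Qi.
Qed.

Lemma bmf_expR h : bmf h -> bmf (fun x => expR (h x)).
Proof.
move=> [mh [M hM]]; split; first exact: measurableT_comp.
exists (expR M) => x; rewrite ger0_norm ?expR_ge0// ler_expR.
by rewrite (le_trans _ (hM x))// ler_norm.
Qed.

Lemma bmf_cos h : measurable_fun setT h -> bmf (fun x => cos (h x)).
Proof.
move=> mh; split.
  by apply: measurableT_comp => //; apply: continuous_measurable_fun;
    exact: continuous_cos.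
by exists 1 => x; rewrite ler_norml cos_geN1 cos_le1.
Qed.

Lemma bmf_sin h : measurable_fun setT h -> bmf (fun x => sin (h x)).
Proof.
move=> mh; split.
  by apply: measurableT_comp => //; apply: continuous_measurable_fun;
    exact: continuous_sin.
by exists 1 => x; rewrite ler_norml sin_geN1 sin_le1.
Qed.

Lemma bmf_bool (p : T -> bool) : measurable_fun setT p ->
  bmf (fun x => (p x)%:R : R).
Proof.
move=> mp; split; last first.
  by exists 1 => x; case: (p x); rewrite ?normr1// normr0.
rewrite (_ : (fun x => _) = fun x => if p x then 1 else 0); last first.
  by apply/funext => x; case: (p x).
exact: measurable_fun_ifT.
Qed.

Lemma bmf_comp d' (T' : measurableType d') (h : T' -> R) (u : T -> T') :
  measurable_fun setT u -> bmf h -> bmf (fun x => h (u x)).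
Proof.
move=> mu [mh [M hM]]; split; first exact: measurableT_comp.
by exists M => x.
Qed.

Lemma bmf_eq h k : h =1 k -> bmf h -> bmf k.
Proof. by move=> /funext ->. Qed.

Variable P : probability T R.

Lemma bmf_integrable h : bmf h -> P.-integrable setT (EFin \o h).
Proof.
move=> [mh [M hM]]; apply: measurable_bounded_integrable => //.
  exact: fin_num_fun_lty.
exists M; split; first exact: num_real.
by move=> x Mx y _ /=; apply: (le_trans (hM y)); exact: ltW.
Qed.
Local Hint Resolve bmf_integrable : core.

Lemma EFin_Ex h : bmf h -> (Ex P h)%:E = (\int[P]_x (h x)%:E)%E.
Proof.
by move=> bh; rewrite fineK//; apply: integrable_fin_num => //; exact: bmf_integrable.
Qed.

Lemma ExD h k : bmf h -> bmf k ->
  Ex P (fun x => h x + k x) = Ex P h + Ex P k.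
Proof. by move=> bh bk; rewrite RintegralD//; exact: bmf_integrable. Qed.

Lemma ExB h k : bmf h -> bmf k ->
  Ex P (fun x => h x - k x) = Ex P h - Ex P k.
Proof. by move=> bh bk; rewrite RintegralB//; exact: bmf_integrable. Qed.

Lemma ExZ (c : R) h : bmf h -> Ex P (fun x => c * h x) = c * Ex P h.
Proof. by move=> bh; rewrite RintegralZl//; exact: bmf_integrable. Qed.

Lemma ExZr (c : R) h : bmf h -> Ex P (fun x => h x * c) = Ex P h * c.
Proof. by move=> bh; rewrite RintegralZr//; exact: bmf_integrable. Qed.

Lemma Ex_cst (c : R) : Ex P (fun=> c) = c.
Proof.
rewrite Rintegral_cst//= probability_setT/=.
by rewrite mulr1.
Qed.

Lemma Ex_le h k : bmf h -> bmf k -> (forall x, h x <= k x) -> Ex P h <= Ex P k.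
Proof. by move=> bh bk hk; apply: le_Rintegral => //; exact: bmf_integrable. Qed.

Lemma Ex_ge0 h : (forall x, 0 <= h x) -> 0 <= Ex P h.
Proof. by move=> h0; apply: Rintegral_ge0. Qed.

Lemma Ex_norm h : bmf h -> `|Ex P h| <= Ex P (fun x => `|h x|).
Proof. by move=> bh; apply: le_normr_Rintegral => //; exact: bmf_integrable. Qed.

Lemma Ex_bound h (M : R) : bmf h -> (forall x, `|h x| <= M) -> `|Ex P h| <= M.
Proof.
move=> bh hM; rewrite (le_trans (Ex_norm bh))// -[leRHS]Ex_cst.
by apply: Ex_le => //; [exact: bmf_norm|exact: bmf_cst].
Qed.

Lemma Ex_sum (I : Type) (r : seq I) (Q : pred I) (F : I -> T -> R) :
  (forall i, Q i -> bmf (F i)) ->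
  Ex P (fun x => \sum_(i <- r | Q i) F i x) = \sum_(i <- r | Q i) Ex P (F i).
Proof.
move=> bF; elim: r => [|i r ih].
  by under eq_Rintegral do rewrite big_nil; rewrite Ex_cst big_nil.
rewrite big_cons; under eq_Rintegral do rewrite big_cons.
case: ifPn => // Qi; rewrite ExD ?ih//; first exact: bF.
exact: bmf_sum.
Qed.

Lemma sqr_Ex h : bmf h -> Ex P h ^+ 2 <= Ex P (fun x => h x ^+ 2).
Proof.
move=> bh; set c := Ex P h.
have : 0 <= Ex P (fun x => (h x - c) ^+ 2) by apply: Ex_ge0 => x; exact: sqr_ge0.
under eq_Rintegral do rewrite sqrrB.
rewrite ExD; [|apply: bmfB|exact: bmf_cst].
- rewrite ExB; [|exact: bmfX|].
  + rewrite Ex_cst; under [X in _ - X + _]eq_Rintegral do rewrite -mulrnAr.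
    rewrite ExZr// -/c; nra.
  + by apply: bmf_eq (bmfM bh (bmf_cst (c *+ 2))) => x; rewrite mulrnAr.
- exact: bmfX.
- by apply: bmf_eq (bmfM bh (bmf_cst (c *+ 2))) => x; rewrite mulrnAr.
Qed.

(** Replacing [k] by [max h k] changes it on a null set only and makes the inequality hold at every
    point. *)
Lemma ae_Ex_le h k : bmf h -> bmf k -> {ae P, forall x, h x <= k x} ->
  Ex P h <= Ex P k.
Proof.
move=> bh bk hk; have bM := bmf_max bh bk.
rewrite (_ : Ex P k = Ex P (fun x => Num.max (h x) (k x))).
  by apply: Ex_le => // x; rewrite le_max lexx.
congr fine; apply: ae_eq_integral => //.
- by apply/measurable_EFinP; exact: bmf_measurable.
- by apply/measurable_EFinP; exact: bmf_measurable.
- by apply: filterS hk => x hkx _; rewrite max_r.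
Qed.

End bounded_measurable.

(** * Fubini's theorem for bounded functions *)

Section product_expectation.
Context {d1 d2} {T1 : measurableType d1} {T2 : measurableType d2} {R : realType}.
Variables (P1 : probability T1 R) (P2 : probability T2 R).

Lemma bmf_pair1 (h : T1 * T2 -> R) y : bmf h -> bmf (fun x => h (x, y)).
Proof. by move=> bh; apply: bmf_comp bh; exact: measurable_pair2. Qed.

Lemma bmf_pair2 (h : T1 * T2 -> R) x : bmf h -> bmf (fun y => h (x, y)).
Proof. by move=> bh; apply: bmf_comp bh; exact: measurable_pair1. Qed.

Lemma bmf_prod_integrable (h : T1 * T2 -> R) : bmf h ->
  (P1 \x P2)%E.-integrable setT (EFin \o h).
Proof.
move=> bh; apply/integrable12ltyP; first exact/measurable_EFinP/bmf_measurable.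
have [mh [M hM]] := bh.
apply: (@le_lt_trans _ _ M%:E); last exact: ltry.
rewrite -[leRHS](_ : \int[P1]_x M%:E = _)%E; last first.
  by rewrite integral_cst//= probability_setT mule1.
apply: ge0_le_integral => //=.
- by move=> x _; apply: integral_ge0 => y _; rewrite lee_fin.
- apply: (measurable_fun_fubini_tonelli_F (fun z => `|h z|%:E)%E) => //=.
  by apply/measurable_EFinP; exact: measurableT_comp.
- move=> x _; rewrite -[leRHS](_ : \int[P2]_x M%:E = _)%E; last first.
    by rewrite integral_cst//= probability_setT mule1.
  apply: ge0_le_integral => //=.
  + apply/measurable_EFinP; apply: measurableT_comp => //.
    by apply: bmf_measurable; exact: bmf_pair2.
  + by move=> y _; rewrite lee_fin.
Qed.

Lemma bmf_Ex2 (h : T1 * T2 -> R) : bmf h ->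
  bmf (fun x => Ex P2 (fun y => h (x, y))).
Proof.
move=> bh; have [mh [M hM]] := bh; split.
  apply/measurable_EFinP; rewrite (_ : _ \o _ = fubini_F P2 (EFin \o h)).
    exact: (measurable_fubini_F (bmf_prod_integrable bh)).
  by apply/funext => x /=; rewrite EFin_Ex//; exact: bmf_pair2.
by exists M => x; apply: Ex_bound => //; exact: bmf_pair2.
Qed.

Lemma bmf_Ex1 (h : T1 * T2 -> R) : bmf h ->
  bmf (fun y => Ex P1 (fun x => h (x, y))).
Proof.
move=> bh; have [mh [M hM]] := bh; split.
  apply/measurable_EFinP; rewrite (_ : _ \o _ = fubini_G P1 (EFin \o h)).
    exact: (measurable_fubini_G (bmf_prod_integrable bh)).
  by apply/funext => y /=; rewrite EFin_Ex//; exact: bmf_pair1.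
by exists M => y; apply: Ex_bound => //; exact: bmf_pair1.
Qed.

Lemma Ex_Fubini (h : T1 * T2 -> R) : bmf h ->
  Ex P1 (fun x => Ex P2 (fun y => h (x, y))) =
  Ex P2 (fun y => Ex P1 (fun x => h (x, y))).
Proof.
move=> bh; apply: EFin_inj; rewrite EFin_Ex; last exact: bmf_Ex2.
rewrite EFin_Ex; last exact: bmf_Ex1.
have := Fubini (bmf_prod_integrable bh).
under eq_integral do rewrite -(EFin_Ex P2 (bmf_pair2 _ bh)).
by under [RHS]eq_integral do rewrite -(EFin_Ex P1 (bmf_pair1 _ bh)).
Qed.

Lemma Ex_prod (h : T1 * T2 -> R) : bmf h ->
  fine (\int[(P1 \x P2)%E]_z (h z)%:E) = Ex P1 (fun x => Ex P2 (fun y => h (x, y))).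
Proof.
move=> bh; rewrite -(integral12_prod_meas1 (bmf_prod_integrable bh)).
congr fine; apply: eq_integral => x _.
by rewrite EFin_Ex//; exact: bmf_pair2.
Qed.

End product_expectation.

(** * Laws of innovation sequences *)

Section law.
Context {d d'} {T : measurableType d} {T' : measurableType d'} {R : realType}.
Variables (P : probability T R) (u : T -> T') (mu : measurable_fun setT u).

Definition law : probability T' R := distribution P (mfun_Sub (mem_set mu)).

Lemma Ex_law (h : T' -> R) : bmf h -> Ex law h = Ex P (fun w => h (u w)).
Proof.
move=> bh; congr fine.
rewrite (@integral_distribution _ _ _ _ _ P (mfun_Sub (mem_set mu))
  (EFin \o h))//.
  by apply/measurable_EFinP; exact: bmf_measurable.
by apply: (@bmf_integrable _ _ _ _ (fun w => h (u w))); exact: bmf_comp.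
Qed.

End law.

(** * The space of pasts and its cylinder sigma-algebra *)

Section sequence_space.
Context {R : realType}.

Definition seqT : Type := g_sigma_algebraType (@cylinders R).
HB.instance Definition _ := Measurable.on seqT.

Lemma measurable_seqE : (measurable : set (set seqT)) = <<s @cylinders R >>.
Proof. by []. Qed.

Lemma measurable_coord j : measurable_fun setT (fun s : seqT => s j).
Proof.
move=> _ A mA; rewrite setTI; apply: sub_sigma_algebra.
by exists j, A.
Qed.

Lemma measurable_to_seq d (T : measurableType d) (u : T -> seqT) :
  (forall j, measurable_fun setT (fun x => u x j)) -> measurable_fun setT u.
Proof.
move=> mu; apply: (measurability _ measurable_seqE).
move=> _ [_ [j [A [mA ->]]] <-]; have := mu j measurableT A mA.
by rewrite setTI.
Qed.

Definition scons (e : R) (s : seqT) : seqT := fun j => if j is j'.+1 then s j' else e.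
Definition stail (s : seqT) : seqT := fun j => s j.+1.
(** The state reached from the past [s] after [k] further innovations, read off [t]; index 0 is the
    most recent one. *)
Definition smerge k (s t : seqT) : seqT := fun j => if (j < k)%N then t j else s (j - k)%N.

Lemma stailK e s : stail (scons e s) = s. Proof. by []. Qed.

Lemma measurable_scons d (T : measurableType d) (u : T -> R) (v : T -> seqT) :
  measurable_fun setT u -> measurable_fun setT v ->
  measurable_fun setT (fun x => scons (u x) (v x)).
Proof.
move=> mu mv; apply: measurable_to_seq => -[//|j] /=.
by apply: (measurableT_comp (@measurable_coord j) mv).
Qed.

Lemma measurable_stail : measurable_fun setT stail.
Proof. by apply: measurable_to_seq => j; exact: measurable_coord. Qed.

Lemma measurable_smerge k d (T : measurableType d) (u v : T -> seqT) :
  measurable_fun setT u -> measurable_fun setT v ->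
  measurable_fun setT (fun x => smerge k (u x) (v x)).
Proof.
move=> mu mv; apply: measurable_to_seq => j; rewrite /smerge.
by case: (j < k)%N; [exact: (measurableT_comp (@measurable_coord j) mv)|
  exact: (measurableT_comp (@measurable_coord (j - k)) mu)].
Qed.

Lemma smerge0 s t : smerge 0 s t = s.
Proof. by apply/funext => j; rewrite /smerge ltn0 subn0. Qed.

Lemma smerge_scons k s e t : smerge k.+1 s (scons e t) = scons e (smerge k s t).
Proof. by apply/funext => -[//|j]; rewrite /smerge/= ltnS subSS. Qed.

Definition box N (A : nat -> set R) : set seqT :=
  [set s | forall j, (j < N)%N -> A j (s j)].

(** Cylinders on one coordinate are not stable under intersection. Boxes are, and they generate the
    same sigma-algebra, as uniqueness of measures and Dynkin's argument require. *)
Definition boxes : set (set seqT) :=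
  [set C | exists N A, (forall j, measurable (A j)) /\ C = box N A].

Lemma boxes_setI_closed : setI_closed boxes.
Proof.
move=> _ _ [N [A [mA ->]]] [M [B [mB ->]]].
exists (maxn N M), (fun j => (if (j < N)%N then A j else setT) `&`
  (if (j < M)%N then B j else setT)); split.
  by move=> j; apply: measurableI; case: ifPn.
apply/seteqP; split=> [s [sA sB] j _|s sAB].
  by split; case: ifPn => // jN; [exact: sA|exact: sB].
split=> j jN.
  by have [] := sAB j (leq_trans jN (leq_maxl _ _)); rewrite jN.
by have [] := sAB j (leq_trans jN (leq_maxr _ _)); rewrite jN.
Qed.

Lemma measurable_box N A : (forall j, measurable (A j)) -> measurable (box N A).
Proof.
move=> mA; rewrite (_ : box N A = \bigcap_(j in [set j | (j < N)%N])
  ((fun s : seqT => s j) @^-1` A j)); last by [].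
apply: bigcap_measurableType => j jN; rewrite -[X in measurable X]setTI.
exact: measurable_coord.
Qed.

Lemma measurable_boxesE : (measurable : set (set seqT)) = <<s boxes >>.
Proof.
apply/seteqP; split; last first.
  apply: smallest_sub; first exact: sigma_algebra_measurable.
  by move=> _ [N [A [mA ->]]]; exact: measurable_box.
rewrite measurable_seqE; apply: smallest_sub; first exact: smallest_sigma_algebra.
move=> _ [j [A [mA ->]]]; apply: sub_sigma_algebra.
exists j.+1, (fun i => if i == j then A else setT); split.
  by move=> i; case: ifPn.
apply/seteqP; split=> s /= => [sA i _|/(_ j (ltnSn j))].
  by case: ifPn => // /eqP ->.
by rewrite eqxx.
Qed.

Lemma boxes_setT : boxes setT.
Proof.
exists 0%N, (fun=> setT); split => //.
by apply/seteqP; split.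
Qed.

Lemma boxes_measure_unique (m1 m2 : {measure set seqT -> \bar R}) :
  (m1 setT < +oo)%E ->
  (forall N A, (forall j, measurable (A j)) -> m1 (box N A) = m2 (box N A)) ->
  forall C, measurable C -> m1 C = m2 C.
Proof.
move=> m1T m12 C mC; apply: (measure_unique boxes (fun=> setT)) => //.
- exact: measurable_boxesE.
- exact: boxes_setI_closed.
- by move=> _; exact: boxes_setT.
- by rewrite bigcup_const//; exists 0%N.
- by move=> _ [N [A [mA ->]]]; exact: m12.
Qed.

End sequence_space.
Arguments seqT : clear implicits.

(** * Independence and equality in law of innovation sequences *)

Section iid.
Context {d} {Omega : measurableType d} {R : realType} (P : probability Omega R).
Context {I : eqType} (e : I -> Omega -> R) (iid : iid_family P e).

Let me i : measurable_fun setT (e i). Proof. by case: iid. Qed.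

Definition eseq (a : nat -> I) (w : Omega) : seqT R := fun j => e (a j) w.

Lemma measurable_eseq a : measurable_fun setT (eseq a).
Proof. by apply: measurable_to_seq => j; exact: me. Qed.

Lemma prob_box a N (A : nat -> set R) i0 : injective a ->
  (forall j, measurable (A j)) ->
  P (eseq a @^-1` box N A) = (\prod_(j < N) P (e i0 @^-1` A j))%E.
Proof.
move=> inja mA; have [_ [same indep]] := iid.
(* Independence concerns sets attached to labels: each label in [J] receives the set of its
   position, unambiguously since [a] is injective. *)
pose J := map a (iota 0 N).
have idx j : (j < N)%N -> index (a j) J = j.
  by move=> jN; rewrite index_map// -[X in index X _](add0n j) -(nth_iota 0 0 jN)
    index_uniq ?iota_uniq ?size_iota// nth_iota.
have := indep J (fun i => A (index i J)).
rewrite map_inj_uniq// iota_uniq => /(_ isT (fun j => mA _)).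
rewrite big_map (_ : iota 0 N = index_iota 0 N); last by rewrite /index_iota subn0.
rewrite big_mkord.
under eq_bigr do rewrite (same _ i0)// idx//.
move=> <-; congr (P _); apply/seteqP; split=> w /= h.
  move=> _ /mapP[j jN ->] /=; rewrite mem_iota add0n in jN.
  by rewrite idx//; exact: h.
move=> j jN; have := h (a j); rewrite /= idx//; apply.
by apply: map_f; rewrite mem_iota.
Qed.

Variable i0 : I.

Definition elaw : probability R R := law P (me i0).
Definition seqlaw a : probability (seqT R) R := law P (measurable_eseq a).

Lemma seqlaw_eq a b C : injective a -> injective b -> measurable C ->
  seqlaw a C = seqlaw b C.
Proof.
move=> ia ib; apply: boxes_measure_unique => [|N A mA].
  by rewrite [ltLHS](@probability_setT _ _ _ (seqlaw a)) ltry.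
rewrite -[LHS]/(P (eseq a @^-1` box N A)) -[RHS]/(P (eseq b @^-1` box N A)).
by rewrite (prob_box _ i0 ia)// (prob_box _ i0 ib).
Qed.

(** Both sides are finite measures in [C], so boxes suffice. On a box, putting [o] in front of [a]
    gives another injective enumeration, and [prob_box] yields one more factor. *)
Lemma prob_indep a o B C : injective a -> (forall j, a j != o) ->
  measurable B -> measurable C ->
  P ((e o @^-1` B) `&` (eseq a @^-1` C)) = (elaw B * seqlaw a C)%E.
Proof.
move=> ia ao mB mC.
have mD : measurable (e o @^-1` B) by rewrite -[X in measurable X]setTI; exact: me.
(* [pose] abstracts the measurability proof left open by the [pushforward] instance. *)
pose m1' := (pushforward (mrestr P mD) (eseq a) : {measure set (seqT R) -> \bar R}).
pose m1 := m1' (measurable_eseq a).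
have r0 : 0 <= fine (elaw B) by apply: fine_ge0.
pose m2 : {measure set (seqT R) -> \bar R} := mscale (NngNum r0) (seqlaw a).
have m2E X : m2 X = (elaw B * seqlaw a X)%E.
  rewrite -[LHS]/((fine (elaw B))%:E * seqlaw a X)%E fineK//.
  exact: fin_num_measure.
rewrite -m2E setIC -[LHS]/(m1 C).
apply: boxes_measure_unique => //.
  rewrite /m1 /m1' /= /pushforward /mrestr /=.
  rewrite preimage_setT setTI; apply: (le_lt_trans (probability_le1 P mD)).
  by rewrite ltry.
move=> N A mA; rewrite m2E.
pose b j := if j is j'.+1 then a j' else o.
have ib : injective b.
  move=> [|i] [|j]//= => [/eqP|/eqP|/ia ->//]; last by rewrite (negbTE (ao _)).
  by rewrite eq_sym (negbTE (ao _)).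
pose A' j := if j is j'.+1 then A j' else B.
have -> : m1 (box N A) = P (eseq b @^-1` box N.+1 A').
  rewrite /m1 /m1' /= /pushforward /mrestr /=; congr (P _).
  apply/seteqP; split=> w /= => [[h1 h2] [|j] //= jN|h]; first exact: h1.
  by split; [move=> j jN; exact: (h j.+1 jN)|exact: (h 0%N)].
have mA' j : measurable (A' j) by case: j.
rewrite (prob_box _ i0 ib)// big_ord_recl; congr (_ * _)%E.
by rewrite -(prob_box _ _ ia).
Qed.

Lemma Ex_indep a o (h : R * seqT R -> R) : injective a -> (forall j, a j != o) ->
  bmf h ->
  Ex P (fun w => h (e o w, eseq a w)) =
  Ex (seqlaw a) (fun s => Ex elaw (fun x => h (x, s))).
Proof.
move=> ia ao bh.
have mz : measurable_fun setT (fun w => (e o w, eseq a w)).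
  by apply: measurable_fun_pair; [exact: me|exact: measurable_eseq].
rewrite -(Ex_law P mz bh) -Ex_Fubini// -Ex_prod//; congr fine.
apply: eq_measure_integral => X mX _; apply/esym.
apply: product_measure_unique => // B C mB mC.
by rewrite -(prob_indep ia ao).
Qed.

Lemma Ex_eseq a b (h : seqT R -> R) : injective a -> injective b -> bmf h ->
  Ex P (fun w => h (eseq a w)) = Ex (seqlaw b) h.
Proof.
move=> ia ib bh; rewrite -(Ex_law P (measurable_eseq a) bh); congr fine.
by apply: eq_measure_integral => X mX _; exact: seqlaw_eq.
Qed.

End iid.

(** * The Markov chain of pasts *)

Section chain.
Context {R : realType}.
Variables (rho : probability R R) (pi : probability (seqT R) R).
Hypothesis pi_inv : forall h : seqT R -> R, bmf h ->
  Ex pi h = Ex pi (fun s => Ex rho (fun e => h (scons e s))).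
Implicit Types (h D : seqT R -> R) (s t : seqT R).

Definition step h s : R := Ex rho (fun e => h (scons e s)).
(** The conditional expectation of [h] at time [k] given the past [s] at time 0. Only the first [k]
    coordinates of [t] are read, so one law [pi] serves every [k]. *)
Definition cE k h s : R := Ex pi (fun t => h (smerge k s t)).

Lemma bmf_scons2 h : bmf h -> bmf (fun z : seqT R * R => h (scons z.2 z.1)).
Proof. by move=> bh; apply: bmf_comp bh; apply: measurable_scons. Qed.

Lemma bmf_scons h s : bmf h -> bmf (fun e => h (scons e s)).
Proof. by move=> bh; apply: bmf_comp bh; apply: measurable_scons. Qed.

Lemma bmf_stail h : bmf h -> bmf (fun s => h (stail s)).
Proof. by apply: bmf_comp; exact: measurable_stail. Qed.

Lemma bmf_smerge k h s : bmf h -> bmf (fun t => h (smerge k s t)).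
Proof. by apply: bmf_comp; apply: (@measurable_smerge _ k _ _ (fun=> s) id). Qed.

Lemma bmf_step h : bmf h -> bmf (step h).
Proof. by move=> bh; exact: (bmf_Ex2 pi rho (bmf_scons2 bh)). Qed.

Lemma bmf_cE k h : bmf h -> bmf (cE k h).
Proof.
move=> bh; apply: (@bmf_Ex2 _ _ _ _ _ pi pi (fun z => h (smerge k z.1 z.2))).
by apply: bmf_comp bh; apply: measurable_smerge.
Qed.

Lemma Ex_step h : bmf h -> Ex pi (step h) = Ex pi h.
Proof. by move=> bh; rewrite [RHS]pi_inv. Qed.

Lemma cE0 h : cE 0 h = h.
Proof.
by apply/funext => s; rewrite /cE; under eq_Rintegral do rewrite smerge0; rewrite Ex_cst.
Qed.

(** The innovation that [pi_inv] splits off is the most recent one, which [step] averages out before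
    the others. *)
Lemma cES k h : bmf h -> cE k.+1 h = cE k (step h).
Proof.
move=> bh; apply/funext => s; rewrite /cE pi_inv; last exact: bmf_smerge.
by apply: eq_Rintegral => t _; apply: eq_Rintegral => e _; rewrite smerge_scons.
Qed.

Lemma step_cE k h : bmf h -> step (cE k h) = cE k.+1 h.
Proof.
elim: k h => [|k ih] h bh; first by rewrite cES// !cE0.
by rewrite (cES _ bh) (ih _ (bmf_step bh)) [RHS](cES _ bh).
Qed.

Lemma Ex_cE k h : bmf h -> Ex pi (cE k h) = Ex pi h.
Proof.
move=> bh; elim: k => [|k ih]; first by rewrite cE0.
by rewrite -step_cE// Ex_step//; exact: bmf_cE.
Qed.

Lemma cED k h1 h2 s : bmf h1 -> bmf h2 ->
  cE k (fun s => h1 s + h2 s) s = cE k h1 s + cE k h2 s.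
Proof. by move=> b1 b2; rewrite /cE ExD//; exact: bmf_smerge. Qed.

Lemma cEB k h1 h2 s : bmf h1 -> bmf h2 ->
  cE k (fun s => h1 s - h2 s) s = cE k h1 s - cE k h2 s.
Proof. by move=> b1 b2; rewrite /cE ExB//; exact: bmf_smerge. Qed.

Lemma cEZ k c h s : bmf h -> cE k (fun s => c * h s) s = c * cE k h s.
Proof. by move=> b1; rewrite /cE ExZ//; exact: bmf_smerge. Qed.

Lemma cE_bound k h (M : R) s : bmf h -> (forall x, `|h x| <= M) -> `|cE k h s| <= M.
Proof. by move=> bh hM; apply: Ex_bound => //; exact: bmf_smerge. Qed.

(** * Doob's maximal inequality along the chain *)

(** The earlier states of a path are the tails of its last state, so path functionals such as
    partial sums, their running maximum and the stochastic integral [pint] are functions of the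
    single point [s]. *)
Fixpoint psum D m s : R := if m is m'.+1 then psum D m' (stail s) + D s else 0.

Fixpoint pmax D m s : R :=
  if m is m'.+1 then Num.max (pmax D m' (stail s)) (psum D m s) else 0.

Fixpoint pint D m s : R :=
  if m is m'.+1 then pint D m' (stail s) + pmax D m' (stail s) * D s else 0.

Lemma bmf_psum D m : bmf D -> bmf (psum D m).
Proof.
move=> bD; elim: m => [|m ih]; first exact: bmf_cst.
by apply: bmfD => //; exact: bmf_stail.
Qed.

Lemma bmf_pmax D m : bmf D -> bmf (pmax D m).
Proof.
move=> bD; elim: m => [|m ih]; first exact: bmf_cst.
apply: bmf_max; first exact: bmf_stail.
exact: (bmf_psum m.+1 bD).
Qed.

Lemma bmf_pint D m : bmf D -> bmf (pint D m).
Proof.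
move=> bD; elim: m => [|m ih]; first exact: bmf_cst.
apply: bmfD; first exact: bmf_stail.
by apply: bmfM => //; apply: bmf_stail; exact: bmf_pmax.
Qed.

Lemma pmax_ge0 D m s : 0 <= pmax D m s.
Proof. by elim: m s => [|m ih] s //=; rewrite le_max ih. Qed.

(* The pathwise form of Doob's inequality: [pint] is a discrete stochastic integral, hence centred. *)
Lemma pathwise_Doob D m s :
  pmax D m s ^+ 2 <= 4 * psum D m s ^+ 2 - 4 * pint D m s.
Proof.
(* The induction runs on this form, bilinear in the maximum and the sum; nonnegativity of the square
   of [pmax - 2 psum] then gives the constant 4. *)
suff : pmax D m s ^+ 2 <= 2 * pmax D m s * psum D m s - 2 * pint D m s.
  have := sqr_ge0 (pmax D m s - 2 * psum D m s).
  by set x := pmax _ _ _; set y := psum _ _ _; set u := pint _ _ _; nra.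
elim: m s => [|m ih] s /=; first by rewrite expr0n/= !mulr0 subr0.
have := ih (stail s); have := pmax_ge0 D m (stail s).
set x := pmax _ _ _; set y := psum _ _ _; set u := pint _ _ _; set dd := D s.
move=> x0 xyu; rewrite maxEle; case: ifPn => [xy|]; last first.
  rewrite -ltNge => yx; nra.
have : 0 <= (y + dd - x) ^+ 2 by exact: sqr_ge0.
nra.
Qed.

Lemma Ex_mulD h D : bmf h -> bmf D -> (forall s, step D s = 0) ->
  Ex pi (fun s => h (stail s) * D s) = 0.
Proof.
move=> bh bD D0; rewrite pi_inv; last by apply: bmfM => //; exact: bmf_stail.
rewrite -[RHS](Ex_cst pi); apply: eq_Rintegral => s _.
under eq_Rintegral do rewrite stailK.
by rewrite ExZ ?[X in _ * X]D0 ?mulr0//; exact: bmf_scons.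
Qed.

Lemma Ex_stail h : bmf h -> Ex pi (fun s => h (stail s)) = Ex pi h.
Proof.
move=> bh; rewrite pi_inv; last exact: bmf_stail.
apply: eq_Rintegral => s _.
by under eq_Rintegral do rewrite stailK; rewrite Ex_cst.
Qed.

Lemma Ex_pint D m : bmf D -> (forall s, step D s = 0) -> Ex pi (pint D m) = 0.
Proof.
move=> bD D0; elim: m => [|m ih]; first by rewrite Ex_cst.
rewrite [LHS]ExD.
- by rewrite Ex_stail ?ih ?Ex_mulD ?addr0//; [exact: bmf_pmax|exact: bmf_pint].
- by apply: bmf_stail; exact: bmf_pint.
- by apply: bmfM => //; apply: bmf_stail; exact: bmf_pmax.
Qed.

Lemma Ex_psum2 D m : bmf D -> (forall s, step D s = 0) ->
  Ex pi (fun s => psum D m s ^+ 2) = m%:R * Ex pi (fun s => D s ^+ 2).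
Proof.
move=> bD D0; elim: m => [|m ih].
  by rewrite mul0r -[RHS](Ex_cst pi); apply: eq_Rintegral => s _; rewrite /= expr0n.
have bp := bmf_psum m bD.
transitivity (Ex pi (fun s => psum D m (stail s) ^+ 2 +
   (2 * psum D m (stail s) * D s + D s ^+ 2))).
  by apply: eq_Rintegral => s _ /=; ring.
rewrite ExD.
- rewrite ExD; [|apply: bmfM => //|exact: bmfX].
  + rewrite (@Ex_stail (fun s => psum D m s ^+ 2)); last exact: bmfX.
    rewrite ih (@Ex_mulD (fun s => 2 * psum D m s))//.
      by rewrite add0r -natr1 mulrDl mul1r.
    by apply: bmfM => //; exact: bmf_cst.
  + by apply: bmfM; [exact: bmf_cst|exact: bmf_stail].
- by apply: (@bmf_stail (fun s => psum D m s ^+ 2)); exact: bmfX.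
- apply: bmfD; last exact: bmfX.
  by apply: bmfM => //; apply: bmfM; [exact: bmf_cst|exact: bmf_stail].
Qed.

Lemma Doob_L2 D m : bmf D -> (forall s, step D s = 0) ->
  Ex pi (fun s => pmax D m s ^+ 2) <= 4 * m%:R * Ex pi (fun s => D s ^+ 2).
Proof.
move=> bD D0; have bp := bmfX 2 (bmf_psum m bD); have bi := bmf_pint m bD.
apply: (@le_trans _ _ (Ex pi (fun s => 4 * psum D m s ^+ 2 - 4 * pint D m s))).
  apply: Ex_le; last by move=> s; exact: pathwise_Doob.
  - by apply: bmfX; exact: bmf_pmax.
  - by apply: bmfB; apply: bmfM => //; exact: bmf_cst.
rewrite ExB; [|by apply: bmfM => //; exact: bmf_cst..].
by rewrite !ExZ// Ex_pint// Ex_psum2// mulr0 subr0 mulrA.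
Qed.

Section paths.
Variables (x : nat -> seqT R) (xS : forall i, stail (x i.+1) = x i).

Lemma psum_path D m : psum D m (x m) = \sum_(1 <= i < m.+1) D (x i).
Proof.
elim: m => [|m ih] /=; first by rewrite big_geq.
by rewrite xS ih [in RHS]big_nat_recr.
Qed.

Lemma le_pmax_path D j m : (j <= m)%N -> \sum_(1 <= i < j.+1) D (x i) <= pmax D m (x m).
Proof.
rewrite -psum_path; elim: m => [|m ih]; first by rewrite leqn0 => /eqP ->.
rewrite leq_eqVlt => /predU1P[->|jm] /=; first by rewrite le_max lexx orbT.
by rewrite xS le_max ih.
Qed.

End paths.

(** * Conditioning on the remote past *)

(** At a state of time [i], the change in the prediction of [h] at time [i + k] caused by the
    innovation of time [i]. *)
Definition innov k h s : R := cE k h s - cE k.+1 h (stail s).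

Lemma bmf_innov k h : bmf h -> bmf (innov k h).
Proof.
by move=> bh; apply: bmfB; [exact: bmf_cE|apply: bmf_stail; exact: bmf_cE].
Qed.

Lemma step_innov k h s : bmf h -> step (innov k h) s = 0.
Proof.
move=> bh; rewrite /step /innov; under eq_Rintegral do rewrite stailK.
rewrite ExB; [|by apply: bmf_scons; exact: bmf_cE|exact: bmf_cst].
by rewrite Ex_cst -step_cE// subrr.
Qed.

(** By [step_cE], [innov] is the average over a redrawn head [e] of the difference between the true
    and the redrawn prediction; Jensen's inequality does the rest. This is where the coupling with
    [eps0'] enters the martingale differences. *)
Lemma Ex_innov2_le k h : bmf h ->
  Ex pi (fun s => innov k h s ^+ 2) <=
  Ex pi (fun s => Ex rho (fun e => (cE k h s - cE k h (scons e (stail s))) ^+ 2)).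
Proof.
move=> bh; have bk := bmf_cE k bh.
have bz : bmf (fun z : seqT R * R => cE k h z.1 - cE k h (scons z.2 (stail z.1))).
  apply: bmfB; first by apply: bmf_comp bk.
  apply: bmf_comp bk; apply: measurable_scons => //.
  exact: (measurableT_comp measurable_stail).
apply: Ex_le.
- by apply: bmfX; exact: bmf_innov.
- exact: (bmf_Ex2 pi rho (bmfX 2 bz)).
- move=> s; rewrite [X in X ^+ 2 <= _](_ : _ =
    Ex rho (fun e => cE k h s - cE k h (scons e (stail s)))); last first.
    rewrite ExB; [|exact: bmf_cst|exact: bmf_scons].
    by rewrite Ex_cst /innov -step_cE.
  apply: sqr_Ex; exact: (bmf_pair2 s bz).
Qed.

(** Triviality of the remote past in mean. The first power makes the property stable under sums and
    limits in mean; boundedness later upgrades it to squares. *)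
Definition mixes h := forall e : R, 0 < e -> exists K, forall k, (K <= k)%N ->
  Ex pi (fun s => `|cE k h s - Ex pi h|) <= e.

Let bmf_dev k h : bmf h -> bmf (fun s => `|cE k h s - Ex pi h|).
Proof.
by move=> bh; apply: bmf_norm; apply: bmfB; [exact: bmf_cE|exact: bmf_cst].
Qed.

Lemma mixesD h1 h2 : bmf h1 -> bmf h2 -> mixes h1 -> mixes h2 ->
  mixes (fun s => h1 s + h2 s).
Proof.
move=> b1 b2 m1 m2 e e0.
have [|K1 hK1] := m1 (e / 2); first by rewrite divr_gt0.
have [|K2 hK2] := m2 (e / 2); first by rewrite divr_gt0.
exists (maxn K1 K2) => k; rewrite geq_max => /andP[k1 k2].
rewrite [leRHS](splitr e); apply: le_trans (lerD (hK1 _ k1) (hK2 _ k2)).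
rewrite -ExD; [|exact: bmf_dev..]; apply: Ex_le.
- by apply: bmf_dev; exact: bmfD.
- by apply: bmfD; exact: bmf_dev.
- move=> s; rewrite cED// ExD// opprD addrACA; exact: ler_normD.
Qed.

Lemma mixesZ c h : bmf h -> mixes h -> mixes (fun s => c * h s).
Proof.
move=> bh mh e e0.
have [|K hK] := mh (e / (`|c| + 1)); first by rewrite divr_gt0.
exists K => k Kk.
rewrite [X in Ex pi X](_ : _ = fun s => `|c| * `|cE k h s - Ex pi h|); last first.
  by apply/funext => s; rewrite cEZ// ExZ// -mulrBr normrM.
rewrite ExZ; last exact: bmf_dev.
have := hK k Kk; rewrite ler_pdivlMr//; apply: le_trans.
by rewrite mulrC ler_wpM2l ?lerDl//; apply: Ex_ge0.
Qed.

Lemma mixes_cst (c : R) : mixes (fun=> c).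
Proof.
move=> a a0; exists 0%N => k _.
rewrite [X in Ex pi X](_ : _ = fun=> 0); first by rewrite Ex_cst ltW.
by apply/funext => s; rewrite /cE !Ex_cst subrr normr0.
Qed.

Lemma mixes_sum n (F : nat -> seqT R -> R) : (forall j, bmf (F j)) ->
  (forall j, mixes (F j)) -> mixes (fun s => \sum_(j < n) F j s).
Proof.
move=> bF mF; elim: n => [|n ih].
  by have := mixes_cst 0; congr mixes; apply/funext => s; rewrite big_ord0.
rewrite (_ : (fun s => _) = fun s => \sum_(j < n) F j s + F n s).
  by apply: mixesD => //; apply: bmf_sum => j _.
by apply/funext => s; rewrite big_ord_recr.
Qed.

(** Conditional expectation contracts the distance in mean ([Ex_cE]), so the approximation error is
    paid once for [cE k] and once for the mean. *)
Lemma mixes_approx h : bmf h -> (forall e : R, 0 < e -> exists h', [/\ bmf h', mixes h' &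
   Ex pi (fun s => `|h s - h' s|) <= e]) -> mixes h.
Proof.
move=> bh happ e e0.
have [|h' [bh' mh' hh']] := happ (e / 3); first by rewrite divr_gt0.
have [|K hK] := mh' (e / 3); first by rewrite divr_gt0.
exists K => k Kk; have bd := bmfB bh bh'; have bn := bmf_norm bd.
have b1 : bmf (fun s => cE k (fun t => `|h t - h' t|) s) by exact: bmf_cE.
apply: (@le_trans _ _ (Ex pi (fun s => cE k (fun t => `|h t - h' t|) s +
   (`|cE k h' s - Ex pi h'| + Ex pi (fun t => `|h t - h' t|))))).
  apply: Ex_le; first exact: bmf_dev.
    apply: bmfD => //; apply: bmfD; [exact: bmf_dev|exact: bmf_cst].
  move=> s; rewrite (_ : cE k h s - _ = (cE k h s - cE k h' s) +
    ((cE k h' s - Ex pi h') + (Ex pi h' - Ex pi h))); last by ring.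
  rewrite (le_trans (ler_normD _ _))// lerD//.
    by rewrite -cEB//; exact: (Ex_norm pi (bmf_smerge k s bd)).
  rewrite (le_trans (ler_normD _ _))// lerD//.
  by rewrite distrC -ExB//; exact: Ex_norm.
rewrite ExD//; last by apply: bmfD; [exact: bmf_dev|exact: bmf_cst].
rewrite ExD; [|exact: bmf_dev|exact: bmf_cst].
rewrite Ex_cE// Ex_cst.
have := hK k Kk; lra.
Qed.

Lemma bmf_indic (C : set (seqT R)) : measurable C -> bmf (\1_C : seqT R -> R).
Proof.
move=> mC; split; first exact: measurable_indic.
by exists 1 => s; rewrite indicE; case: (_ \in _); rewrite ?normr1 ?normr0.
Qed.

Lemma Ex_indic (C : set (seqT R)) : measurable C -> Ex pi (\1_C) = fine (pi C).
Proof. by move=> mC; rewrite /Rintegral integral_indic// setIT. Qed.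

(** Once [k] reaches [N], all coordinates seen by the box have been renewed and the conditional
    probability is constant. *)
Lemma mixes_box N A : (forall j, measurable (A j)) -> mixes (\1_(box N A)).
Proof.
move=> mA e e0; exists N => k Nk.
rewrite [X in Ex pi X](_ : _ = fun=> 0); first by rewrite Ex_cst ltW.
apply/funext => s; rewrite /cE.
rewrite [X in X - _](_ : _ = Ex pi (\1_(box N A))) ?subrr ?normr0//.
apply: eq_Rintegral => t _; rewrite !indicE; congr (_%:R : R); congr nat_of_bool.
apply/idP/idP; rewrite !inE => h j jN; have := h j jN;
  by rewrite /smerge (leq_trans jN Nk).
Qed.

(** Dynkin's argument starting from boxes; increasing unions are handled by [mixes_approx]. *)
Lemma mixes_indic C : measurable C -> mixes (\1_C).
Proof.
pose H := [set C : set (seqT R) | measurable C /\ mixes (\1_C)].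
suff : (measurable : set (set (seqT R))) `<=` H by move=> + mC => /(_ _ mC)[].
rewrite measurable_boxesE; apply: lambda_system_subset => //.
- exact: boxes_setI_closed.
- split; first by [].
  + split; [exact: measurableT|]; rewrite (_ : setT = box 0 (fun=> setT)).
      by apply: mixes_box.
    by apply/seteqP; split.
  + move=> A B BA [mA xA] [mB xB]; split; first exact: measurableD.
    rewrite (_ : \1_(A `\` B) = fun s => \1_A s + (-1) * \1_B s); last first.
      apply/funext => s; rewrite !indicE in_setD mulN1r.
      have [sB|sB] := boolP (s \in B); last by rewrite andbT subr0.
      have -> : s \in A by move: sB; rewrite !inE => /BA.
      by rewrite /= subrr.
    apply: mixesD; [exact: bmf_indic| | |]; last exact: mixesZ (bmf_indic mB) xB.
      by apply: bmfM; [exact: bmf_cst|exact: bmf_indic].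
    by [].
  + move=> F ndF HF; have mF n : measurable (F n) by case: (HF n).
    have mU : measurable (\bigcup_n F n) by exact: bigcup_measurable.
    split => //; apply: mixes_approx; first exact: bmf_indic.
    move=> e e0.
    have cF := nondecreasing_cvg_mu mF mU ndF.
    have /fine_cvgP[_ /cvgrPdist_le/(_ e e0)[N _ hN]] :
      pi (F n) @[n --> \oo] --> (fine (pi (\bigcup_n F n)))%:E.
      rewrite fineK; first exact: cF.
      exact: fin_num_measure.
    exists (\1_(F N)); split; [exact: bmf_indic|by case: (HF N)|].
    have := hN N (leqnn N); apply: le_trans.
    rewrite /= -(Ex_indic mU) -(Ex_indic (mF N)) -ExB; [|exact: bmf_indic..].
    rewrite ger0_norm; last first.
      apply: Ex_ge0 => s; rewrite subr_ge0 !indicE ler_nat.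
      have [sF|//] := boolP (s \in F N); rewrite (_ : s \in _)//.
      by move: sF; rewrite !inE => sF; exists N.
    rewrite le_eqVlt; apply/orP; left; apply/eqP; apply: eq_Rintegral => s _.
    rewrite ger0_norm//; rewrite subr_ge0 !indicE ler_nat.
    have [sF|//] := boolP (s \in F N); rewrite (_ : s \in _)//.
    by move: sF; rewrite !inE => sF; exists N.
- by move=> _ [N [A [mA ->]]]; split; [exact: measurable_box|exact: mixes_box].
Qed.

(** The count is the minimum of [N] and the integer part of [y], written as a sum of level-set
    indicators so that [mixes_indic] applies. The last conjunct carries the induction. *)
Lemma count_floor (y : R) (N : nat) : 0 <= y -> let c := \sum_(j < N) ((j.+1%:R <= y)%R : bool)%:R : R in
  c <= y /\ (y < N%:R -> y - 1 <= c) /\ (N%:R <= y -> c = N%:R).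
Proof.
move=> y0; elim: N => [|N [c1 [c2 c3]]] /=.
  rewrite big_ord0; split=> //; split=> //; lra.
rewrite big_ord_recr /=; have [Ny|yN] := leP N.+1%:R y.
  have NN : N%:R <= y by rewrite (le_trans _ Ny)// ler_nat.
  by rewrite (c3 NN) natr1; split=> //; split => //; rewrite ltNge Ny.
rewrite addr0; split=> //; split=> // _.
have [|Ny] := ltP y N%:R; first exact: c2.
by rewrite c3// lerBlDr natr1 ltW.
Qed.

Lemma mixes_bmf h : bmf h -> mixes h.
Proof.
move=> bh; have [mh [M hM]] := bh.
have M0 : 0 <= M by rewrite (le_trans _ (hM (fun=> 0))).
apply: mixes_approx => // e e0.
pose y s := (h s + M) / e.
have y0 s : 0 <= y s.
  rewrite divr_ge0 ?(ltW e0)//; have := hM s; rewrite ler_norml; lra.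
pose N := (Num.truncn ((M + M) / e)).+1.
have yN s : y s < N%:R.
  apply: (@le_lt_trans _ _ ((M + M) / e)); last exact: truncnS_gt.
  rewrite ler_pM2r ?invr_gt0// lerD2r; have := hM s; rewrite ler_norml; lra.
pose c s := \sum_(j < N) ((j.+1%:R <= y s)%R : bool)%:R : R.
(* [h + M] rounded down to a multiple of [e], then shifted back: a simple function within [e] of
   [h]. *)
pose h' s := e * c s + (- M).
have my : measurable_fun setT y.
  by apply: measurable_funM => //; apply: measurable_funD.
have bc j : bmf (fun s => ((j.+1%:R <= y s)%R : bool)%:R : R).
  by apply: bmf_bool; exact: measurable_fun_ler.
have bcs : bmf c by apply: bmf_sum => j _; exact: bc.
exists h'; split.
- by apply: bmfD; [apply: bmfM => //; exact: bmf_cst|exact: bmf_cst].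
- apply: mixesD.
  + by apply: bmfM => //; exact: bmf_cst.
  + exact: bmf_cst.
  + apply: mixesZ => //.
    apply: (@mixes_sum N (fun j s => ((j.+1%:R <= y s)%R : bool)%:R)) => // j.
    have mC : measurable [set s | j.+1%:R <= y s].
      rewrite (_ : [set s | _] = [set: seqT R] `&` y @^-1` `[j.+1%:R, +oo[%classic).
        exact: my.
      by rewrite setTI; apply/seteqP; split => s /=; rewrite in_itv/= andbT.
    have := mixes_indic mC; congr mixes; apply/funext => s.
    by rewrite indicE; congr (_%:R); rewrite mem_setE.
  + exact: mixes_cst.
- apply: (@le_trans _ _ (Ex pi (fun=> e))); last by rewrite Ex_cst.
  apply: Ex_le => //.
  + apply: bmf_norm; apply: bmfB => //.
    by apply: bmfD; [apply: bmfM => //; exact: bmf_cst|exact: bmf_cst].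
  + exact: bmf_cst.
  + move=> s; have [c1 [/(_ (yN s)) c2 _]] := count_floor N (y0 s).
    rewrite -/(c s) in c1 c2.
    have hy : h s = e * y s - M by rewrite /y mulrC divfK ?gt_eqF// addrK.
    rewrite /h' hy ler_norml; apply/andP; split; nra.
Qed.

(** The deviation is at most [M + M], so its square is at most that constant times its absolute
    value; the added 1 keeps the divisor positive. *)
Lemma remote_past h (e : R) : bmf h -> 0 < e -> exists K, forall k, (K <= k)%N ->
  Ex pi (fun s => (cE k h s - Ex pi h) ^+ 2) <= e.
Proof.
move=> bh e0; have [_ [M hM]] := bh.
have M0 : 0 <= M by rewrite (le_trans _ (hM (fun=> 0))).
have M1 : 0 < M + M + 1 by rewrite ltr_wpDl// addr_ge0.
have [|K hK] := @mixes_bmf _ bh (e / (M + M + 1)); first by rewrite divr_gt0.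
exists K => k /hK; rewrite ler_pdivlMr//; apply: le_trans.
rewrite -ExZr; last exact: bmf_dev.
apply: Ex_le.
- by apply: bmfX; apply: bmfB; [exact: bmf_cE|exact: bmf_cst].
- by apply: bmfM; [exact: bmf_dev|exact: bmf_cst].
- move=> s; rewrite -real_normK ?num_real// expr2 ler_wpM2l//.
  rewrite (le_trans (ler_normB _ _))// ler_wpDr// lerD//.
    exact: cE_bound.
  exact: Ex_bound.
Qed.

End chain.

(** * The stationary process *)

Section process.
Context {d} {Omega : measurableType d} {R : realType} (P : probability Omega R).
Variables (eps : int -> Omega -> R) (eps0' : Omega -> R) (g : seqT R -> R).
Hypothesis iid : iid_family P (fam eps eps0').
Hypothesis mg : seq_measurable g.

Lemma measurable_g : measurable_fun setT g.
Proof. by move=> _ B mB; rewrite setTI; exact: mg. Qed.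

Let past (i : int) (j : nat) : option int := Some (i - j%:Z).

Let past_inj i : injective (past i).
Proof. by move=> j k [] /addrI/oppr_inj[]. Qed.

Definition Xi (i : int) : Omega -> seqT R := eseq (fam eps eps0') (past i).
Definition rho : probability R R := elaw iid (Some 0).
Definition xilaw : probability (seqT R) R := seqlaw iid (past 0).

Lemma measurable_Xi i : measurable_fun setT (Xi i).
Proof. exact: (measurable_eseq iid). Qed.

Lemma bmf_Xi i (h : seqT R -> R) : bmf h -> bmf (fun w => h (Xi i w)).
Proof. by apply: bmf_comp; exact: measurable_Xi. Qed.

Lemma Ex_Xi i (h : seqT R -> R) : bmf h -> Ex P (fun w => h (Xi i w)) = Ex xilaw h.
Proof. by move=> bh; exact: (Ex_eseq iid (Some 0) (@past_inj i) (@past_inj 0) bh). Qed.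

Lemma prob_Xi i (A : set (seqT R)) : measurable A -> P (Xi i @^-1` A) = xilaw A.
Proof. by move=> mA; exact: (seqlaw_eq iid (Some 0) (@past_inj i) (@past_inj 0) mA). Qed.

Lemma ae_Xi i (Q : seqT R -> Prop) : {ae xilaw, forall s, Q s} ->
  {ae P, forall w, Q (Xi i w)}.
Proof.
move=> [N [mN N0 QN]]; exists (Xi i @^-1` N); split.
- by rewrite -[X in measurable X]setTI; exact: measurable_Xi.
- by rewrite -N0; exact: prob_Xi.
- by move=> w /= nQ; apply: QN.
Qed.

Lemma ae_pi (A : set (seqT R)) : measurable A ->
  {ae P, forall w, A (Xi 0 w)} -> {ae xilaw, forall s, A s}.
Proof.
move=> mA hA; exists (~` A); split => //; first exact: measurableC.
rewrite -[LHS](prob_Xi 0 (measurableC mA)).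
have mB : measurable (Xi 0 @^-1` (~` A)).
  by rewrite -[X in measurable X]setTI; apply: measurable_Xi => //; exact: measurableC.
by apply/negligibleP => //; apply: negligibleS hA.
Qed.

Lemma stail_Xi i w : stail (Xi (i + 1) w) = Xi i w.
Proof.
apply/funext => j; rewrite /stail /Xi /eseq /past /fam.
by congr (eps _ w); rewrite -addn1 PoszD; ring.
Qed.

Lemma scons_Xi i w : Xi (i + 1) w = scons (eps (i + 1) w) (Xi i w).
Proof.
apply/funext => -[|j]; rewrite /Xi /eseq /past /fam /=.
  by rewrite subr0.
by congr (eps _ w); rewrite -addn1 PoszD; ring.
Qed.

Lemma pi_inv (h : seqT R -> R) : bmf h ->
  Ex xilaw h = Ex xilaw (fun s => Ex rho (fun e => h (scons e s))).
Proof.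
move=> bh; rewrite -(Ex_Xi (0 + 1) bh).
under eq_Rintegral do rewrite scons_Xi.
apply: (@Ex_indep _ _ _ _ _ _ iid (Some 0) (past 0) (Some (0 + 1))
  (fun z => h (scons z.1 z.2))); first exact: past_inj.
- by move=> j; rewrite /past; apply/eqP => -[]; lia.
- by apply: bmf_comp bh; apply: measurable_scons.
Qed.

(** The label [None] is absent from [past 0], so the coupled pair is a past together with the same
    past whose head is drawn again independently. *)
Lemma Ex_xi0star (G : seqT R * seqT R -> R) : bmf G ->
  Ex P (fun w => G (xi0 eps w, xi0star eps eps0' w)) =
  Ex xilaw (fun s => Ex rho (fun e => G (s, scons e (stail s)))).
Proof.
move=> bG.
have bz : bmf (fun z : R * seqT R => G (z.2, scons z.1 (stail z.2))).
  apply: bmf_comp bG; apply: measurable_fun_pair => //.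
  by apply: measurable_scons => //; exact: (measurableT_comp measurable_stail).
have <- := Ex_indep iid (Some 0) (@past_inj 0) (fun j => isT : past 0 j != None) bz.
apply: eq_Rintegral => w _; congr G; congr pair.
  by apply/funext => j; rewrite /xi0 /eseq /past /fam /= sub0r.
by apply/funext => -[|j]; rewrite /xi0star /stail /eseq /past /fam /= ?sub0r.
Qed.

Lemma xi0E w : xi0 eps w = Xi 0 w.
Proof. by apply/funext => j; rewrite /xi0 /Xi /eseq /past /= sub0r. Qed.

Lemma futE k s w : fut eps k s w = smerge k s (Xi k%:Z w).
Proof.
apply/funext => j; rewrite /fut /smerge; case: ifPn => // jk.
by rewrite /Xi /eseq /past /fam subzn// ltnW.
Qed.

Lemma Ex_fut k s (h : seqT R -> R) : bmf h ->
  Ex P (fun w => h (fut eps k s w)) = cE xilaw k h s.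
Proof.
move=> bh; rewrite /cE -(Ex_Xi k%:Z (bmf_smerge k s bh)).
by apply: eq_Rintegral => w _; rewrite futE.
Qed.

Definition cosg (th : R) (s : seqT R) : R := cos (th * g s).
Definition sing (th : R) (s : seqT R) : R := sin (th * g s).
Definition leg (x : R) (s : seqT R) : R := ((g s <= x)%R : bool)%:R.

Lemma bmf_cosg th : bmf (cosg th).
Proof. by apply: bmf_cos; apply: measurable_funM => //; exact: measurable_g. Qed.

Lemma bmf_sing th : bmf (sing th).
Proof. by apply: bmf_sin; apply: measurable_funM => //; exact: measurable_g. Qed.

Lemma bmf_leg x : bmf (leg x).
Proof.
by apply: bmf_bool; apply: measurable_fun_ler => //; exact: measurable_g.
Qed.

Lemma condphi_reE k s th : condphi_re P g eps k s th = cE xilaw k (cosg th) s.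
Proof. by rewrite -Ex_fut//; exact: bmf_cosg. Qed.

Lemma condphi_imE k s th : condphi_im P g eps k s th = cE xilaw k (sing th) s.
Proof. by rewrite -Ex_fut//; exact: bmf_sing. Qed.

Lemma Ex_bool d' (T : measurableType d') (Q : probability T R) (p : T -> bool) :
  measurable_fun setT p -> Ex Q (fun t => (p t)%:R) = fine (Q [set t | p t]).
Proof.
move=> mp; have mA : measurable [set t | p t].
  by rewrite -[X in measurable X]setTI; exact: (mp measurableT [set true]).
rewrite -[in RHS](setIT [set t | p t]) -integral_indic//; congr fine.
apply: eq_integral => t _; rewrite indicE; congr (_%:R)%:E.
by rewrite mem_setE.
Qed.

Lemma condFE k s x : condF P g eps k s x = cE xilaw k (leg x) s.
Proof.
rewrite -Ex_fut; last exact: bmf_leg.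
rewrite Ex_bool//; apply: measurable_fun_ler => //.
apply: (measurableT_comp measurable_g).
rewrite (_ : fut _ _ _ = fun w => smerge k s (Xi k%:Z w)); last first.
  by apply/funext => w; exact: futE.
by apply: measurable_smerge => //; exact: measurable_Xi.
Qed.

Lemma distFE x : distF P g eps x = Ex xilaw (leg x).
Proof.
rewrite -(Ex_Xi 0 (bmf_leg x)) Ex_bool//.
apply: measurable_fun_ler => //; apply: (measurableT_comp measurable_g).
exact: measurable_Xi.
Qed.

End process.

(** * Maximal bounds for sums of conditional expectations *)

Section weighted_sums.
Context {R : realFieldType}.

(** The induction step of the weighted Cauchy--Schwarz inequality. It is used once more on its own,
    to append the remainder with weight 1. *)
Lemma weighted_sqrD (x y A B v : R) : 0 <= A -> 0 <= B -> 0 < v ->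
  x ^+ 2 <= A * B -> (x + y) ^+ 2 <= (A + v) * (B + y ^+ 2 / v).
Proof.
move=> A0 B0 v0 xAB.
pose z := y / v; have yE : y = v * z by rewrite /z mulrC divfK ?gt_eqF.
have -> : y ^+ 2 / v = v * z ^+ 2 by rewrite yE; field; rewrite gt_eqF.
have z2 : 0 <= z ^+ 2 by exact: sqr_ge0.
suff : 2 * (x * z) <= A * z ^+ 2 + B.
  by rewrite yE => h; have : v * (2 * (x * z)) <= v * (A * z ^+ 2 + B);
    [rewrite ler_pM2l|nra].
have p0 : 0 <= A * z ^+ 2 + B by rewrite addr_ge0// mulr_ge0.
apply: (le_trans (ler_norm _)).
rewrite -(ler_pXn2r (n := 2))// ?nnegrE ?normr_ge0// real_normK ?num_real//.
have h1 : 4 * (x ^+ 2 * z ^+ 2) <= 4 * (A * B * z ^+ 2).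
  by rewrite ler_pM2l// ler_wpM2r.
have h2 : 0 <= (A * z ^+ 2 - B) ^+ 2 by exact: sqr_ge0.
nra.
Qed.

Lemma weighted_sqr_sum (S v : nat -> R) K : (forall k, 0 < v k) ->
  (\sum_(k < K) S k) ^+ 2 <= (\sum_(k < K) v k) * (\sum_(k < K) S k ^+ 2 / v k).
Proof.
move=> v0; elim: K => [|K ih]; first by rewrite !big_ord0 expr0n mulr0.
rewrite !big_ord_recr/=; apply: weighted_sqrD => //.
  by apply: sumr_ge0 => k _; exact: ltW.
by apply: sumr_ge0 => k _; rewrite divr_ge0 ?sqr_ge0// ltW.
Qed.

Lemma sqr_sum_le (a : nat -> R) m n : (m <= n)%N ->
  (\sum_(i < m) a i) ^+ 2 <= n%:R * \sum_(i < n) a i ^+ 2.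
Proof.
move=> mn; have := @weighted_sqr_sum a (fun=> 1) m (fun=> ltr01).
rewrite sumr_const card_ord => /le_trans; apply.
apply: ler_pM; rewrite ?ler_nat//.
  by apply: sumr_ge0 => k _; rewrite divr_ge0 ?sqr_ge0.
under eq_bigr do rewrite divr1.
rewrite -(big_mkord predT (fun i => a i ^+ 2)).
rewrite -(big_mkord predT (fun i => a i ^+ 2)).
rewrite [leRHS](big_cat_nat (leq0n m) mn)//= lerDl.
by apply: sumr_ge0 => k _; exact: sqr_ge0.
Qed.

Fixpoint rmax (F : nat -> R) n : R :=
  if n is n'.+1 then Num.max (rmax F n') (F n) else F 0%N.

Lemma le_rmax F m n : (m <= n)%N -> F m <= rmax F n.
Proof.
elim: n => [|n ih]; first by rewrite leqn0 => /eqP ->.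
rewrite leq_eqVlt => /predU1P[->|mn] /=; first by rewrite le_max lexx orbT.
by rewrite le_max ih.
Qed.

Lemma rmax_le F n B : (forall m, (m <= n)%N -> F m <= B) -> rmax F n <= B.
Proof.
elim: n => [|n ih] FB /=; first exact: FB.
by rewrite ge_max ih ?FB// => m mn; apply: FB; exact: leqW.
Qed.

End weighted_sums.

Lemma bmf_rmax d (T : measurableType d) (R : realType) (F : nat -> T -> R) n :
  (forall m, bmf (F m)) -> bmf (fun w => rmax (fun m => F m w) n).
Proof. by move=> bF; elim: n => [|n ih] //=; exact: bmf_max. Qed.


Section maximal_bound.
Context {d} {Omega : measurableType d} {R : realType} (P : probability Omega R).
Variables (eps : int -> Omega -> R) (eps0' : Omega -> R).
Hypothesis iid : iid_family P (fam eps eps0').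
Let pi := xilaw iid.
Let rho := rho iid.
Let Xi := Xi eps eps0'.
Let inv := pi_inv iid.
Variables (h : seqT R -> R) (bh : bmf h).

(** The predictable sum: the term [i] is the prediction of [h] at time [i + 1] from the past at time
    [i], hence lag 1 and indices from 0. With [h] a cosine or a sine it is the real or imaginary
    part of [H_m]. *)
Definition csum m (w : Omega) : R :=
  \sum_(i < m) (cE pi 1 h (Xi i%:Z w) - Ex pi h).

Definition coupled k : R := Ex pi (fun s => Ex rho (fun e =>
  (cE pi k h s - cE pi k h (scons e (stail s))) ^+ 2)).

Definition csum_max n (w : Omega) : R := rmax (fun m => csum m w ^+ 2) n.

Lemma bmf_csum m : bmf (csum m).
Proof.
apply: bmf_sum => i _; apply: bmfB; last exact: bmf_cst.
by apply: (bmf_Xi iid); exact: bmf_cE.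
Qed.

Lemma bmf_csum_max n : bmf (csum_max n).
Proof.
by apply: (@bmf_rmax _ _ _ (fun m w => csum m w ^+ 2)) => m; apply: bmfX; exact: bmf_csum.
Qed.

Let part K m w : R := \sum_(i < m) innov pi K.+1 h (Xi (i%:Z - K%:Z) w).
Let rest K m w : R := \sum_(i < m) (cE pi K.+1 h (Xi (i%:Z - K%:Z) w) - Ex pi h).

(** Telescoping in [K]: each step pushes the conditioning one unit into the past and leaves an
    innovation of one further lag. *)
Lemma csum_decomp K m w : csum m w = \sum_(k < K) part k m w + rest K m w.
Proof.
elim: K => [|K ih].
  by rewrite big_ord0 add0r; apply: eq_bigr => i _; rewrite subr0.
rewrite big_ord_recr /= ih -addrA; congr (_ + _).
rewrite /part /rest -big_split; apply: eq_bigr => i _ /=.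
rewrite /innov (_ : stail (Xi (i%:Z - K%:Z) w) = Xi (i%:Z - K.+1%:Z) w); first by ring.
rewrite -[RHS](stail_Xi eps eps0'); congr (stail (Xi _ w)).
by rewrite -addn1 PoszD; ring.
Qed.

(** Shifted by one because the partial sums along a path start at index 1 while [csum] starts at
    0. *)
Let pathx K w (j : nat) := Xi (j%:Z - 1 - K%:Z) w.
Let pathxS K w j : stail (pathx K w j.+1) = pathx K w j.
Proof.
rewrite -[RHS](stail_Xi eps eps0'); congr (stail (Xi _ w)).
by rewrite -addn1 PoszD; ring.
Qed.

(** The running maximum is one-sided, so the innovations and their negatives are both needed to
    bound [part ^ 2], uniformly in [m <= n]. *)
Let env K n w : R := pmax (innov pi K.+1 h) n (pathx K w n) ^+ 2 +
  pmax (fun s => - innov pi K.+1 h s) n (pathx K w n) ^+ 2.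

Let bmf_env K n : bmf (env K n).
Proof.
have bD := bmf_innov pi K.+1 bh.
by apply: bmfD; apply: bmfX; apply: (bmf_Xi iid); apply: bmf_pmax => //; exact: bmfN.
Qed.

Lemma part_le K m n w : (m <= n)%N -> part K m w ^+ 2 <= env K n w.
Proof.
move=> mn; set D := innov pi K.+1 h.
have pE (f : seqT R -> R) : \sum_(1 <= i < m.+1) f (pathx K w i) =
    \sum_(i < m) f (Xi (i%:Z - K%:Z) w).
  rewrite big_add1 big_mkord; apply: eq_bigr => i _; congr (f (Xi _ w)).
  by rewrite -addn1 PoszD; ring.
have h1 := le_pmax_path (@pathxS K w) D mn.
have h2 := le_pmax_path (@pathxS K w) (fun s => - D s) mn.
rewrite pE in h1; rewrite (pE (fun s => - D s)) sumrN in h2.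
rewrite -/(part K m w) in h1 h2; rewrite /env -/D.
have a0 := pmax_ge0 D n (pathx K w n).
have b0 := pmax_ge0 (fun s => - D s) n (pathx K w n).
move: h1 h2 a0 b0; set x := part _ _ _; set a := pmax _ _ _; set b := pmax _ _ _.
move=> xa xb a0 b0; have [x0|/ltW x0] := leP 0 x; nra.
Qed.

Lemma Ex_env K n : Ex P (env K n) <= 8 * n%:R * coupled K.+1.
Proof.
set D := innov pi K.+1 h; have bD : bmf D := bmf_innov pi K.+1 bh.
have bN := bmfN bD.
have b1 := bmfX 2 (bmf_pmax n bD); have b2 := bmfX 2 (bmf_pmax n bN).
rewrite /env ExD; [|exact: (bmf_Xi iid) b1|exact: (bmf_Xi iid) b2].
rewrite (Ex_Xi iid _ b1) (Ex_Xi iid _ b2).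
have D0 s : step rho D s = 0 by exact: step_innov.
have N0 s : step rho (fun s => - D s) s = 0.
  rewrite /step; under eq_Rintegral do rewrite -mulN1r.
  by rewrite ExZ ?[X in _ * X]D0 ?mulr0//; exact: bmf_scons.
have := Doob_L2 inv n bD D0; have := Doob_L2 inv n bN N0.
under [X in _ <= _ * X]eq_Rintegral do rewrite sqrrN.
have := Ex_innov2_le inv K.+1 bh.
rewrite -/pi -/rho -/D -/(coupled K.+1) => hc hN hD.
apply: (le_trans (lerD hD hN)).
rewrite -mulrDl -mulrDl (_ : 4 + 4 = 8); last by ring.
by rewrite ler_wpM2l// mulr_ge0.
Qed.

Let devn K n w : R := n%:R * \sum_(i < n)
  (cE pi K.+1 h (Xi (i%:Z - K%:Z) w) - Ex pi h) ^+ 2.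

Let bdev K : bmf (fun s => (cE pi K.+1 h s - Ex pi h) ^+ 2).
Proof. by apply: bmfX; apply: bmfB; [exact: bmf_cE|exact: bmf_cst]. Qed.

Lemma Ex_devn K n : Ex P (devn K n) =
  n%:R ^+ 2 * Ex pi (fun s => (cE pi K.+1 h s - Ex pi h) ^+ 2).
Proof.
rewrite /devn ExZ; last first.
  by apply: bmf_sum => i _; exact: (bmf_Xi iid _ (bdev K)).
rewrite Ex_sum; last by move=> i _; exact: (bmf_Xi iid _ (bdev K)).
under eq_bigr do rewrite (Ex_Xi iid _ (bdev K)).
by rewrite sumr_const card_ord -[X in _ * X = _]mulr_natl mulrA expr2.
Qed.

(** Here [n] is fixed and [K] grows: the crude factor [n ^ 2] in the mean of [devn] is beaten by
    [remote_past]. The 1 in [V + 1] is the weight of the remainder; 8 is 4 from Doob's inequality,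
    for each of the two signs. *)
Lemma Ex_csum_max n (v : nat -> R) (V B : R) : (forall k, 0 < v k) ->
  (forall K, \sum_(k < K) v k <= V) ->
  (forall K, \sum_(k < K) coupled k.+1 / v k <= B) ->
  Ex P (csum_max n) <= 8 * n%:R * (V + 1) * B.
Proof.
move=> v0 vV cB.
have V0 : 0 <= V by have := vV 0%N; rewrite big_ord0.
have V1 : 0 < V + 1 by rewrite ltr_wpDl.
apply/ler_addgt0Pr => e e0.
have n2 : 0 < (V + 1) * (n%:R ^+ 2 + 1) by rewrite mulr_gt0// ltr_wpDl// sqr_ge0.
have [|K /(_ K.+1 (leqnSn K)) hK] := remote_past inv bh (e := e / ((V + 1) * (n%:R ^+ 2 + 1))).
  by rewrite divr_gt0.
have bS : bmf (fun w => \sum_(k < K) env k n w / v k).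
  by apply: bmf_sum => k _; apply: bmfM => //; exact: bmf_cst.
have bR : bmf (devn K n).
  apply: bmfM; first exact: bmf_cst.
  by apply: bmf_sum => i _; exact: (bmf_Xi iid _ (bdev K)).
apply: (@le_trans _ _ (Ex P (fun w => (V + 1) *
    (\sum_(k < K) env k n w / v k + devn K n w)))).
  apply: Ex_le; first exact: bmf_csum_max.
    by apply: bmfM; [exact: bmf_cst|exact: bmfD].
  move=> w; apply: rmax_le => m mn.
  rewrite (csum_decomp K).
  apply: (@le_trans _ _ ((\sum_(k < K) v k + 1) *
      (\sum_(k < K) part k m w ^+ 2 / v k + rest K m w ^+ 2 / 1))).
    apply: weighted_sqrD => //.
    - by apply: sumr_ge0 => k _; exact: ltW.
    - by apply: sumr_ge0 => k _; rewrite divr_ge0 ?sqr_ge0// ltW.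
    - exact: (@weighted_sqr_sum _ (fun k => part k m w) v K v0).
  have s0 : 0 <= \sum_(k < K) part k m w ^+ 2 / v k.
    by apply: sumr_ge0 => k _; rewrite divr_ge0 ?sqr_ge0// ltW.
  apply: ler_pM.
  - by rewrite addr_ge0//; apply: sumr_ge0 => k _; exact: ltW.
  - by rewrite addr_ge0// divr1 sqr_ge0.
  - by rewrite lerD2r.
  - rewrite divr1 lerD//.
      by apply: ler_sum => k _; rewrite ler_pM2r ?invr_gt0// part_le.
    exact: (@sqr_sum_le _ (fun i => cE pi K.+1 h (Xi (i%:Z - K%:Z) w) - Ex pi h)).
rewrite ExZ; last exact: bmfD.
rewrite ExD// Ex_sum; last by move=> k _; apply: bmfM => //; exact: bmf_cst.
under eq_bigr do rewrite (ExZr P _ (bmf_env _ _)).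
rewrite Ex_devn mulrDr; apply: lerD.
  rewrite [leRHS](_ : _ = (V + 1) * (8 * n%:R * B)); last by ring.
  rewrite ler_pM2l//.
  apply: (@le_trans _ _ (\sum_(k < K) 8 * n%:R * (coupled k.+1 / v k))).
    by apply: ler_sum => k _; rewrite mulrA ler_pM2r ?invr_gt0// Ex_env.
  by rewrite -mulr_sumr ler_wpM2l// mulr_ge0.
move: hK; rewrite ler_pdivlMr//; apply: le_trans.
rewrite [leLHS](_ : _ = Ex pi (fun s => (cE pi K.+1 h s - Ex pi h) ^+ 2) *
  ((V + 1) * n%:R ^+ 2)); last by ring.
apply: ler_wpM2l; first by apply: Ex_ge0 => s; exact: sqr_ge0.
by rewrite ler_pM2l// lerDl.
Qed.

End maximal_bound.

Lemma nneseries_le_bound (R : realType) (u : nat -> \bar R) (B : \bar R) :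
  (forall k, 0 <= u k)%E -> (forall K, \sum_(k < K) u k <= B)%E ->
  (\sum_(k <oo) u k <= B)%E.
Proof.
move=> u0 uB; apply: lime_le; first exact: is_cvg_nneseries.
by apply: nearW => K; rewrite big_mkord.
Qed.

(** * Integration over the frequency *)

Section frequency_integral.
Context {d} {Omega : measurableType d} {R : realType} (P : probability Omega R).
Variables (eps : int -> Omega -> R) (eps0' : Omega -> R) (g : seqT R -> R).
Hypothesis iid : iid_family P (fam eps eps0').
Hypothesis mg : seq_measurable g.
Let pi := xilaw iid.
Let rho := rho iid.
Let Xi := Xi eps eps0'.
Let inv := pi_inv iid.
Notation lam := (@lebesgue_measure R).
Notation measR := (measurableTypeR R).

Let mid : measurable_fun setT (id : R -> measR).
Proof. by move=> _ A mA; rewrite setTI. Qed.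
(** Some probability on the frequency axis, so that [bmf_Ex2] yields joint measurability in the
    frequency and the path. *)
Let nu : probability measR R := law rho mid.

Let mgT : measurable_fun setT g := measurable_g mg.

Lemma bmf_cE_joint (F : measR * seqT R -> R) k : bmf F ->
  bmf (fun z : measR * seqT R => cE pi k (fun s => F (z.1, s)) z.2).
Proof.
move=> bF.

apply: (@bmf_Ex2 _ _ _ _ _ (nu \x pi)%E pi
  (fun y : (measR * seqT R) * seqT R => F (y.1.1, smerge k y.1.2 y.2))).
apply: bmf_comp bF; apply: measurable_fun_pair => //.
  exact: measurableT_comp.
apply: measurable_smerge => //; exact: measurableT_comp.
Qed.

Lemma bmf_cosg_joint : bmf (fun z : measR * seqT R => cosg g z.1 z.2).
Proof.
by apply: bmf_cos; apply: measurable_funM => //; exact: (measurableT_comp mgT).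
Qed.

Lemma bmf_sing_joint : bmf (fun z : measR * seqT R => sing g z.1 z.2).
Proof.
by apply: bmf_sin; apply: measurable_funM => //; exact: (measurableT_comp mgT).
Qed.

Section one_kernel.
Variables (F : measR * seqT R -> R) (bF : bmf F).
Let h th s := F (th, s).

Lemma bmf_csum_joint m : bmf (fun z : measR * Omega => csum iid (h z.1) m z.2).
Proof.
apply: bmf_sum => i _; apply: bmfB.
  apply: (@bmf_comp _ _ _ _ _ (fun y : measR * seqT R => cE pi 1 (h y.1) y.2)
    (fun z : measR * Omega => (z.1, Xi i%:Z z.2))); last exact: bmf_cE_joint.
  by apply: measurable_fun_pair => //; apply: measurableT_comp => //;
    exact: (measurable_Xi iid).

exact: (@bmf_comp _ _ _ _ _ _ fst _ (bmf_Ex2 nu pi bF)).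
Qed.

Lemma bmf_csum_max_joint n : bmf (fun z : measR * Omega => csum_max iid (h z.1) n z.2).
Proof.
apply: (@bmf_rmax _ _ _ (fun m (z : measR * Omega) => csum iid (h z.1) m z.2 ^+ 2)).
by move=> m; apply: bmfX; exact: bmf_csum_joint.
Qed.

Lemma bmf_coupled k : bmf (fun th : measR => coupled iid (h th) k).
Proof.

apply: (@bmf_Ex2 _ _ _ _ _ nu pi (fun z => Ex rho (fun e =>
  (cE pi k (h z.1) z.2 - cE pi k (h z.1) (scons e (stail z.2))) ^+ 2))).
apply: (@bmf_Ex2 _ _ _ _ _ (nu \x pi)%E rho (fun y : (measR * seqT R) * R =>
  (cE pi k (h y.1.1) y.1.2 - cE pi k (h y.1.1) (scons y.2 (stail y.1.2))) ^+ 2)).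
apply: bmfX; apply: bmfB.
  exact: (@bmf_comp _ _ _ _ _ _ fst _ (bmf_cE_joint k bF)).
apply: (@bmf_comp _ _ _ _ _ (fun y : measR * seqT R => cE pi k (h y.1) y.2)
  (fun y : (measR * seqT R) * R => (y.1.1, scons y.2 (stail y.1.2))));
  last exact: bmf_cE_joint.
apply: measurable_fun_pair; first exact: measurableT_comp.
apply: measurable_scons => //; apply: (measurableT_comp measurable_stail).
exact: measurableT_comp.
Qed.

End one_kernel.

Lemma coupled_ge0 (h : seqT R -> R) k : 0 <= coupled iid h k.
Proof. by apply: Ex_ge0 => s; apply: Ex_ge0 => e; exact: sqr_ge0. Qed.

Lemma csum_max_ge0 (h : seqT R -> R) n w : 0 <= csum_max iid h n w.
Proof. by apply: le_trans (le_rmax _ (leq0n n)); exact: sqr_ge0. Qed.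

Lemma phidiff2E k th : phidiff2 P g eps eps0' k th =
  (coupled iid (cosg g th) k + coupled iid (sing g th) k)%:E.
Proof.
pose G (h : seqT R -> R) (z : seqT R * seqT R) := (cE pi k h z.1 - cE pi k h z.2) ^+ 2.
have bG h : bmf h -> bmf (G h).
  by move=> bh; apply: bmfX; apply: bmfB; [exact: (@bmf_comp _ _ _ _ _ _ fst _ (bmf_cE pi k bh))|exact: (@bmf_comp _ _ _ _ _ _ snd _ (bmf_cE pi k bh))].
have mxi : measurable_fun setT (fun w => (xi0 eps w : seqT R, xi0star eps eps0' w : seqT R)).
  have me i : measurable_fun setT (eps i) by case: iid => /(_ (Some i)).
  have m0 : measurable_fun setT eps0' by case: iid => /(_ None).
  apply: measurable_fun_pair; apply: measurable_to_seq => j; first exact: me.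
  by rewrite /xi0star; case: j => [//|j] /=; exact: me.
have bGx h : bmf h -> bmf (fun w => G h (xi0 eps w, xi0star eps eps0' w)).
  by move=> bh; exact: (bmf_comp mxi (bG _ bh)).
rewrite /phidiff2.
under eq_integral do rewrite !(condphi_reE iid mg) !(condphi_imE iid mg).
rewrite -(@EFin_Ex _ _ _ P (fun w => G (cosg g th) (xi0 eps w, xi0star eps eps0' w) +
  G (sing g th) (xi0 eps w, xi0star eps eps0' w))); last first.
  by apply: bmfD; apply: bGx; [exact: bmf_cosg|exact: bmf_sing].
rewrite ExD; [|by apply: bGx; exact: bmf_cosg|by apply: bGx; exact: bmf_sing].
rewrite (Ex_xi0star iid (bG _ (bmf_cosg mg th))).
by rewrite (Ex_xi0star iid (bG _ (bmf_sing mg th))).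
Qed.

Definition Lam n (w : Omega) : \bar R := (\int[lam]_th ((1 + th ^+ 2) *
  (csum iid (cosg g th) n w ^+ 2 + csum iid (sing g th) n w ^+ 2))%:E)%E.

(** With the maximum inside the frequency integral, [Lmax n] dominates [Lam m] for all [m <= n], and
    Tonelli's theorem reduces its mean to the bound at a fixed frequency. *)
Definition Lmax n (w : Omega) : \bar R := (\int[lam]_th ((1 + th ^+ 2) *
  (csum_max iid (cosg g th) n w + csum_max iid (sing g th) n w))%:E)%E.

Let q0 (th : R) : 0 <= 1 + th ^+ 2. Proof. by rewrite addr_ge0// sqr_ge0. Qed.
Let mq : measurable_fun setT (fun th : measR => 1 + th ^+ 2).
Proof. by apply: measurable_funD => //; exact: measurable_funX. Qed.

Let mLmax n : measurable_fun setT (fun z : measR * Omega => ((1 + z.1 ^+ 2) *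
  (csum_max iid (cosg g z.1) n z.2 + csum_max iid (sing g z.1) n z.2))%:E).
Proof.
apply/measurable_EFinP; apply: measurable_funM; first exact: (measurableT_comp mq).
apply: measurable_funD.
  exact: (bmf_measurable (bmf_csum_max_joint bmf_cosg_joint n)).
exact: (bmf_measurable (bmf_csum_max_joint bmf_sing_joint n)).
Qed.

Lemma measurable_Lmax n : measurable_fun setT (Lmax n).
Proof.
apply: (measurable_fun_fubini_tonelli_G (fun z : measR * Omega => ((1 + z.1 ^+ 2) *
  (csum_max iid (cosg g z.1) n z.2 + csum_max iid (sing g z.1) n z.2))%:E)) => //.
by move=> z; rewrite lee_fin mulr_ge0// addr_ge0// csum_max_ge0.
Qed.

Lemma Lmax_ge0 n w : (0 <= Lmax n w)%E.
Proof.
by apply: integral_ge0 => th _; rewrite lee_fin mulr_ge0// addr_ge0// csum_max_ge0.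
Qed.

Lemma Lam_ge0 n w : (0 <= Lam n w)%E.
Proof.
by apply: integral_ge0 => th _; rewrite lee_fin mulr_ge0// addr_ge0// sqr_ge0.
Qed.

Lemma measurable_csum_th (F : measR * seqT R -> R) m w : bmf F ->
  measurable_fun setT (fun th : measR => csum iid (fun s => F (th, s)) m w).
Proof.
by move=> bF; exact: (bmf_measurable (bmf_pair1 w (bmf_csum_joint bF m))).
Qed.

Lemma Lam_le_Lmax m n w : (m <= n)%N -> (Lam m w <= Lmax n w)%E.
Proof.
move=> mn; apply: ge0_le_integral => //.
- by move=> th _; rewrite lee_fin mulr_ge0// addr_ge0// sqr_ge0.
- apply/measurable_EFinP; apply: measurable_funM => //.
  apply: measurable_funD; apply: measurable_funX.
    exact: (measurable_csum_th m w bmf_cosg_joint).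
  exact: (measurable_csum_th m w bmf_sing_joint).
- exact: (measurableT_comp (mLmax n) (@measurable_pair2 _ _ measR Omega w)).
- move=> th _; rewrite lee_fin ler_wpM2l// lerD//.
    exact: (@le_rmax _ (fun m => csum iid (cosg g th) m w ^+ 2)).
  exact: (@le_rmax _ (fun m => csum iid (sing g th) m w ^+ 2)).
Qed.

Let a k : R := Num.sqrt (fine (Ik P g eps eps0' k.+1)).
Hypothesis Ifin : forall k : nat, (1 <= k)%N -> (Ik P g eps eps0' k < +oo)%E.
Hypothesis Isum : cvg (series a @ \oo).

(** Since [a k] is the square root of the frequency integral of order [k + 1], dividing that
    integral by [v k] leaves at most [a k]. The geometric term keeps the weights positive and
    summable. *)
Let v k : R := a k + 2^-1 ^+ k.+1.
Let v0 k : 0 < v k. Proof. by rewrite ltr_wpDl ?sqrtr_ge0// exprn_gt0. Qed.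

Let asum K : \sum_(k < K) a k <= limn (series a).
Proof.
have := @nondecreasing_cvgn_le _ (series a) _ Isum K.
rewrite /series /= big_mkord; apply.
by apply: nondecreasing_series => k _ _; exact: sqrtr_ge0.
Qed.

Let V := limn (series a) + 1.
Let vV K : \sum_(k < K) v k <= V.
Proof.
rewrite big_split /=; apply: lerD; first exact: asum.
have -> : \sum_(k < K) 2^-1 ^+ k.+1 = 1 - 2^-1 ^+ K :> R.
  elim: K => [|K ih]; first by rewrite big_ord0 expr0 subrr.
  by rewrite big_ord_recr/= ih exprS; field.
by rewrite lerBlDr lerDl exprn_ge0.
Qed.

Let L0 : 0 <= limn (series a).
Proof. by have := asum 0; rewrite big_ord0. Qed.

Let Ik_ge0 k : (0 <= Ik P g eps eps0' k)%E.
Proof.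
apply: integral_ge0 => th _; rewrite phidiff2E -EFinM lee_fin mulr_ge0//.
by rewrite addr_ge0// coupled_ge0.
Qed.

Let Ik_v k : (((v k)^-1)%:E * Ik P g eps eps0' k.+1 <= (a k)%:E)%E.
Proof.
rewrite -[X in (_ * X)%E]fineK; last by rewrite ge0_fin_numE ?Ifin.
rewrite -EFinM lee_fin ler_pdivrMl//.
rewrite -[leLHS]sqr_sqrtr ?fine_ge0// -/(a k) expr2 ler_wpM2r ?sqrtr_ge0//.
by rewrite lerDl exprn_ge0.
Qed.

Let wsum (th : measR) : \bar R :=
  (\sum_(k <oo) ((v k)^-1)%:E * phidiff2 P g eps eps0' k.+1 th)%E.

Let term_ge0 k (th : R) : (0 <= ((v k)^-1)%:E * phidiff2 P g eps eps0' k.+1 th)%E.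
Proof.
rewrite phidiff2E -EFinM lee_fin mulr_ge0 ?invr_ge0 ?(ltW (v0 k))//.
by rewrite addr_ge0// coupled_ge0.
Qed.

Let Ex_max_le n th :
  ((Ex P (csum_max iid (cosg g th) n) + Ex P (csum_max iid (sing g th) n))%:E <=
  (16 * n.+1%:R * (V + 1))%:E * wsum th)%E.
Proof.
have V1 : 0 < V + 1 by rewrite /V ltr_wpDl// addr_ge0.
(* Using [n.+1] instead of [n] keeps this factor positive, so the bound is [+oo] at frequencies
   where the weighted series diverges. *)
have cn : 0 < 16 * n.+1%:R * (V + 1) by rewrite !mulr_gt0.
have w0 : (0 <= wsum th)%E by apply: nneseries_ge0 => k _ _; exact: term_ge0.
have [woo|] := ltP (wsum th) +oo%E; last first.
  by rewrite leye_eq => /eqP ->; rewrite gt0_muley ?leey// lte_fin.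
set B := fine (wsum th).
have wB : wsum th = B%:E by rewrite fineK// ge0_fin_numE.
have part K (c : nat -> R) : (forall k, c k <= coupled iid (cosg g th) k + coupled iid (sing g th) k) ->
    \sum_(k < K) c k.+1 / v k <= B.
  move=> cle; rewrite -lee_fin -wB.
  apply: (@le_trans _ _ (\sum_(0 <= k < K) ((v k)^-1)%:E * phidiff2 P g eps eps0' k.+1 th)%E).
    rewrite big_mkord; under [leRHS]eq_bigr do rewrite phidiff2E -EFinM.
    rewrite sumEFin lee_fin; apply: ler_sum => k _.
    by rewrite mulrC ler_pM2l ?invr_gt0.
  by apply: nneseries_lim_ge => k _ _; exact: term_ge0.
have B0 : 0 <= B by apply: fine_ge0.
have hc : Ex P (csum_max iid (cosg g th) n) <= 8 * n%:R * (V + 1) * B.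
  apply: Ex_csum_max (v0) vV _ => [|K]; first exact: bmf_cosg.
  by apply: part => k; rewrite lerDl coupled_ge0.
have hs : Ex P (csum_max iid (sing g th) n) <= 8 * n%:R * (V + 1) * B.
  apply: Ex_csum_max (v0) vV _ => [|K]; first exact: bmf_sing.
  by apply: part => k; rewrite lerDr coupled_ge0.
rewrite wB -EFinM lee_fin; apply: (le_trans (lerD hc hs)).
rewrite -mulrDl -mulrDl -mulrDl ler_wpM2r// ler_wpM2r ?(ltW V1)//.
by rewrite (_ : 8 + 8 = 16); [rewrite ler_pM2l// ler_nat|ring].
Qed.

Let mphi k : measurable_fun setT (fun th : measR => phidiff2 P g eps eps0' k th).
Proof.
rewrite (_ : (fun th => _) = fun th =>
  (coupled iid (cosg g th) k + coupled iid (sing g th) k)%:E); last first.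
  by apply/funext => th; rewrite phidiff2E.
apply/measurable_EFinP; apply: measurable_funD.
  exact: (bmf_measurable (bmf_coupled bmf_cosg_joint k)).
exact: (bmf_measurable (bmf_coupled bmf_sing_joint k)).
Qed.

Lemma integral_Lmax : exists2 C : R, 0 <= C &
  forall n, (\int[P]_w Lmax n w <= (C * n.+1%:R)%:E)%E.
Proof.
exists (16 * (V + 1) * limn (series a)).
  by rewrite !mulr_ge0// /V !addr_ge0.
move=> n.
pose G (z : measR * Omega) := ((1 + z.1 ^+ 2) *
  (csum_max iid (cosg g z.1) n z.2 + csum_max iid (sing g z.1) n z.2))%:E.
have G0 z : (0 <= G z)%E by rewrite lee_fin mulr_ge0// addr_ge0// csum_max_ge0.
have mG : measurable_fun setT G := mLmax n.
have -> : (\int[P]_w Lmax n w = \int[lam]_th \int[P]_w G (th, w))%E.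
  by rewrite (fubini_tonelli G).
have c0 : 0 <= 16 * n.+1%:R * (V + 1) by rewrite !mulr_ge0// /V !addr_ge0.
(* Once the series and the frequency integral are exchanged, what remains is the sum of the
   [Ik / v], bounded by the sum of the [a k]. *)
apply: (@le_trans _ _ (\int[lam]_th ((16 * n.+1%:R * (V + 1))%:E *
   \sum_(k <oo) (((v k)^-1)%:E * ((1 + th ^+ 2)%:E * phidiff2 P g eps eps0' k.+1 th))))%E).
  apply: ge0_le_integral => //.
  - by move=> th _; apply: integral_ge0 => w _.
  - exact: (measurable_fun_fubini_tonelli_F G).
  - apply: measurable_funeM; apply: ge0_emeasurable_sum => [k th _ _|k _].
      by rewrite muleCA mule_ge0// ?lee_fin// term_ge0.
    apply: measurable_funeM; apply: emeasurable_funM => //.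
    exact/measurable_EFinP.
  - move=> th _; rewrite /G /=.
    have bc := bmf_csum_max iid (bmf_cosg mg th) n.
    have bs := bmf_csum_max iid (bmf_sing mg th) n.
    rewrite -(@EFin_Ex _ _ _ P (fun w => (1 + th ^+ 2) *
      (csum_max iid (cosg g th) n w + csum_max iid (sing g th) n w))); last first.
      by apply: bmfM; [exact: bmf_cst|exact: bmfD].
    rewrite ExZ; last exact: bmfD.
    rewrite ExD// EFinM.
    under eq_eseriesr do rewrite muleCA.
    rewrite nneseriesZl; last by move=> k _; exact: term_ge0.
    by rewrite muleCA lee_wpmul2l ?lee_fin// Ex_max_le.
rewrite ge0_integralZl_EFin//; last 2 first.
- move=> th _; apply: nneseries_ge0 => k _ _.
  by rewrite muleCA mule_ge0// ?lee_fin// term_ge0.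
- apply: ge0_emeasurable_sum => [k th _ _|k _].
    by rewrite muleCA mule_ge0// ?lee_fin// term_ge0.
  apply: measurable_funeM; apply: emeasurable_funM => //.
  exact/measurable_EFinP.
rewrite (_ : 16 * (V + 1) * limn (series a) * n.+1%:R =
  16 * n.+1%:R * (V + 1) * limn (series a)); last by ring.
rewrite [leRHS]EFinM lee_wpmul2l ?lee_fin//.
rewrite integral_nneseries//; last 2 first.
- move=> k; apply: measurable_funeM; apply: emeasurable_funM => //.
  exact/measurable_EFinP.
- by move=> k th _; rewrite muleCA mule_ge0// ?lee_fin// term_ge0.
apply: nneseries_le_bound.
  move=> k; apply: integral_ge0 => th _.
  by rewrite muleCA mule_ge0// ?lee_fin// term_ge0.
move=> K; apply: (@le_trans _ _ (\sum_(k < K) (a k)%:E)%E).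
  apply: lee_sum => k _; rewrite ge0_integralZl_EFin//.
  - by move=> th _; rewrite phidiff2E -EFinM lee_fin mulr_ge0// addr_ge0// coupled_ge0.
  - apply: emeasurable_funM => //; exact/measurable_EFinP.
  - by rewrite invr_ge0 ltW.
by rewrite sumEFin lee_fin asum.
Qed.

End frequency_integral.

(** * Growth rates from dyadic blocks *)

Section logarithms.
Context {R : realType}.

Lemma ln2_ge : 2^-1 <= ln (2 : R).
Proof.
have : ln (1 + - (2^-1 : R)) <= - 2^-1 by apply: le_ln1Dx; lra.
rewrite (_ : 1 + - 2^-1 = 2^-1 :> R); last by field.
by rewrite lnV ?posrE// lerN2.
Qed.

Lemma near_ln_ge (M : R) : \forall n \near \oo, M <= ln (n%:R : R).
Proof.
near=> n; rewrite -[leLHS]expRK ler_ln ?posrE ?expR_gt0//.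
  by near: n; exact: nbhs_infty_ger.
by rewrite ltr0n; near: n; exact: nbhs_infty_gt.
Unshelve. all: by end_near. Qed.

Lemma near_lnln_ge (M : R) : \forall n \near \oo, M <= ln (ln (n%:R : R)).
Proof.
near=> n.
have h : expR M <= ln (n%:R : R) by near: n; exact: near_ln_ge.
by rewrite -[leLHS]expRK ler_ln ?posrE ?expR_gt0// (lt_le_trans (expR_gt0 M)).
Unshelve. all: by end_near. Qed.

Lemma ln_nat_ge0 n : 0 <= ln (n%:R : R).
Proof.
by case: n => [|n]; [rewrite ln0|apply: ln_ge0; rewrite ler1n].
Qed.

(* Junk values make the terms [r = 0, 1] vanish. *)
Definition bertrand (r : nat) : R := (r%:R * ln (r%:R : R) ^+ 2)^-1.

Lemma bertrand_ge0 r : 0 <= bertrand r.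
Proof. by rewrite invr_ge0 mulr_ge0// sqr_ge0. Qed.

(** The difference of inverse logarithms is [ln (r + 1) - ln r] over the product of the logarithms,
    and its numerator is at least [1 / (r + 1)]. *)
Lemma bertrand_telescope r : (2 <= r)%N ->
  bertrand r.+1 <= (ln (r%:R : R))^-1 - (ln (r.+1%:R : R))^-1.
Proof.
move=> r2.
have r0 : 0 < r%:R :> R by rewrite ltr0n (leq_trans _ r2).
have l0 : 0 < ln (r%:R : R) by rewrite ln_gt0// ltr1n.
have l1 : ln (r%:R : R) <= ln (r.+1%:R : R) by rewrite ler_ln ?posrE// ler_nat.
have l2 : 0 < ln (r.+1%:R : R) by exact: lt_le_trans l1.
have d : r.+1%:R^-1 <= ln (r.+1%:R : R) - ln (r%:R : R).
  have : ln (1 + - (r.+1%:R^-1 : R)) <= - r.+1%:R^-1.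
    by apply: le_ln1Dx; rewrite ltrN2 invf_lt1// ltr1n ltnS (leq_trans _ r2).
  rewrite (_ : 1 + - r.+1%:R^-1 = r%:R / r.+1%:R :> R); last first.
    by rewrite -[in RHS](addrK 1 r%:R) natr1 mulrBl divff ?gt_eqF// div1r.
  by rewrite ln_div ?posrE// lerNr opprB.
rewrite /bertrand invfM.
set x := ln (r%:R : R) in l0 l1 d *; set y := ln (r.+1%:R : R) in l1 l2 d *.
have -> : x^-1 - y^-1 = (y - x) / (x * y) by field; rewrite !gt_eqF.
apply: ler_pM => //; rewrite ?invr_ge0 ?sqr_ge0//.
by rewrite lef_pV2 ?posrE ?mulr_gt0// ?exprn_gt0// expr2 ler_pM2r.
Qed.

Lemma bertrand_sum : exists B : R, forall K, \sum_(r < K) bertrand r <= B.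
Proof.
exists (bertrand 2 + (ln (2 : R))^-1).
have b0 : bertrand 0 = 0 by rewrite /bertrand mul0r invr0.
have b1 : bertrand 1 = 0 by rewrite /bertrand ln1 expr0n mulr0 invr0.
have i0 : 0 <= (ln (2 : R))^-1 by rewrite invr_ge0 (ln_nat_ge0 2).
have B0 := bertrand_ge0 2.
case=> [|[|[|K]]]; rewrite ?big_ord_recr/= ?big_ord0 ?b0 ?b1 ?addr0 ?add0r//; [lra..|].
suff : \sum_(r < K.+3) bertrand r <= bertrand 2 + (ln (2 : R))^-1 - (ln (K.+2%:R : R))^-1.
  rewrite !big_ord_recr/= => /le_trans; apply.
  by rewrite lerBlDr lerDl invr_ge0 ln_nat_ge0.
elim: K => [|K ih].
  by rewrite !big_ord_recr/= big_ord0 b0 b1 !add0r addrK.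
rewrite big_ord_recr/=.
have := @bertrand_telescope K.+2 isT; lra.
Qed.

End logarithms.

Section dyadic.
Context {d} {Omega : measurableType d} {R : realType} (P : probability Omega R).

Lemma summable_terms_small (u : nat -> \bar R) (e : R) : (forall r, 0 <= u r)%E ->
  (\sum_(r <oo) u r < +oo)%E -> 0 < e -> exists N, forall r, (N <= r)%N -> (u r <= e%:E)%E.
Proof.
move=> u0 ufin e0.
have S0 : (0 <= \sum_(r <oo) u r)%E by apply: nneseries_ge0 => *; exact: u0.
have ub K : (\sum_(0 <= r < K) u r <= \sum_(r <oo) u r)%E.
  by apply: nneseries_lim_ge => *; exact: u0.
have uf r : u r \is a fin_num.
  rewrite ge0_fin_numE//; apply: le_lt_trans ufin; apply: le_trans (ub r.+1).
  by rewrite big_nat_recr//= leeDr// sume_ge0.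
have : cvgn (series (fun r => fine (u r))).
  apply: nondecreasing_is_cvgn.
    by apply: nondecreasing_series => r _ _; exact: fine_ge0.
  exists (fine (\sum_(r <oo) u r)) => _ [K _ <-].
  rewrite -lee_fin fineK; last by rewrite ge0_fin_numE.
  rewrite /series /= -sumEFin; apply: le_trans (ub K).
  by rewrite le_eqVlt; apply/orP; left; apply/eqP; apply: eq_bigr => r _; rewrite fineK.
move=> /cvg_series_cvg_0/cvgrPdist_le/(_ e e0)[N _ hN].
exists N => r /hN /=; rewrite sub0r normrN -[X in (X <= _)%E]fineK// lee_fin.
by apply: le_trans; exact: ler_norm.
Qed.

(** The series of the [Y (2 ^ r)] divided by [2 ^ r * r * ln r ^ 2] has finite mean, so it converges
    almost surely and its terms tend to 0. *)
Lemma ae_dyadic_growth (Y : nat -> Omega -> \bar R) (C : R) :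
  (forall n, measurable_fun setT (Y n)) -> (forall n w, 0 <= Y n w)%E ->
  0 <= C -> (forall n, \int[P]_w Y n w <= (C * n.+1%:R)%:E)%E ->
  {ae P, forall w, forall e : R, 0 < e -> exists N, forall r, (N <= r)%N ->
    (Y (2 ^ r)%N w <= (e * ((2 ^ r)%:R * (r%:R * ln (r%:R : R) ^+ 2)))%:E)%E}.
Proof.
move=> mY Y0 C0 YC.
pose c r : R := (2 ^ r)%:R^-1 * bertrand r.
have c0 r : 0 <= c r by apply: mulr_ge0; [rewrite invr_ge0|exact: bertrand_ge0].
pose S w : \bar R := (\sum_(r <oo) (c r)%:E * Y (2 ^ r)%N w)%E.
have t0 r w : (0 <= (c r)%:E * Y (2 ^ r)%N w)%E by rewrite mule_ge0 ?lee_fin.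
have mS : measurable_fun setT S.
  by apply: ge0_emeasurable_sum => [*|r _]; [exact: t0|exact: measurable_funeM].
have S0 w : (0 <= S w)%E by apply: nneseries_ge0 => *; exact: t0.
have [B hB] := @bertrand_sum R.
have iS : P.-integrable setT S.
  apply/integrableP; split => //.
  under eq_integral do rewrite gee0_abs//.
  rewrite integral_nneseries//; last by move=> r; exact: measurable_funeM.
  apply: (@le_lt_trans _ _ (2 * C * B)%:E); last exact: ltry.
  apply: nneseries_le_bound => [r|K]; first by apply: integral_ge0.
  apply: (@le_trans _ _ (\sum_(r < K) (2 * C * bertrand r)%:E)%E); last first.
    by rewrite sumEFin lee_fin -mulr_sumr ler_wpM2l// mulr_ge0.
  apply: lee_sum => r _; rewrite ge0_integralZl_EFin//.
  apply: (@le_trans _ _ ((c r)%:E * (C * (2 ^ r).+1%:R)%:E)%E).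
    by rewrite lee_wpmul2l// lee_fin.
  rewrite -EFinM lee_fin /c.
  have p0 : 0 < (2 ^ r)%:R :> R by rewrite ltr0n expn_gt0.
  rewrite [leLHS](_ : _ = (bertrand r * C) * ((2 ^ r).+1%:R / (2 ^ r)%:R)); last by ring.
  rewrite [leRHS](_ : _ = (bertrand r * C) * 2); last by ring.
  rewrite ler_wpM2l ?mulr_ge0 ?bertrand_ge0// ler_pdivrMr// -natrM ler_nat.
  by rewrite mul2n -addnn -addn1 leq_add2l expn_gt0.
apply: filterS (integrable_ae measurableT iS) => w /(_ Logic.I) Sw e e0.
have [|N hN] := @summable_terms_small (fun r => (c r)%:E * Y (2 ^ r)%N w)%E e (t0^~ w) _ e0.
  by move: Sw; rewrite ge0_fin_numE.
exists (maxn N 2) => r; rewrite geq_max => /andP[/hN + r2].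
have r0 : 0 < r%:R * ln (r%:R : R) ^+ 2.
  by rewrite mulr_gt0 ?ltr0n ?(leq_trans _ r2)// exprn_gt0// ln_gt0// ltr1n.
have p0 : 0 < (2 ^ r)%:R :> R by rewrite ltr0n expn_gt0.
have -> : c r = ((2 ^ r)%:R * (r%:R * ln (r%:R : R) ^+ 2))^-1.
  by rewrite /c /bertrand -invfM.
rewrite lee_pdivrMl; last exact: mulr_gt0.
by rewrite -EFinM mulrC.
Qed.

(** The constant 54 is 2 times 3 times 9, from [2 ^ r <= 2 n], [r <= 3 ln n] and
    [ln r <= 3 ln (ln n)]. *)
Lemma dyadic_bound (n r : nat) : 1 <= ln (ln (n%:R : R)) ->
  r = (trunc_log 2 n).+1 ->
  (2 ^ r)%:R * (r%:R * ln (r%:R : R) ^+ 2) <=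
  54 * (n%:R * ln (n%:R : R) * ln (ln (n%:R : R)) ^+ 2).
Proof.
move=> LL rE.
set l := ln (n%:R : R); set ll := ln l.
have l1 : 1 <= l.
  rewrite leNgt; apply/negP => l1; move: LL; rewrite leNgt => /negP; apply.
  have [l0|l0] := leP l 0; first by rewrite ln0.
  rewrite -[ltRHS](expRK 1) ltr_ln ?posrE ?expR_gt0// (lt_le_trans l1)//.
  by rewrite -expR0 ler_expR.
have n0 : (0 < n)%N.
  by rewrite lt0n; apply/eqP => nE; move: l1; rewrite /l nE ln0// ler10.
have h2 : (2 ^ r)%:R <= 2 * n%:R :> R.
  by rewrite rE expnS natrM ler_pM2l// ler_nat trunc_logP.
have hr : r%:R <= 3 * l.
  have : (trunc_log 2 n)%:R * ln (2 : R) <= l.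
    rewrite mulrC mulr_natr -lnXn// /l ler_ln ?posrE ?ltr0n ?exprn_gt0//.
    by rewrite -natrX ler_nat trunc_logP.
  have : (trunc_log 2 n)%:R * 2^-1 <= (trunc_log 2 n)%:R * ln (2 : R).
    by rewrite ler_wpM2l// ln2_ge.
  rewrite rE -(natr1 (trunc_log 2 n)); set t := (trunc_log 2 n)%:R.
  move=> h1 h2'; lra.
have r0 : 0 < r%:R :> R by rewrite rE ltr0n.
have hl : ln (r%:R : R) <= 3 * ll.
  apply: (@le_trans _ _ (ln (3 * l))).
    by rewrite ler_ln ?posrE// mulr_gt0// (lt_le_trans _ l1).
  rewrite lnM ?posrE//; last by rewrite (lt_le_trans _ l1).
  have : ln (1 + 2 : R) <= 2 by apply: le_ln1Dx; lra.
  rewrite (_ : 1 + 2 = 3 :> R); last by ring.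
  by move: LL; rewrite -/l -/ll; lra.
have lr0 : 0 <= ln (r%:R : R) by exact: ln_nat_ge0.
have L2 : ln (r%:R : R) ^+ 2 <= 9 * ll ^+ 2.
  by rewrite (_ : 9 * ll ^+ 2 = (3 * ll) ^+ 2); [rewrite lerXn2r// nnegrE (le_trans lr0)|ring].
rewrite [leRHS](_ : _ = (2 * n%:R) * ((3 * l) * (9 * ll ^+ 2))); last by ring.
by apply: ler_pM => //; [rewrite mulr_ge0// sqr_ge0|apply: ler_pM => //; exact: sqr_ge0].
Qed.

Lemma ae_growth (Y Z : nat -> Omega -> \bar R) (C : R) :
  (forall n, measurable_fun setT (Y n)) -> (forall n w, 0 <= Y n w)%E ->
  0 <= C -> (forall n, \int[P]_w Y n w <= (C * n.+1%:R)%:E)%E ->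
  (forall m n w, (m <= n)%N -> (Z m w <= Y n w)%E) ->
  {ae P, forall w, forall e : R, 0 < e -> \forall n \near \oo,
    (Z n w <= (e * (n%:R * ln (n%:R : R) * ln (ln (n%:R : R)) ^+ 2))%:E)%E}.
Proof.
move=> mY Y0 C0 YC ZY; have := ae_dyadic_growth mY Y0 C0 YC.
apply: filterS => w hw e e0.
have [|N hN] := hw (e / 54); first by rewrite divr_gt0.
near=> n.
pose r := (trunc_log 2 n).+1.
have Nr : (N <= r)%N.
  apply: leqW; apply: trunc_log_max => //.
  by near: n; exact: nbhs_infty_ge.
have nr : (n <= 2 ^ r)%N by apply: ltnW; exact: trunc_log_ltn.
apply: (le_trans (ZY _ _ w nr)); apply: (le_trans (hN r Nr)).
rewrite lee_fin -mulrA ler_pM2l// ler_pdivrMl//.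
apply: dyadic_bound => //.
by near: n; exact: near_lnln_ge.
Unshelve. all: by end_near. Qed.

End dyadic.

(** * Exponential bounds for the martingale part *)

(** From [1 - x <= exp (- x)], as [(1 - x) (1 + x + 2 x ^ 2) = 1 + x ^ 2 (1 - 2 x)] is at least 1 in
    this range. *)
Lemma expR_le_quadratic (R : realType) (x : R) : x <= 2^-1 -> expR x <= 1 + x + 2 * x ^+ 2.
Proof.
move=> x2; have h : 1 - x <= (expR x)^-1 by rewrite -expRN expR_ge1Dx.
have e0 := expR_gt0 x.
have : (1 - x) * expR x <= 1 by rewrite -ler_pdivlMr// div1r.
have x1 : 0 < 1 - x by lra.
rewrite mulrC -ler_pdivlMr// => /le_trans; apply.
rewrite ler_pdivrMr//.
have : 0 <= x ^+ 2 * (1 - 2 * x) by rewrite mulr_ge0 ?sqr_ge0//; lra.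
by rewrite !expr2 => h2; nra.
Qed.

Section exponential_bound.
Context {R : realType}.
Variables (rho : probability R R) (pi : probability (seqT R) R).
Hypothesis pi_inv : forall h : seqT R -> R, bmf h ->
  Ex pi h = Ex pi (fun s => Ex rho (fun e => h (scons e s))).
Variables (I : seqT R -> R) (bI : bmf I).
Hypotheses (I0 : forall s, 0 <= I s) (I1 : forall s, I s <= 1)
  (II : forall s, I s ^+ 2 = I s).
Let q := step rho I.

Definition centred s : R := I s - step rho I (stail s).

Let bq : bmf q. Proof. exact: (bmf_step rho pi bI). Qed.

Let q0 s : 0 <= q s. Proof. exact: Ex_ge0. Qed.
Let q1 s : q s <= 1.
Proof. by rewrite -[leRHS](Ex_cst rho); apply: Ex_le => //; [exact: bmf_scons|exact: bmf_cst]. Qed.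

Lemma bmf_centred : bmf centred.
Proof. by apply: bmfB => //; exact: bmf_stail. Qed.

Let centred_le s : `|centred s| <= 1.
Proof.
rewrite ler_norml /centred -/(q _).
by have := I0 s; have := I1 s; have := q0 (stail s); have := q1 (stail s); lra.
Qed.

(** Because [I ^ 2 = I], the quadratic majorant of the exponential is affine in [I]. Averaging
    cancels the linear term and leaves the conditional variance [q - q ^ 2], at most [q]. *)
Lemma step_expR_centred (t : R) s : `|t| <= 2^-1 ->
  Ex rho (fun e => expR (t * centred (scons e s))) <= 1 + 2 * t ^+ 2 * q s.
Proof.
move=> t2; have bc := bmf_scons s bmf_centred; have bs := bmf_scons s bI.
apply: (@le_trans _ _ (Ex rho (fun e =>
    (t + 2 * t ^+ 2 * (1 - 2 * q s)) * I (scons e s) +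
    (1 - t * q s + 2 * t ^+ 2 * q s ^+ 2)))).
  apply: Ex_le.
  - by apply: bmf_expR; apply: bmfM => //; exact: bmf_cst.
  - by apply: bmfD; [apply: bmfM => //; exact: bmf_cst|exact: bmf_cst].
  - move=> e; apply: le_trans.
      apply: expR_le_quadratic; apply: le_trans (ler_norm _) _.
      rewrite normrM -[leRHS]mulr1; apply: ler_pM => //; exact: centred_le.
    rewrite /centred stailK -/(q s) le_eqVlt; apply/orP; left; apply/eqP.
    have := II (scons e s); set i := I _; set p := q s => ii.
    rewrite (_ : (t * (i - p)) ^+ 2 = t ^+ 2 * (i ^+ 2 - 2 * i * p + p ^+ 2)); last by ring.
    by rewrite ii; ring.
rewrite ExD; [|by apply: bmfM => //; exact: bmf_cst|exact: bmf_cst].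
rewrite ExZ// Ex_cst [Ex rho _](_ : _ = q s)//.
have t20 : 0 <= 2 * t ^+ 2 by rewrite mulr_ge0// sqr_ge0.
have : 0 <= 2 * t ^+ 2 * q s ^+ 2 by rewrite mulr_ge0// sqr_ge0.
nra.
Qed.

Let S m := psum centred m.
Let psi (t : R) m s : R := expR (t * S m s) + expR (- t * S m s) - 2.

Let bS m : bmf (S m). Proof. exact: (bmf_psum _ bmf_centred). Qed.
Let bE (t : R) m : bmf (fun s => expR (t * S m s)).
Proof. by apply: bmf_expR; apply: bmfM => //; exact: bmf_cst. Qed.
Let bpsi t m : bmf (psi t m).
Proof. by apply: bmfB; [apply: bmfD; exact: bE|exact: bmf_cst]. Qed.

Lemma psi_ge0 (t : R) m s : 0 <= psi t m s.
Proof.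
rewrite /psi mulNr expRN; set x := expR _; have x0 : 0 < x by exact: expR_gt0.
have -> : x + x^-1 - 2 = (x - 1) ^+ 2 / x by field; rewrite gt_eqF.
by rewrite divr_ge0 ?sqr_ge0// ltW.
Qed.

Lemma psi_ge (t lambda : R) m s : 0 <= t ->
  (expR (t * lambda) - 2) * ((lambda <= `|S m s|)%R : bool)%:R <= psi t m s.
Proof.
move=> t0; case: (leP lambda) => [lS|_]; last by rewrite mulr0 psi_ge0.
rewrite mulr1 lerD2r; have := expR_ge0 (t * S m s); have := expR_ge0 (- t * S m s).
move: lS; have [s0|s0] := leP 0 (S m s).
  rewrite ger0_norm// => lS h1 h2.
  by apply: ler_wpDr => //; rewrite ler_expR ler_wpM2l.
rewrite ltr0_norm// => lS h1 h2.
by apply: ler_wpDl => //; rewrite mulNr -mulrN ler_expR ler_wpM2l.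
Qed.

Variables (Q : R) (Q0 : 0 <= Q) (qQ : {ae pi, forall s, q s <= Q}).

Lemma Ex_expR_step (t : R) m : `|t| <= 2^-1 ->
  Ex pi (fun s => expR (t * S m.+1 s)) <=
  Ex pi (fun s => expR (t * S m s) * (1 + 2 * t ^+ 2 * q s)).
Proof.
move=> t2; rewrite pi_inv; last exact: bE.
have bq2 : bmf (fun s => 1 + 2 * t ^+ 2 * q s).
  by apply: bmfD; [exact: bmf_cst|apply: bmfM => //; exact: bmf_cst].
apply: Ex_le.
- exact: (bmf_step rho pi (bE t m.+1)).
- exact: bmfM.
- move=> s.
  rewrite [leLHS](_ : _ = expR (t * S m s) * Ex rho (fun e => expR (t * centred (scons e s)))).
    by rewrite ler_wpM2l ?expR_ge0// step_expR_centred.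
  rewrite -ExZ; last first.
    apply: bmf_expR; apply: bmfM; [exact: bmf_cst|exact: (bmf_scons s bmf_centred)].
  by apply: eq_Rintegral => e _; rewrite /S /= stailK mulrDr expRD.
Qed.

(** The sum of the two exponentials is [psi + 2]. Multiplied by [1 + 2 t ^ 2 q], the [psi] part uses
    the almost sure bound [Q], while the constant 2 keeps [q] itself, whose mean is that of [I];
    this keeps the bound proportional to a probability. *)
Lemma Ex_psi_step (t : R) m : 0 <= t -> t <= 2^-1 ->
  Ex pi (psi t m.+1) <= (1 + 2 * t ^+ 2 * Q) * Ex pi (psi t m) + 4 * t ^+ 2 * Ex pi I.
Proof.
move=> t0 t2.
have tn : `|t| <= 2^-1 by rewrite ger0_norm.
have tn' : `|- t| <= 2^-1 by rewrite normrN ger0_norm.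
have c20 : 0 <= 2 * t ^+ 2 by rewrite mulr_ge0// sqr_ge0.
have bq2 : bmf (fun s => 1 + 2 * t ^+ 2 * q s).
  by apply: bmfD; [exact: bmf_cst|apply: bmfM => //; exact: bmf_cst].
have b1 := bmfM (bE t m) bq2; have b2 := bmfM (bE (- t) m) bq2.
have b3 : bmf (fun s => psi t m s * (1 + 2 * t ^+ 2 * q s)) by exact: bmfM.
have b4 : bmf (fun s => 4 * t ^+ 2 * q s) by apply: bmfM => //; exact: bmf_cst.
apply: (@le_trans _ _ (Ex pi (fun s => psi t m s * (1 + 2 * t ^+ 2 * q s) + 4 * t ^+ 2 * q s))).
  rewrite [leRHS](_ : _ = Ex pi (fun s => expR (t * S m s) * (1 + 2 * t ^+ 2 * q s)) +
      Ex pi (fun s => expR (- t * S m s) * (1 + 2 * t ^+ 2 * q s)) - 2); last first.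
    rewrite -ExD// -[X in _ = _ - X](Ex_cst pi) -ExB; [|exact: bmfD|exact: bmf_cst].
    by apply: eq_Rintegral => s _; rewrite /psi; ring.
  rewrite /psi ExB; [|by apply: bmfD; exact: bE|exact: bmf_cst].
  rewrite ExD; [|exact: bE..].
  rewrite Ex_cst lerD2r lerD//; first exact: Ex_expR_step.
  by have := Ex_expR_step m tn'; rewrite sqrrN.
rewrite ExD//; apply: lerD.
  rewrite -ExZ//; apply: ae_Ex_le => //.
    by apply: bmfM => //; exact: bmf_cst.
  apply: filterS qQ => s qs; rewrite mulrC ler_wpM2r//; last first.
    by rewrite lerD2l ler_wpM2l.
  exact: psi_ge0.
by rewrite ExZ// Ex_step.
Qed.

Lemma Ex_psi (t : R) m : 0 <= t -> t <= 2^-1 ->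
  Ex pi (psi t m) <= 4 * t ^+ 2 * Ex pi I * m%:R * (1 + 2 * t ^+ 2 * Q) ^+ m.
Proof.
move=> t0 t2; set p := Ex pi I; set al := 2 * t ^+ 2 * Q.
have p0 : 0 <= p by exact: Ex_ge0.
have al0 : 0 <= al by rewrite !mulr_ge0.
have b0 : 0 <= 4 * t ^+ 2 * p by rewrite !mulr_ge0// sqr_ge0.
elim: m => [|m ih].
  rewrite mulr0 mul0r -[leRHS](Ex_cst pi) le_eqVlt; apply/orP; left; apply/eqP.
  by apply: eq_Rintegral => s _; rewrite /psi /S /= !mulr0 expR0; ring.
apply: (le_trans (Ex_psi_step m t0 t2)); rewrite -/p -/al.
have h : (1 + al) * Ex pi (psi t m) <=
    (1 + al) * (4 * t ^+ 2 * p * m%:R * (1 + al) ^+ m).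
  by rewrite ler_wpM2l// addr_ge0.
apply: (le_trans (lerD h (lexx _))).
rewrite (_ : 4 * t ^+ 2 * p * m.+1%:R * (1 + al) ^+ m.+1 =
  (1 + al) * (4 * t ^+ 2 * p * m%:R * (1 + al) ^+ m) +
  4 * t ^+ 2 * p * (1 + al) ^+ m.+1); last first.
  by rewrite -(natr1 m) (exprS (1 + al) m); set E := (1 + al) ^+ m; ring.
rewrite lerD2l -[leLHS]mulr1 ler_wpM2l//.
by rewrite exprn_ege1// lerDl.
Qed.

Lemma centred_tail (t lambda : R) m : 0 <= t -> t <= 2^-1 ->
  (expR (t * lambda) - 2) * Ex pi (fun s => ((lambda <= `|psum centred m s|)%R : bool)%:R) <=
  4 * t ^+ 2 * Ex pi I * m%:R * (1 + 2 * t ^+ 2 * Q) ^+ m.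
Proof.
move=> t0 t2; apply: le_trans (Ex_psi m t0 t2).
have bb : bmf (fun s => ((lambda <= `|psum centred m s|)%R : bool)%:R : R).
  apply: bmf_bool; apply: measurable_fun_ler => //.
  exact: (bmf_measurable (bmf_norm (bS m))).
rewrite -ExZ//; apply: Ex_le => //.
  by apply: bmfM => //; exact: bmf_cst.
by move=> s; exact: psi_ge.
Qed.

End exponential_bound.

Lemma ae_forall_count d (T : measurableType d) (R : realType)
    (mu : {measure set T -> \bar R}) (I : countType) (Q : I -> T -> Prop) :
  (forall i, {ae mu, forall x, Q i x}) -> {ae mu, forall x, forall i, Q i x}.
Proof.
move=> hQ.
pose N n : set T := if unpickle n is Some i then [set x | ~ Q i x] else set0.
have : mu.-negligible (\bigcup_n N n).
  apply: negligible_bigcup => n; rewrite /N; case: unpickle => [i|]; last exact: negligible_set0.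
  exact: hQ.
apply: negligibleS => x /= /existsNP[i nQ]; exists (pickle i) => //.
by rewrite /N pickleK.
Qed.

(** * Martingale increments on an infinite grid *)

Section oscillation.
Context {d} {Omega : measurableType d} {R : realType} (P : probability Omega R).
Variables (eps : int -> Omega -> R) (eps0' : Omega -> R) (g : seqT R -> R).
Hypothesis iid : iid_family P (fam eps eps0').
Hypothesis mg : seq_measurable g.
Let pi := xilaw iid.
Let rho := rho iid.
Let Xi := Xi eps eps0'.
Let inv := pi_inv iid.
Let F := distF P g eps.

Definition gap (a c : R) (s : seqT R) : R := leg g c s - leg g a s.
Definition cgap (a c : R) (s : seqT R) : R := cE pi 1 (leg g c) s - cE pi 1 (leg g a) s.

Lemma bmf_gap a c : bmf (gap a c).
Proof. by apply: bmfB; exact: bmf_leg. Qed.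

Lemma step_gap a c : step rho (gap a c) = cgap a c.
Proof.
apply/funext => s; rewrite /step /gap ExB; [|by apply: bmf_scons; exact: bmf_leg..].
rewrite /cgap -!(step_cE inv) ?cE0//; exact: bmf_leg.
Qed.

Lemma bmf_cgap a c : bmf (cgap a c).
Proof. by apply: bmfB; apply: bmf_cE; exact: bmf_leg. Qed.

Lemma leg_le a c s : a <= c -> leg g a s <= leg g c s.
Proof.
move=> ac; rewrite /leg ler_nat.
by case: (leP (g s) a) => // ga; rewrite (le_trans ga ac).
Qed.

Lemma cE_leg_le a c s : a <= c -> cE pi 1 (leg g a) s <= cE pi 1 (leg g c) s.
Proof.
move=> ac; apply: Ex_le; [by apply: bmf_smerge; exact: bmf_leg..|].
by move=> t; exact: leg_le.
Qed.

Lemma Ex_gap a c : Ex pi (gap a c) = F c - F a.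
Proof. by rewrite /gap ExB; [rewrite /F !(distFE iid mg)|exact: bmf_leg..]. Qed.

Lemma F_ge0 x : 0 <= F x. Proof. by rewrite /F (distFE iid mg); exact: Ex_ge0. Qed.

Lemma F_le1 x : F x <= 1.
Proof.
rewrite /F (distFE iid mg) -[leRHS](Ex_cst pi); apply: Ex_le.
- exact: bmf_leg.
- exact: bmf_cst.
- by move=> s; rewrite /leg lern1 leq_b1.
Qed.

Lemma F_homo a c : a <= c -> F a <= F c.
Proof.
move=> ac; rewrite /F !(distFE iid mg); apply: Ex_le; [exact: bmf_leg..|].
by move=> s; exact: leg_le.
Qed.

Definition Mt n a c (w : Omega) : R :=
  \sum_(1 <= i < n.+1) (gap a c (Xi i%:Z w) - cgap a c (Xi (i%:Z - 1) w)).

Lemma Mt_psum n a c w : Mt n a c w = psum (centred rho (gap a c)) n (Xi n%:Z w).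
Proof.
have xS i : stail (Xi i.+1%:Z w) = Xi i%:Z w.
  by rewrite -[RHS](stail_Xi eps eps0') -addn1 PoszD.
rewrite (psum_path xS); apply: eq_big_nat => i /andP[i1 _].
rewrite /centred step_gap; congr (_ - cgap _ _ _).
by rewrite -[LHS](stail_Xi eps eps0') subrK.
Qed.

Section grid.
Variables (n : nat) (h lambda kappa : R) (M : nat).
Hypotheses (h0 : 0 < h) (k0 : 0 <= kappa).
Let pt (k : int) : R := k%:~R * h.
Hypothesis tail : forall (k : int) (m : nat), (m < M)%N ->
  Ex P (fun w => ((lambda <= `|Mt n (pt k) (pt (k + m%:Z)) w|)%R : bool)%:R) <=
  kappa * (F (pt (k + m%:Z)) - F (pt k)).

Let ev (k : int) m : set Omega := [set w | lambda <= `|Mt n (pt k) (pt (k + m%:Z)) w|].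

Let bmf_Mt a c : bmf (Mt n a c).
Proof.
apply: bmf_sum => i _; apply: bmfB; apply: (bmf_Xi iid);
  [exact: bmf_gap|exact: bmf_cgap].
Qed.

Let mev_fun k m : measurable_fun setT (fun w => lambda <= `|Mt n (pt k) (pt (k + m%:Z)) w|).
Proof.
by apply: measurable_fun_ler => //; exact: (bmf_measurable (bmf_norm (bmf_Mt _ _))).
Qed.

Let mev k m : measurable (ev k m).
Proof.
rewrite (_ : ev k m = [set: Omega] `&`
  (fun w => `|Mt n (pt k) (pt (k + m%:Z)) w|) @^-1` `[lambda, +oo[%classic).
  exact: (bmf_measurable (bmf_norm (bmf_Mt _ _))).
by rewrite setTI; apply/seteqP; split => w /=; rewrite in_itv/= andbT.
Qed.

Let Pev k m : (m < M)%N -> (P (ev k m) <= (kappa * (F (pt (k + m%:Z)) - F (pt k)))%:E)%E.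
Proof.
move=> mM; rewrite -[X in (X <= _)%E]fineK; last exact: fin_num_measure.
by rewrite lee_fin -Ex_bool ?tail.
Qed.

(* Telescoping in [m]: consecutive cells are disjoint, so their probabilities add up to at most 1. *)
Lemma grid_sum (k : int) m K :
  \sum_(z < K) (F (pt (k + z%:Z + m%:Z)) - F (pt (k + z%:Z))) <= m%:R.
Proof.
elim: m => [|m ih].
  by rewrite big1// => z _; rewrite addr0 subrr.
have -> : \sum_(z < K) (F (pt (k + z%:Z + m.+1%:Z)) - F (pt (k + z%:Z))) =
    \sum_(z < K) (F (pt (k + z%:Z + m%:Z)) - F (pt (k + z%:Z))) +
    \sum_(z < K) (F (pt (k + z.+1%:Z + m%:Z)) - F (pt (k + z%:Z + m%:Z))).
  rewrite -big_split; apply: eq_bigr => z _ /=.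
  have -> : k + z.+1%:Z + m%:Z = k + z%:Z + m.+1%:Z by lia.
  by ring.
rewrite -(natr1 m) lerD//.
rewrite -(big_mkord predT (fun z => F (pt (k + z.+1%:Z + m%:Z)) - F (pt (k + z%:Z + m%:Z)))).
rewrite (telescope_sumr (fun z => F (pt (k + z%:Z + m%:Z))))//.
by have := F_le1 (pt (k + K%:Z + m%:Z)); have := F_ge0 (pt (k + 0%:Z + m%:Z)); lra.
Qed.

Lemma grid_sum_neg m K :
  \sum_(z < K) (F (pt (Negz z + m%:Z)) - F (pt (Negz z))) <= m%:R.
Proof.
(* Read backwards, the negative indices form an increasing run starting at [- K]. *)
rewrite (reindex_inj rev_ord_inj) /=; apply: le_trans (grid_sum (- K%:Z) m K).
rewrite le_eqVlt; apply/orP; left; apply/eqP; apply: eq_bigr => z _.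
have -> : Negz (K - z.+1) = - K%:Z + z%:Z.
  by rewrite NegzE; have := ltn_ord z; lia.
by [].
Qed.

Definition bad : set Omega := [set w | exists (k : int) (m : nat), (m < M)%N /\
  lambda <= `|Mt n (pt k) (pt (k + m%:Z)) w|].

Let cell z : set Omega := \big[setU/set0]_(m < M) (ev (Posz z) m `|` ev (Negz z) m).

Let cellE z : cell z = \bigcup_(m in `I_M) (ev (Posz z) m `|` ev (Negz z) m).
Proof. by rewrite (bigcup_mkord M (fun m => ev (Posz z) m `|` ev (Negz z) m)). Qed.

Let badE : bad = \bigcup_z cell z.
Proof.
apply/seteqP; split=> w.
  move=> [[z|z] [m [mM hm]]]; exists z => //; rewrite cellE; exists m => //.
    by left.
  by right.
move=> [z _]; rewrite cellE => -[m mM [hm|hm]]; first by exists (Posz z), m.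
by exists (Negz z), m.
Qed.

Let mcell z : measurable (cell z).
Proof. by apply: bigsetU_measurable => m _; apply: measurableU; exact: mev. Qed.

Lemma measurable_bad : measurable bad.
Proof. by rewrite badE; apply: bigcup_measurable => z _; exact: mcell. Qed.

(** For each width [m < M], the increments of [F] over all cells sum to at most [M] on either half
    of the grid; there are [M] widths and two halves. *)
Lemma prob_bad : (P bad <= (2 * kappa * M%:R ^+ 2)%:E)%E.
Proof.
apply: (@le_trans _ _ (\sum_(z <oo) P (cell z))%E).
  by apply: measure_sigma_subadditive; [exact: mcell|exact: measurable_bad|rewrite badE].
apply: nneseries_le_bound => [z|K]; first exact: measure_ge0.
apply: (@le_trans _ _ (\sum_(z < K) \sum_(m < M)
  ((kappa * (F (pt (Posz z + m%:Z)) - F (pt (Posz z))) +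
    kappa * (F (pt (Negz z + m%:Z)) - F (pt (Negz z)))))%:E)%E).
  apply: lee_sum => z _.
  have mU m : (m < M)%N -> measurable (ev (Posz z) m `|` ev (Negz z) m).
    by move=> _; apply: measurableU; exact: mev.
  apply: le_trans (Boole_inequality P mU) _.
  apply: lee_sum => m _; rewrite EFinD.
  apply: le_trans (leeD (Pev (Posz z) (ltn_ord m)) (Pev (Negz z) (ltn_ord m))).
  by apply: measureU2; exact: mev.
under eq_bigr do rewrite sumEFin.
rewrite sumEFin lee_fin exchange_big /=.
apply: (@le_trans _ _ (\sum_(m < M) 2 * kappa * M%:R)); last first.
  by rewrite sumr_const card_ord -[leLHS]mulr_natr expr2 mulrA.
apply: ler_sum => m _; rewrite big_split /= -!mulr_sumr -mulrDr.
rewrite [leRHS](_ : _ = kappa * (M%:R + M%:R)); last by ring.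
rewrite ler_wpM2l//.
have mM : m%:R <= M%:R :> R by rewrite ler_nat ltnW.
apply: lerD; apply: le_trans mM; last exact: grid_sum_neg.
by apply: le_trans (grid_sum 0 m K); under eq_bigr do rewrite -[Posz _]add0r.
Qed.

End grid.

Variables (c0 : R) (c0_gt0 : 0 < c0).
Hypothesis condF_derivable :
  {ae P, forall w, forall x : R, derivable (condF P g eps 1 (xi0 eps w)) x 1}.
Hypothesis condF_derive : {ae P, forall w, forall x : R,
  derive1 (condF P g eps 1 (xi0 eps w)) x <= c0}.

(** The mean value theorem applied to the conditional distribution function, carried from [Omega] to
    the law of the past. *)
Lemma cgap_le a c : a <= c -> {ae pi, forall s, cgap a c s <= c0 * (c - a)}.
Proof.
move=> ac; apply: (ae_pi iid (A := [set s | cgap a c s <= c0 * (c - a)])).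
  rewrite (_ : [set s | _] = [set: seqT R] `&` cgap a c @^-1` `]-oo, c0 * (c - a)]%classic).
    exact: (bmf_measurable (bmf_cgap a c)).
  by rewrite setTI; apply/seteqP; split => s /=; rewrite in_itv/=.
apply: filterS2 condF_derivable condF_derive => w dw lw /=.
rewrite /cgap -!(condFE iid mg) -(xi0E eps eps0' w).
move: ac; rewrite le_eqVlt => /predU1P[<-|ac]; first by rewrite !subrr mulr0.
set f := condF P g eps 1 (xi0 eps w).
have [||x _ ->] := @MVT _ f (derive1 f) a c ac.
- by move=> x _; rewrite derive1E; apply: DeriveDef.
- apply: derivable_within_continuous => x _; exact: dw.
- by rewrite ler_pM2r ?subr_gt0.
Qed.

(** The null set of [cgap_le] depends on the endpoints. Times and rational endpoints are countably
    many; monotonicity in both endpoints then reaches all reals, at the cost of an arbitrary [e]. *)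
Lemma ae_cgap_le : {ae P, forall w, forall (i : int) (x y : R), x <= y ->
  cgap x y (Xi i w) <= c0 * (y - x)}.
Proof.
pose Q (z : int * rat * rat) w := (ratr z.1.2 <= ratr z.2 :> R) ->
  cgap (ratr z.1.2) (ratr z.2) (Xi z.1.1 w) <= c0 * (ratr z.2 - ratr z.1.2).
have /ae_forall_count : forall z, {ae P, forall w, Q z w}.
  move=> [[i x] y]; rewrite /Q /=.
  have [xy|xy] := boolP (ratr x <= ratr y :> R); last by apply: aeW.
  by have := ae_Xi i (cgap_le xy); apply: filterS => w h _.
apply: filterS => w hw i x y xy.
apply/ler_addgt0Pr => e e0.
have d0 : 0 < e / (c0 * 2) by rewrite divr_gt0// mulr_gt0.
have [x' /=] := @rat_in_itvoo R (x - e / (c0 * 2)) x ltac:(by rewrite ltrBlDr ltrDl).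
rewrite in_itv/= => /andP[x1 x2].
have [y' /=] := @rat_in_itvoo R y (y + e / (c0 * 2)) ltac:(by rewrite ltrDl).
rewrite in_itv/= => /andP[y1 y2].
have := hw (i, x', y'); rewrite /Q /= => /(_ _)/le_trans h.
apply: (@le_trans _ _ (cgap (ratr x') (ratr y') (Xi i w))).
  rewrite /cgap lerB//; apply: cE_leg_le; exact: ltW.
apply: h; first by rewrite (le_trans (ltW x2))// (le_trans xy)// ltW.
rewrite (_ : c0 * (y - x) + e = c0 * (y - x + (e / (c0 * 2) + e / (c0 * 2)))).
  by rewrite ler_pM2l//; lra.
by field; rewrite gt_eqF.
Qed.

(** The condition [4 <= expR (t * lambda)] makes [expR (t * lambda) - 2] at least half of the
    exponential, which turns the factor 4 of [centred_tail] into 8. *)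
Lemma tail_prob n (a c t lambda : R) : a <= c -> 0 <= t -> t <= 2^-1 ->
  4 <= expR (t * lambda) ->
  Ex P (fun w => ((lambda <= `|Mt n a c w|)%R : bool)%:R) <=
  8 * t ^+ 2 * n%:R * (1 + 2 * t ^+ 2 * (c0 * (c - a))) ^+ n / expR (t * lambda) * (F c - F a).
Proof.
move=> ac t0 t2 e4.
have Q0 : 0 <= c0 * (c - a) by rewrite mulr_ge0 ?(ltW c0_gt0)// subr_ge0.
have G0 s : 0 <= gap a c s by rewrite subr_ge0 leg_le.
have G1 s : gap a c s <= 1.
  by rewrite /gap /leg; case: (g s <= c)%R; case: (g s <= a)%R; rewrite /=; lra.
have GG s : gap a c s ^+ 2 = gap a c s.
  have := G0 s; rewrite /gap /leg; case: (g s <= c)%R; case: (g s <= a)%R; rewrite /=;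
    rewrite ?subrr ?subr0 ?expr0n ?expr1n//; lra.
have qQ : {ae pi, forall s, step rho (gap a c) s <= c0 * (c - a)}.
  by rewrite step_gap; exact: cgap_le.
have := centred_tail inv (bmf_gap a c) G0 G1 GG Q0 qQ lambda n t0 t2.
set p := Ex pi _; set K := 4 * t ^+ 2 * Ex pi (gap a c) * n%:R * _ => hp.
have pE : Ex P (fun w => ((lambda <= `|Mt n a c w|)%R : bool)%:R) = p.
  rewrite /p -(Ex_Xi iid n%:Z).
    by apply: eq_Rintegral => w _; rewrite Mt_psum.
  apply: bmf_bool; apply: measurable_fun_ler => //.
  apply: (bmf_measurable (bmf_norm _)); apply: bmf_psum.
  exact: (bmf_centred rho pi (bmf_gap a c)).
have p0 : 0 <= p by apply: Ex_ge0.
rewrite pE; set E := expR _ in e4 hp *.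
have E0 : 0 < E by exact: expR_gt0.
rewrite [leRHS](_ : _ = 2 * K / E); last first.
  by rewrite /K Ex_gap; field; rewrite gt_eqF.
by rewrite ler_pdivlMr//; nra.
Qed.


End oscillation.

Lemma sum_invsqr_le (R : realType) K : \sum_(n < K) (n%:R ^+ 2 : R)^-1 <= 2.
Proof.
(* The term of index 0 is 0, since the inverse of 0 is 0. *)
case: K => [|[|K]]; rewrite ?big_ord0// ?big_ord1 ?expr0n ?invr0//.
suff : \sum_(n < K.+2) (n%:R ^+ 2 : R)^-1 <= 2 - K.+1%:R^-1.
  by move=> /le_trans; apply; rewrite lerBlDr lerDl invr_ge0.
elim: K => [|K ih].
  by rewrite big_ord_recr big_ord1/= expr0n invr0 expr1n invr1 add0r; lra.
rewrite big_ord_recr/=; apply: (le_trans (lerD ih (lexx _))).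
rewrite -(natr1 K.+1); set x := K.+1%:R : R.
have x0 : 0 < x by rewrite ltr0n.
rewrite -lerBrDl.
have -> : 2 - (x + 1)^-1 - (2 - x^-1) = (x * (x + 1))^-1.
  by field; rewrite !gt_eqF// ltr_wpDl// ltW.
rewrite lef_pV2 ?posrE ?mulr_gt0 ?exprn_gt0//; [|lra..].
by rewrite expr2 ler_pM2r; lra.
Qed.

(** * Bracketing between grid points and Borel--Cantelli *)

Section martingale_part.
Context {d} {Omega : measurableType d} {R : realType} (P : probability Omega R).
Variables (eps : int -> Omega -> R) (eps0' : Omega -> R) (g : seqT R -> R).
Hypothesis iid : iid_family P (fam eps eps0').
Hypothesis mg : seq_measurable g.
Local Notation Xi := (Xi eps eps0').
Let F := distF P g eps.
Local Notation Mt := (Mt g iid).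
Local Notation cgap := (cgap g iid).
Variables (c0 : R) (c0_gt0 : 0 < c0).

Section pathwise.
Variables (n : nat) (w : Omega) (h lambda : R) (M : nat).
Hypothesis lip : forall (i : int) (x y : R), x <= y -> cgap x y (Xi i w) <= c0 * (y - x).

(** Enlarging the interval can only increase the indicators, while each compensator grows by at most
    [c0] times the added length. *)
Lemma Mt_outer a x y c : a <= x -> x <= y -> y <= c ->
  Mt n x y w <= Mt n a c w + n%:R * (c0 * ((x - a) + (c - y))).
Proof.
move=> ax xy yc.
have -> : n%:R * (c0 * ((x - a) + (c - y))) = \sum_(1 <= i < n.+1) c0 * ((x - a) + (c - y)).
  by rewrite sumr_const_nat subSS subn0 mulr_natl.
rewrite -big_split; apply: ler_sum => i _ /=.
have h1 := lip (i%:Z - 1) ax; have h2 := lip (i%:Z - 1) yc.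
have g1 := leg_le g (Xi i%:Z w) ax; have g2 := leg_le g (Xi i%:Z w) yc.
by move: h1 h2 g1 g2; rewrite /cgap /gap mulrDr; lra.
Qed.

Lemma Mtxx x : Mt n x x w = 0.
Proof. by rewrite /Mt big1// => i _; rewrite /gap /cgap !subrr. Qed.

Hypotheses (h0 : 0 < h) (nM : (n.+3 <= M)%N).
Hypothesis grid : forall (k : int) (m : nat), (m < M)%N ->
  `|Mt n (k%:~R * h) ((k + m%:Z)%:~R * h) w| <= lambda.

Lemma Mt_bracket (x y : R) : x <= y -> y - x <= n%:R * h ->
  `|Mt n x y w| <= lambda + n%:R * (c0 * (h + h)).
Proof.
move=> xy yxb.
pose k := Num.floor (x / h); pose l := Num.floor (y / h).
have kx : k%:~R * h <= x by rewrite -ler_pdivlMr// floor_le.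
have xk : x < (k + 1)%:~R * h by rewrite -ltr_pdivrMr// floorD1_gt.
have ly : l%:~R * h <= y by rewrite -ler_pdivlMr// floor_le.
have yl : y < (l + 1)%:~R * h by rewrite -ltr_pdivrMr// floorD1_gt.
have kl : k <= l by apply: le_floor; rewrite ler_pM2r ?invr_gt0.
have lk : l <= k + n%:Z.
  rewrite -ltzD1 -(ltr_int R) -(ltr_pM2r h0) (le_lt_trans ly)//.
  rewrite !intrD (_ : n%:Z%:~R = n%:R :> R)// !mulrDl mul1r.
  by move: xk; rewrite !intrD !mulrDl mul1r; lra.
have [m mE] : exists m : nat, l + 1 = k + m%:Z /\ (m <= n.+1)%N.
  exists (absz (l + 1 - k)%R); split; lia.
case: mE => mE mn.
rewrite ler_norml; apply/andP; split; last first.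
  have mM : (m < M)%N by lia.
  have := grid k mM; rewrite -mE ler_norml => /andP[_ hm].
  apply: (le_trans (Mt_outer kx xy (ltW yl))).
  rewrite lerD// ler_wpM2l// ler_wpM2l ?(ltW c0_gt0)//.
  by move: xk yl; rewrite !intrD !mulrDl !mul1r; lra.
rewrite lerNl.
(* The lower bound comes from the largest grid interval inside [[x, y]]; when both points lie in one
   cell, the degenerate interval [[y, y]], with zero increment, takes its place. *)
have [kl'|lk'] := leP (k + 1) l.
  have [m' [mE' mn']] : exists m : nat, l = k + 1 + m%:Z /\ (m <= n)%N.
    exists (absz (l - (k + 1))%R); split; lia.
  have mM : (m' < M)%N by lia.
  have := grid (k + 1) mM; rewrite -mE' ler_norml => /andP[hm _].
  have kl2 : (k + 1)%:~R * h <= l%:~R * h by rewrite ler_pM2r// ler_int.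
  have := Mt_outer (ltW xk) kl2 ly.
  have : n%:R * (c0 * ((k + 1)%:~R * h - x + (y - l%:~R * h))) <= n%:R * (c0 * (h + h)).
    rewrite ler_wpM2l// ler_wpM2l ?(ltW c0_gt0)//.
    by move: kx yl; rewrite !intrD !mulrDl !mul1r; lra.
  by lra.
have lkE : l = k by lia.
have := Mt_outer xy (lexx y) (lexx y); rewrite Mtxx subrr addr0.
have : n%:R * (c0 * (y - x)) <= n%:R * (c0 * (h + h)).
  rewrite ler_wpM2l// ler_wpM2l ?(ltW c0_gt0)//.
  by move: kx yl; rewrite lkE !intrD !mulrDl !mul1r; lra.
have : 0 <= lambda by apply: le_trans (grid 0 (m := 0) _); rewrite ?normr_ge0//; lia.
by lra.
Qed.

End pathwise.

Hypothesis condF_derivable :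
  {ae P, forall w, forall x : R, derivable (condF P g eps 1 (xi0 eps w)) x 1}.
Hypothesis condF_derive : {ae P, forall w, forall x : R,
  derive1 (condF P g eps 1 (xi0 eps w)) x <= c0}.
Variables (b : nat -> R) (b0 : forall n, 0 < b n).

(** The mesh [b n / n] makes the compensator error over two cells of order [b n]. The exponent
    [G + 7] pays [n ^ G] for the growth factor, one power for the [n] summands and two for the
    [n + 3] widths and their sums; the rest is summable. *)
Lemma prob_bad_le n (C : R) (G : nat) : (2 <= n)%N -> 1 <= C -> 2 * c0 <= G%:R ->
  ln (n%:R : R) <= C * (n%:R * b n) ->
  (P (bad g iid n (b n / n%:R) (((G + 7)%:R * 2 * Num.sqrt C) *
     Num.sqrt (n%:R * b n * ln (n%:R : R))) n.+3) <= (64 * (n%:R ^+ 2)^-1)%:E)%E.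
Proof.
move=> n2 C1 cG LC; set L := ln (n%:R : R) in LC *; set lambda := _ * Num.sqrt _.
have n0 : 0 < n%:R :> R by rewrite ltr0n; lia.
have n1 : 1 < n%:R :> R by rewrite ltr1n.
have L0 : 0 < L by rewrite ln_gt0.
have A0 : 0 < n%:R * b n by rewrite mulr_gt0.
have C0 : 0 < C by lra.
pose sA := Num.sqrt (n%:R * b n); pose sL := Num.sqrt L; pose sC := Num.sqrt C.
have sA0 : 0 < sA by rewrite sqrtr_gt0.
have sL0 : 0 < sL by rewrite sqrtr_gt0.
have sC0 : 0 < sC by rewrite sqrtr_gt0.
have sA2 : sA ^+ 2 = n%:R * b n by rewrite sqr_sqrtr ?(ltW A0).
have sL2 : sL ^+ 2 = L by rewrite sqr_sqrtr ?(ltW L0).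
have sC2 : sC ^+ 2 = C by rewrite sqr_sqrtr ?(ltW C0).
(* Chosen so that [t * lambda] is a multiple of [ln n]; the bandwidth condition
   [ln n <= C * (n * b n)] is exactly what gives [t <= 1/2]. *)
pose t := sL / (2 * sC * sA).
have d0 : 0 < 2 * sC * sA by rewrite !mulr_gt0.
have t0 : 0 <= t by rewrite divr_ge0 ?(ltW sL0)// ltW.
have t2 : t <= 2^-1.
  rewrite ler_pdivrMr// (_ : 2^-1 * (2 * sC * sA) = sC * sA); last by field.
  by rewrite -sqrtrM ?(ltW C0)// ler_wsqrtr.
have tE : t ^+ 2 = L / (4 * C * (n%:R * b n)).
  by rewrite -sL2 -sC2 -sA2 /t; field; rewrite !gt_eqF.
have tl : t * lambda = (G + 7)%:R * L.
  rewrite /lambda sqrtrM ?(ltW A0)// -/sA -/sL -/sC -sL2 /t; field.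
  by rewrite !gt_eqF.
have eE : expR (t * lambda) = n%:R ^+ (G + 7).
  by rewrite tl expRM_natl lnK// posrE.
pose kappa : R := 2 * n%:R ^+ G.+1 / n%:R ^+ (G + 7).
have k0 : 0 <= kappa by rewrite divr_ge0// ?mulr_ge0// exprn_ge0// ltW.
have h0 : 0 < b n / n%:R by rewrite divr_gt0.
apply: (@le_trans _ _ (2 * kappa * n.+3%:R ^+ 2)%:E); last first.
  rewrite lee_fin /kappa.
  have -> : 2 * (2 * n%:R ^+ G.+1 / n%:R ^+ (G + 7)) * n.+3%:R ^+ 2 =
      4 * n.+3%:R ^+ 2 / n%:R ^+ 6 :> R.
    rewrite exprD (exprS _ G) (exprS _ 6).
    set E := n%:R ^+ G : R; have E0 : E != 0 by rewrite expf_neq0// gt_eqF.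
    set E6 := n%:R ^+ 6 : R; have E60 : E6 != 0 by rewrite expf_neq0// gt_eqF.
    by field; rewrite E0 E60 gt_eqF.
  rewrite ler_pdivrMr ?exprn_gt0//.
  rewrite (_ : 64 * (n%:R ^+ 2)^-1 * n%:R ^+ 6 = 64 * n%:R ^+ 4 :> R); last first.
    by field; rewrite gt_eqF.
  have h1 : n.+3%:R <= 4 * n%:R :> R.
    by rewrite -natrM ler_nat; clear -n2; lia.
  apply: (@le_trans _ _ (4 * (4 * n%:R) ^+ 2)).
    by rewrite ler_pM2l// lerXn2r// nnegrE// mulr_ge0.
  rewrite (_ : 4 * (4 * n%:R) ^+ 2 = 64 * n%:R ^+ 2); last by ring.
  by rewrite ler_pM2l// ler_weXn2l// ltW.
apply: prob_bad => //.
move=> k m mM.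
set a := k%:~R * _; set c := (k + m%:Z)%:~R * _.
have ac : c - a = m%:R * (b n / n%:R).
  by rewrite /c /a intrD mulrDl addrC addKr.
have ac0 : 0 <= c - a by rewrite ac mulr_ge0// ltW.
have ac' : a <= c by rewrite -subr_ge0.
have cb : c - a <= 3 * b n.
  rewrite ac mulrCA [leRHS]mulrC ler_pM2l// ler_pdivrMr// -natrM ler_nat.
  by clear -n2 mM; lia.
have e4 : 4 <= expR (t * lambda).
  rewrite eE exprD -[leLHS]mul1r; apply: ler_pM => //.
    by rewrite exprn_ege1// ltW.
  apply: (@le_trans _ _ (2 ^+ 7)); first by rewrite -natrX ler_nat.
  by rewrite lerXn2r// ?nnegrE// ler_nat.
apply: (le_trans (tail_prob iid mg c0_gt0 condF_derivable condF_derive n ac' t0 t2 e4)).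
rewrite -/F; apply: ler_wpM2r.
  by rewrite subr_ge0; exact: (F_homo iid mg).
rewrite eE /kappa ler_pM2r ?invr_gt0 ?exprn_gt0//.
rewrite (_ : 2 * n%:R ^+ G.+1 = 2 * n%:R * n%:R ^+ G :> R); last first.
  by rewrite (exprS _ G) mulrA.
have t24 : t ^+ 2 <= 4^-1.
  by rewrite (_ : 4^-1 = 2^-1 ^+ 2); [rewrite lerXn2r// nnegrE|field].
have al0 : 0 <= 2 * t ^+ 2 * (c0 * (c - a)) by apply: mulr_ge0; [rewrite mulr_ge0// sqr_ge0|rewrite mulr_ge0// ltW].
apply: ler_pM.
- by apply: mulr_ge0 => //; apply: mulr_ge0 => //; exact: sqr_ge0.
- by rewrite exprn_ge0// addr_ge0.
- by rewrite ler_pM2r//; lra.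
(* By [1 + x <= exp x] the [n]-th power is at most the exponential of [3 c0 / (2 C) * ln n], hence
   at most [n ^ G] as [C >= 1] and [2 c0 <= G]. *)
apply: (@le_trans _ _ (expR (2 * t ^+ 2 * (c0 * (c - a))) ^+ n)).
  by rewrite lerXn2r// ?nnegrE ?addr_ge0 ?expR_ge0// expR_ge1Dx.
rewrite -expRM_natl (_ : n%:R ^+ G = expR (G%:R * L)); last first.
  by rewrite expRM_natl lnK// posrE.
rewrite ler_expR.
apply: (@le_trans _ _ (n%:R * (2 * t ^+ 2 * (c0 * (3 * b n))))).
  rewrite ler_pM2l//; apply: ler_wpM2l; first by apply: mulr_ge0 => //; exact: sqr_ge0.
  by rewrite ler_pM2l.
rewrite tE.
have -> : n%:R * (2 * (L / (4 * C * (n%:R * b n))) * (c0 * (3 * b n))) = (3 * c0 / (2 * C)) * L.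
  by field; rewrite !gt_eqF.
rewrite ler_pM2r//; apply: le_trans cG.
have hc : c0 * 1 <= c0 * C by rewrite ler_pM2l.
rewrite ler_pdivrMr ?mulr_gt0// (_ : 2 * c0 * (2 * C) = 4 * (c0 * C)); last by ring.
apply: (@le_trans _ _ (4 * (c0 * 1))); last by rewrite ler_pM2l.
by rewrite mulr1 ler_pM2r// ler_nat.
Qed.

Hypothesis bC : exists C : R, \forall n \near \oo, ln (n%:R : R) <= C * (n%:R * b n).

Lemma martingale_oscillation : exists2 K : R, 0 <= K &
  {ae P, forall w, \forall n \near \oo, forall x y : R, x <= y -> y - x <= b n ->
    `|Mt n x y w| <= K * Num.sqrt (n%:R * b n * ln (n%:R : R)) + 2 * c0 * b n}.
Proof.
have [C hC] := bC; pose C' := Num.max C 1.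
pose G := (Num.truncn (2 * c0)).+1.
have cG : 2 * c0 <= G%:R by apply: ltW; exact: truncnS_gt.
pose K := (G + 7)%:R * 2 * Num.sqrt C'; exists K.
  by rewrite !mulr_ge0// sqrtr_ge0.
have [N _ hN] : \forall n \near \oo, (2 <= n)%N /\ ln (n%:R : R) <= C' * (n%:R * b n).
  near=> n; split; first by near: n; exact: nbhs_infty_ge.
  have h : ln (n%:R : R) <= C * (n%:R * b n) by near: n.
  apply: (le_trans h); rewrite ler_wpM2r// ?le_max ?lexx//.
  by rewrite mulr_ge0// ltW.
pose B n := bad g iid n (b n / n%:R) (K * Num.sqrt (n%:R * b n * ln (n%:R : R))) n.+3.
(* The tail bound holds from [N] on; emptying the earlier events leaves their upper limit
   unchanged. *)
pose B' n := if (N <= n)%N then B n else set0.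
have mB' n : measurable (B' n).
  by rewrite /B'; case: ifPn => // _; exact: measurable_bad.
have PB' n : (P (B' n) <= (64 * (n%:R ^+ 2)^-1)%:E)%E.
  rewrite /B'; case: ifPn => [Nn|_]; last first.
    by rewrite measure0 lee_fin mulr_ge0// invr_ge0 sqr_ge0.
  have [n2 nC] := hN n Nn.
  by apply: prob_bad_le => //; rewrite le_max lexx orbT.
have lim0 : P (lim_sup_set B') = 0%E.
  apply: lim_sup_set_cvg0 => //; apply: (@le_lt_trans _ _ 128%:E); last exact: ltry.
  apply: nneseries_le_bound => [n|k]; first exact: measure_ge0.
  apply: (@le_trans _ _ (\sum_(n < k) (64 * (n%:R ^+ 2)^-1)%:E)%E).
    by apply: lee_sum => n _; exact: PB'.
  rewrite sumEFin lee_fin -mulr_sumr (_ : 128 = 64 * 2 :> R); last by ring.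
  by rewrite ler_pM2l// sum_invsqr_le.
have evB : {ae P, forall w, ~ lim_sup_set B' w}.
  exists (lim_sup_set B'); split => //; last by move=> w /= /contrapT.
  by apply: bigcap_measurable => //= k _; apply: bigcup_measurable => j _; exact: mB'.
apply: filterS2 evB (ae_cgap_le iid mg c0_gt0 condF_derivable condF_derive) => w hw lip.
have [k hk] : exists k, forall j, (k <= j)%N -> ~ B' j w.
  apply: contrapT => /forallNP h; apply: hw => k _.
  have /existsNP[j /not_implyP[kj /contrapT Bj]] := h k.
  by exists j.
near=> n.
have Nn : (N <= n)%N by near: n; exact: nbhs_infty_ge.
have kn : (k <= n)%N by near: n; exact: nbhs_infty_ge.
have n0 : 0 < n%:R :> R by rewrite ltr0n; have [] := hN n Nn; lia.
have nB : ~ B n w by have := hk n kn; rewrite /B' Nn.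
move=> x y xy yxb.
rewrite (_ : 2 * c0 * b n = n%:R * (c0 * (b n / n%:R + b n / n%:R))); last first.
  by field; rewrite gt_eqF.
apply: (@Mt_bracket n w (b n / n%:R) _ n.+3) => //.
- by rewrite divr_gt0.
- move=> j m mM; rewrite leNgt; apply/negP => hlt; apply: nB.
  by exists j, m; split => //; exact: ltW.
- by rewrite mulrC divfK ?gt_eqF.
Unshelve. all: by end_near. Qed.

End martingale_part.

(** * Cauchy-kernel smoothing *)

Section uniform_average.
Context {R : realType}.
Notation measR := (measurableTypeR R).

Lemma measurable_measR d (T : measurableType d) (f : R -> T) :
  measurable_fun setT f -> measurable_fun setT (f : measR -> T).
Proof. by move=> mf _ A mA; exact: (mf measurableT A mA). Qed.

(** Integrals over bounded intervals are written as averages under a uniform probability, so that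
    the tools for bounded functions, Fubini's theorem included, apply to them. *)
Lemma Ex_uniform_FTC (a b : R) (ab : a < b) (f F : R -> R) (M : R) :
  continuous f -> (forall x, `|f x| <= M) -> (forall x, derivable F x 1) ->
  {in `]a, b[, derive1 F =1 f} ->
  Ex (uniform_prob ab) (f : measR -> R) = (F b - F a) / (b - a).
Proof.
move=> cf fM dF F'f.
have mf : measurable_fun setT (f : measR -> R).
  by apply: measurable_measR; exact: continuous_measurable_fun.
have bf : bmf (f : measR -> R) by split => //; exists M.
have ba : 0 < b - a by rewrite subr_gt0.
have dG (x : R) : is_derive x 1 (fun x => F x + M * x) (derive1 F x + M).
  have ? : is_derive x 1 F (derive1 F x) by rewrite derive1E; apply: DeriveDef.
  by apply: is_derive_eq; rewrite /GRing.scale /=; ring.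
(* Adding [M] makes the integrand nonnegative, as [integral_uniform] requires. *)
have -> : Ex (uniform_prob ab) (f : measR -> R) =
    Ex (uniform_prob ab) (fun x : measR => f x + M) - M.
  by rewrite ExD ?Ex_cst ?addrK//; exact: bmf_cst.
have -> : Ex (uniform_prob ab) (fun x : measR => f x + M) =
    (b - a)^-1 * ((F b + M * b) - (F a + M * a)).
  rewrite /Rintegral integral_uniform; last 2 first.
  - by apply/measurable_EFinP; exact: measurable_funD.
  - by move=> x; rewrite lee_fin; have := fM x; rewrite ler_norml; lra.
  rewrite (@continuous_FTC2 _ (fun x => f x + M) (fun x => F x + M * x))//.
  - apply: continuous_subspaceT => x; apply: continuousD; first exact: cf.
    exact: cst_continuous.
  - have cG (x : R) : {for x, continuous (fun x => F x + M * x)}.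
      by apply: differentiable_continuous; apply/derivable1_diffP; have [] := dG x.
    split; first by move=> x _; have [] := dG x.
      by apply: cvg_at_right_filter; exact: cG.
    by apply: cvg_at_left_filter; exact: cG.
  - by move=> x xab; rewrite derive1E (derive_val (is_derive := dG x)) F'f.
by field; rewrite gt_eqF.
Qed.

(* The absolute value only serves to keep the integrand bounded. *)
Lemma Ex_laplace_cos (sig N c : R) (N0 : 0 < N) : 0 < sig ->
  N * Ex (uniform_prob N0) (fun th : measR => expR (- sig * `|th|) * cos (th * c)) =
  (sig + expR (- sig * N) * (c * sin (N * c) - sig * cos (N * c))) / (sig ^+ 2 + c ^+ 2).
Proof.
move=> s0; have D0 : 0 < sig ^+ 2 + c ^+ 2 by rewrite ltr_wpDr ?sqr_ge0// exprn_gt0.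
pose F (th : R) := (sig ^+ 2 + c ^+ 2)^-1 *
  (expR (- sig * th) * (c * sin (th * c) - sig * cos (th * c))).
have dF (x : R) : is_derive x 1 F (expR (- sig * x) * cos (x * c)).
  rewrite /F; apply: is_derive_eq.
  rewrite /GRing.scale /=; field; exact: lt0r_neq0.
pose f (th : R) := expR (- sig * `|th|) * cos (th * c).
rewrite (@Ex_uniform_FTC 0 N N0 f F 1) /f.
- rewrite /F mulr0 expR0 !mul0r sin0 cos0; field.
  by rewrite (gt_eqF N0) lt0r_neq0.
- move=> x; apply: (@continuousM R R (fun th : R => expR (- sig * `|th|))
    (fun th : R => cos (th * c))).
    apply: (@continuous_comp _ _ _ (fun th : R => - sig * `|th|) expR).
      apply: (@continuousM R R (fun=> - sig) (fun th : R => `|th|)).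
        exact: cst_continuous.
      exact: norm_continuous.
    exact: continuous_expR.
  by apply/differentiable_continuous/derivable1_diffP; apply: ex_derive.
- move=> x; rewrite normrM -[leRHS]mulr1; apply: ler_pM => //.
    rewrite ger0_norm ?expR_ge0// -expR0 ler_expR mulNr oppr_le0 mulr_ge0 ?(ltW s0)//.
  by rewrite ler_norml cos_geN1 cos_le1.
- by move=> x; have [] := dF x.
- move=> x; rewrite in_itv /= => /andP[x0 _].
  by rewrite derive1E (derive_val (is_derive := dF x)) ger0_norm// ltW.
Qed.

Lemma Ex_cauchy (sig x y z : R) (xy : x < y) : 0 < sig ->
  Ex (uniform_prob xy) (fun r : measR => sig / (sig ^+ 2 + (r - z) ^+ 2)) =
  (atan ((y - z) / sig) - atan ((x - z) / sig)) / (y - x).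
Proof.
move=> s0.
have D0 (r : R) : 0 < sig ^+ 2 + (r - z) ^+ 2 by rewrite ltr_wpDr ?sqr_ge0// exprn_gt0.
have dF (r : R) : is_derive r 1 (fun r => atan ((r - z) / sig)) (sig / (sig ^+ 2 + (r - z) ^+ 2)).
  apply: is_derive_eq.
  rewrite /GRing.scale /=; field; rewrite (gt_eqF s0) lt0r_neq0//.
pose f (r : R) := sig / (sig ^+ 2 + (r - z) ^+ 2).
rewrite (@Ex_uniform_FTC x y xy f (fun r => atan ((r - z) / sig)) sig^-1) /f//.
- move=> r; apply: (@continuousM R R (fun=> sig) (fun r : R => (sig ^+ 2 + (r - z) ^+ 2)^-1)).
    exact: cst_continuous.
  apply: (@continuousV R R (fun r : R => sig ^+ 2 + (r - z) ^+ 2)); first exact: lt0r_neq0.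
  by apply/differentiable_continuous/derivable1_diffP; apply: ex_derive.
- move=> r; rewrite ger0_norm ?divr_ge0 ?(ltW s0) ?(ltW (D0 r))//.
  rewrite ler_pdivrMr; last exact: D0.
  by rewrite ler_pdivlMl// expr2 lerDl sqr_ge0.
- by move=> r _; rewrite derive1E (derive_val (is_derive := dF r)).
Qed.

(** The cost of stopping the frequency integral at [N]. It is uniform in [c], hence in the value of
    [g], because [(|c| + sig) * sig] is at most twice [sig ^ 2 + c ^ 2]. *)
Lemma cauchy_truncation (sig N c : R) : 0 < sig ->
  `|(sig + expR (- sig * N) * (c * sin (N * c) - sig * cos (N * c))) / (sig ^+ 2 + c ^+ 2) -
    sig / (sig ^+ 2 + c ^+ 2)| <= expR (- sig * N) * (2 / sig).
Proof.
move=> s0; have D0 : 0 < sig ^+ 2 + c ^+ 2 by rewrite ltr_wpDr ?sqr_ge0// exprn_gt0.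
rewrite -mulrBl addrC addKr -mulrA normrM ger0_norm ?expR_ge0// ler_wpM2l ?expR_ge0//.
rewrite normrM [X in _ * X]ger0_norm ?invr_ge0 ?(ltW D0)// ler_pdivrMr//.
apply: (@le_trans _ _ (`|c| + sig)).
  rewrite (le_trans (ler_normB _ _))// !normrM (gtr0_norm s0) lerD//.
    by rewrite -[leRHS]mulr1 ler_wpM2l// ler_norml sin_geN1 sin_le1.
  by rewrite -[leRHS]mulr1 ler_wpM2l ?(ltW s0)// ler_norml cos_geN1 cos_le1.
rewrite -mulrA mulrCA mulrC ler_pdivlMr//.
have := sqr_ge0 (sig - `|c|); rewrite -(real_normK (num_real c)).
have := normr_ge0 c; set u := `|c|; nra.
Qed.

Lemma integral_cauchy_le (N : R) : 0 < N ->
  (\int[@lebesgue_measure R]_(x in `[0%R, N]) ((1 + x ^+ 2)^-1)%R%:E <= 2%:E)%E.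
Proof.
move=> N0.
have D0 (r : R) : 0 < 1 + r ^+ 2 by rewrite ltr_wpDr ?sqr_ge0.
have cA (x : R) : {for x, continuous (@atan R)} by exact: continuous_atan.
rewrite (@continuous_FTC2 _ _ atan)//.
- by rewrite atan0 -EFinB subr0 lee_fin ltW// (lt_trans (atan_ltpi2 _))// pihalf_lt2.
- apply: continuous_subspaceT => r; apply: (@continuousV R R (fun r : R => 1 + r ^+ 2)).
    exact: lt0r_neq0.
  by apply/differentiable_continuous/derivable1_diffP; apply: ex_derive.
- split; first by move=> x _; exact: derivable_atan.
    by apply: cvg_at_right_filter; exact: cA.
  by apply: cvg_at_left_filter; exact: cA.
- by move=> x _; rewrite derive1_atan.
Qed.

End uniform_average.

(** * From arctangents to indicators *)

Section atan_limit.
Context {d} {T : measurableType d} {R : realType} (Q : probability T R).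
Variables (Z : T -> R) (mZ : measurable_fun setT Z) (x : R).
Hypothesis noatom : Q [set t | Z t = x] = 0%E.

Lemma measurable_atanM (r c : R) : measurable_fun setT (fun t => atan ((r - Z t) / c)).
Proof.
apply: (measurableT_comp (f := @atan R)).
  by apply: continuous_measurable_fun => u; exact: continuous_atan.
by apply: measurable_funM => //; apply: measurable_funB.
Qed.

Lemma norm_atan_le2 (u : R) : `|atan u| <= 2.
Proof.
have h := @pihalf_lt2 R.
by rewrite ler_norml; have := atan_gtNpi2 u; have := atan_ltpi2 u; lra.
Qed.

Lemma bmf_atanM (r c : R) : bmf (fun t => atan ((r - Z t) / c)).
Proof.
by split; [exact: measurable_atanM|exists 2 => t; exact: norm_atan_le2].
Qed.

Lemma cvg_atan_pos (u : R) : 0 < u -> (fun j : nat => atan (u / j.+1%:R^-1)) @ \oo --> pi / 2.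
Proof.
move=> u0; apply: (cvg_comp (fun j : nat => u / j.+1%:R^-1) (@atan R) _ (@cvgy_atan R)).
apply/cvgryPge => A; near=> j.
rewrite invrK -ler_pdivrMl// mulrC.
apply: (@le_trans _ _ j%:R); last by rewrite ler_nat.
by near: j; exact: nbhs_infty_ger.
Unshelve. all: by end_near. Qed.

(** Dominated convergence with bound 2. Where [Z = x] every arctangent is 0 while the limit function
    is [pi / 2], hence the hypothesis that [x] is not an atom. *)
Lemma cvg_Ex_atan : (fun j : nat => Ex Q (fun t => atan ((x - Z t) / j.+1%:R^-1))) @ \oo -->
  pi * Ex Q (fun t => ((Z t <= x)%R : bool)%:R) - pi / 2.
Proof.
have bb : bmf (fun t => ((Z t <= x)%R : bool)%:R : R).
  by apply: bmf_bool; exact: measurable_fun_ler.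
pose f t : R := pi * ((Z t <= x)%R : bool)%:R - pi / 2.
have bf : bmf f by apply: bmfB; [apply: bmfM => //; exact: bmf_cst|exact: bmf_cst].
have -> : pi * Ex Q (fun t => ((Z t <= x)%R : bool)%:R) - pi / 2 = Ex Q f.
  rewrite /f ExB ?Ex_cst ?ExZ//; [|exact: bmf_cst].
  by apply: bmfM => //; exact: bmf_cst.
have [|||||_ _ h] := @dominated_convergence _ T R Q setT measurableT
  (fun j t => (atan ((x - Z t) / j.+1%:R^-1))%:E) (EFin \o f) (cst 2%:E).
- by move=> j; apply/measurable_EFinP; exact: measurable_atanM.
- by apply/measurable_EFinP; exact: bmf_measurable.
- exists [set t | Z t = x]; split => //.
    rewrite (_ : [set t | _] = [set: T] `&` Z @^-1` [set x]); first exact: mZ.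
    by rewrite setTI.
  move=> t /=; apply: contra_notP => ntx _.
  apply: cvg_EFin; first by apply: nearW.
  suff : (fun j : nat => atan ((x - Z t) / j.+1%:R^-1)) @ \oo --> f t by [].
  have [tx|tx|//] := ltgtP (Z t) x.
    rewrite /f (ltW tx) mulr1 (_ : pi - pi / 2 = pi / 2 :> R); last by field.
    by apply: cvg_atan_pos; rewrite subr_gt0.
  rewrite /f leNgt tx mulr0 sub0r.
  have -> : (fun j : nat => atan ((x - Z t) / j.+1%:R^-1)) =
      (fun j : nat => - atan ((Z t - x) / j.+1%:R^-1)).
    by apply/funext => j; rewrite -atanN -mulNr opprB.
  by apply: cvgN; apply: cvg_atan_pos; rewrite subr_gt0.
- by apply: (bmf_integrable Q (bmf_cst 2)).
- by apply: aeW => t j _; rewrite lee_fin norm_atan_le2.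
by move: h; rewrite -(EFin_Ex Q bf) => /fine_cvg.
Qed.

End atan_limit.

(** * Fourier inversion for the predictable part *)

Section inversion.
Context {d} {Omega : measurableType d} {R : realType} (P : probability Omega R).
Variables (eps : int -> Omega -> R) (eps0' : Omega -> R) (g : seqT R -> R).
Hypothesis iid : iid_family P (fam eps eps0').
Hypothesis mg : seq_measurable g.
Local Notation mu0 := (xilaw iid).
Local Notation Xi := (Xi eps eps0').
Local Notation csum := (csum iid).
Notation measR := (measurableTypeR R).
Let mgT : measurable_fun setT g := measurable_g mg.
Variables (n : nat) (w : Omega).
Implicit Types h : seqT R -> R.

Lemma csumD h1 h2 : bmf h1 -> bmf h2 ->
  csum (fun s => h1 s + h2 s) n w = csum h1 n w + csum h2 n w.
Proof.
move=> b1 b2; rewrite -big_split; apply: eq_bigr => i _ /=.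
by rewrite cED// ExD//; ring.
Qed.

Lemma csumZ (c : R) h : bmf h -> csum (fun s => c * h s) n w = c * csum h n w.
Proof.
move=> b1; rewrite mulr_sumr; apply: eq_bigr => i _.
by rewrite cEZ// ExZ// mulrBr.
Qed.

Lemma csumB h1 h2 : bmf h1 -> bmf h2 ->
  csum (fun s => h1 s - h2 s) n w = csum h1 n w - csum h2 n w.
Proof.
move=> b1 b2; rewrite -sumrB; apply: eq_bigr => i _ /=.
by rewrite cEB// ExB//; ring.
Qed.

Lemma csum_bound h (M : R) : bmf h -> (forall s, `|h s| <= M) ->
  `|csum h n w| <= n%:R * (M + M).
Proof.
move=> bh hM; apply: le_trans (ler_norm_sum _ _ _) _.
rewrite (_ : n%:R * (M + M) = \sum_(i < n) (M + M)); last first.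
  by rewrite sumr_const card_ord mulr_natl.
apply: ler_sum => i _; rewrite (le_trans (ler_normB _ _))// lerD//.
  exact: cE_bound.
exact: Ex_bound.
Qed.

Lemma csum_Fubini (U : probability measR R) (H : measR * seqT R -> R) : bmf H ->
  csum (fun s => Ex U (fun r => H (r, s))) n w =
  Ex U (fun r => csum (fun s => H (r, s)) n w).
Proof.
move=> bH.
have b1 s0 : bmf (fun z : seqT R * measR => H (z.2, smerge 1 s0 z.1)).
  apply: bmf_comp bH; apply: measurable_fun_pair => //.
  by apply: (@measurable_smerge _ 1 _ _ (fun=> s0)).
have b2 : bmf (fun z : seqT R * measR => H (z.2, z.1)).
  by apply: bmf_comp bH; exact: measurable_fun_pair.
rewrite /csum Ex_sum; last first.
  move=> i _; apply: bmfB; first exact: (bmf_Ex1 mu0 U (b1 (Xi i%:Z w))).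
  exact: (bmf_Ex1 mu0 U b2).
apply: eq_bigr => i _; rewrite ExB.
- by rewrite /cE (Ex_Fubini mu0 U (b1 _)) (Ex_Fubini mu0 U b2).
- exact: (bmf_Ex1 mu0 U (b1 (Xi i%:Z w))).
- exact: (bmf_Ex1 mu0 U b2).
Qed.

Let c (th : R) := csum (cosg g th) n w.
Let s (th : R) := csum (sing g th) n w.
Let Hh (th : measR) : R := `|c th| + `|s th|.

Let bc : bmf (c : measR -> R).
Proof. exact: (bmf_pair1 w (bmf_csum_joint iid (bmf_cosg_joint mg) n)). Qed.
Let bs : bmf (s : measR -> R).
Proof. exact: (bmf_pair1 w (bmf_csum_joint iid (bmf_sing_joint mg) n)). Qed.
Let bHh : bmf Hh. Proof. by apply: bmfD; exact: bmf_norm. Qed.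

Hypothesis Lfin : (Lam g iid n w < +oo)%E.
Definition Jbound : R := 2 * Num.sqrt (fine (Lam g iid n w)).

(** The Cauchy--Schwarz inequality obtained by optimizing a weighted mean inequality: the best [l]
    is [2 / sqrt A], and when [A = 0] an arbitrarily large [l] is taken. *)
Lemma sqrt_optimization (X A : R) : 0 <= A ->
  (forall l : R, 0 < l -> X <= l / 2 * A + l^-1 * 2) -> X <= 2 * Num.sqrt A.
Proof.
move=> A0 hX; have [A1|A1] := ltP 0 A.
  have r0 : 0 < Num.sqrt A by rewrite sqrtr_gt0.
  have l0 : 0 < 2 / Num.sqrt A by rewrite divr_gt0.
  apply: (le_trans (hX _ l0)); rewrite -[X in _ * X + _](sqr_sqrtr A0).
  rewrite le_eqVlt; apply/orP; left; apply/eqP; field.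
  by rewrite gt_eqF.
have -> : A = 0 by apply/eqP; rewrite eq_le A1.
rewrite sqrtr0 mulr0; apply/ler_addgt0Pr => e e0; rewrite add0r.
have l0 : 0 < 2 / e by rewrite divr_gt0.
apply: (le_trans (hX _ l0)).
have -> : A = 0 by apply/eqP; rewrite eq_le A1.
rewrite mulr0 add0r le_eqVlt; apply/orP; left; apply/eqP; field.
by rewrite gt_eqF.
Qed.

Lemma average_H (N : R) (N0 : 0 < N) : N * Ex (uniform_prob N0) Hh <= Jbound.
Proof.
have q0 (th : R) : 0 < 1 + th ^+ 2 by rewrite ltr_wpDr// sqr_ge0.
have mq : measurable_fun setT (fun th : measR => 1 + th ^+ 2).
  by apply: measurable_funD => //; exact: measurable_funX.
pose E (th : measR) : R := (1 + th ^+ 2) * (c th ^+ 2 + s th ^+ 2).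
have E0 th : 0 <= E th by rewrite mulr_ge0 ?(ltW (q0 th))// addr_ge0// sqr_ge0.
have mE : measurable_fun setT E.
  apply: measurable_funM => //; apply: measurable_funD; apply: measurable_funX;
    [exact: bmf_measurable bc|exact: bmf_measurable bs].
have mqV : measurable_fun setT (fun th : measR => (1 + th ^+ 2)^-1).
  apply: measurable_measR; apply: continuous_measurable_fun => x.
  apply: (@continuousV R R (fun r : R => 1 + r ^+ 2)); first exact: lt0r_neq0.
  by apply/differentiable_continuous/derivable1_diffP; apply: ex_derive.
have LE : Lam g iid n w = (\int[@lebesgue_measure R]_th (E th)%:E)%E by [].
apply: sqrt_optimization; first by rewrite fine_ge0// Lam_ge0.
move=> l l0; rewrite -lee_fin EFinM (EFin_Ex _ bHh).
rewrite integral_uniform; last 2 first.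
- by apply/measurable_EFinP; exact: bmf_measurable.
- by move=> th; rewrite lee_fin addr_ge0.
rewrite subr0 muleA -EFinM divff ?gt_eqF// mul1e.
apply: (@le_trans _ _ (\int[@lebesgue_measure R]_(th in `[0%R, N])
   ((l / 2)%:E * (E th)%:E + (l^-1)%:E * ((1 + th ^+ 2)^-1)%R%:E))%E).
  apply: ge0_le_integral => //.
  - by move=> th _; rewrite lee_fin addr_ge0.
  - by apply/measurable_EFinP; apply: measurable_funTS; exact: bmf_measurable.
  - apply: measurable_funTS; apply: emeasurable_funD; apply: measurable_funeM;
      exact/measurable_EFinP.
  - move=> th _; rewrite -!EFinM -EFinD lee_fin /E /Hh.
    rewrite -(real_normK (num_real (c th))) -(real_normK (num_real (s th))).
    have qq := q0 th; move: (normr_ge0 (c th)) (normr_ge0 (s th)).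
    set u := `|c th|; set v := `|s th|; set q := 1 + th ^+ 2 in qq * => u0 v0.
    (* Applied to both components. The inverse weights add up to [l^-1 / (1 + th ^ 2)], whose
       integral [integral_cauchy_le] bounds by [2 / l]. *)
    have amgm (z : R) : z <= l / 2 * (q * z ^+ 2) + l^-1 * q^-1 / 2.
      rewrite -subr_ge0 (_ : _ - z = (l * q * z - 1) ^+ 2 / (2 * l * q)).
        by rewrite divr_ge0 ?sqr_ge0// !mulr_ge0// ltW.
      by field; rewrite (gt_eqF l0) gt_eqF.
    have := amgm u; have := amgm v.
    rewrite mulrDr [l / 2 * (_ + _)]mulrDr; lra.
rewrite ge0_integralD//; last 4 first.
- by move=> th _; rewrite -EFinM lee_fin mulr_ge0// divr_ge0// ltW.
- by apply: measurable_funTS; apply: measurable_funeM; exact/measurable_EFinP.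
- by move=> th _; rewrite -EFinM lee_fin mulr_ge0// invr_ge0 ltW.
- by apply: measurable_funTS; apply: measurable_funeM; exact/measurable_EFinP.
rewrite ge0_integralZl_EFin//; last 3 first.
- by move=> th _; rewrite lee_fin.
- by apply: measurable_funTS; exact/measurable_EFinP.
- by rewrite divr_ge0// ltW.
rewrite ge0_integralZl_EFin//; last 3 first.
- by move=> th _; rewrite lee_fin invr_ge0 ltW.
- by apply: measurable_funTS; exact/measurable_EFinP.
- by rewrite invr_ge0 ltW.
rewrite EFinD; apply: leeD.
  rewrite [leRHS]EFinM lee_wpmul2l// ?lee_fin ?divr_ge0 ?(ltW l0)//.
  rewrite fineK; last by rewrite ge0_fin_numE// Lam_ge0.
  rewrite LE; apply: ge0_subset_integral => //; first exact/measurable_EFinP.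
  by move=> th _; rewrite lee_fin.
rewrite [leRHS]EFinM lee_wpmul2l// ?lee_fin ?invr_ge0 ?(ltW l0)//.
exact: integral_cauchy_le.
Qed.

Section kernel.
Variables (sig : R) (s0 : 0 < sig).
Let kern (a : R) : R := sig / (sig ^+ 2 + a ^+ 2).

Let D0 (a : R) : 0 < sig ^+ 2 + a ^+ 2.
Proof. by rewrite ltr_wpDr ?sqr_ge0// exprn_gt0. Qed.

Let bkern : bmf (kern : R -> R).
Proof.
split; last first.
  exists sig^-1 => a; rewrite ger0_norm ?divr_ge0 ?(ltW s0) ?(ltW (D0 a))//.
  by rewrite ler_pdivrMr ?D0// ler_pdivlMl// -expr2 lerDl sqr_ge0.
apply: continuous_measurable_fun => a.
apply: (@continuousM R R (fun=> sig) (fun r : R => (sig ^+ 2 + r ^+ 2)^-1)).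
  exact: cst_continuous.
apply: (@continuousV R R (fun r : R => sig ^+ 2 + r ^+ 2)); first exact: lt0r_neq0.
by apply/differentiable_continuous/derivable1_diffP; apply: ex_derive.
Qed.

Let mrg (r : R) : measurable_fun setT (fun u : seqT R => r - g u).
Proof. exact: measurable_funB. Qed.

Let bkg (r : R) : bmf (fun u : seqT R => kern (r - g u)).
Proof. exact: (bmf_comp (mrg r) bkern). Qed.

Let K (r : R) (z : measR * seqT R) : R := expR (- sig * `|z.1|) * cos (z.1 * (r - g z.2)).

Let bK r : bmf (K r).
Proof.
apply: bmfM.
  split; last first.
    exists 1 => z; rewrite ger0_norm ?expR_ge0// -expR0 ler_expR mulNr oppr_le0.
    by rewrite mulr_ge0// ltW.
  apply: measurableT_comp => //; apply: measurable_funM => //.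
  by apply: measurableT_comp => //; exact: measurableT_comp.
apply: bmf_cos; apply: measurable_funM => //.
by apply: (measurableT_comp (mrg r)).
Qed.

(** Expanding [cos (th * (r - g))] expresses the sum through the cosine and sine sums with
    coefficients at most 1 in absolute value, so the bound depends neither on [N] nor on [sig]. *)
Lemma csum_truncated_kernel (r N : R) (N0 : 0 < N) :
  `|csum (fun u => N * Ex (uniform_prob N0) (fun th => K r (th, u))) n w| <= Jbound.
Proof.
have bEK : bmf (fun u => Ex (uniform_prob N0) (fun th => K r (th, u))).
  exact: (bmf_Ex1 _ mu0 (bK r)).
rewrite csumZ// (csum_Fubini _ (bK r)) normrM (gtr0_norm N0).
apply: le_trans (average_H N0); rewrite ler_pM2l//.
have bcs : bmf (fun th : measR => csum (fun u => K r (th, u)) n w).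
  exact: (bmf_pair1 w (bmf_csum_joint iid (bK r) n)).
apply: (le_trans (Ex_norm _ bcs)); apply: Ex_le => //; first exact: bmf_norm.
move=> th; set e := expR (- sig * `|th|).
have -> : csum (fun u => K r (th, u)) n w =
    e * (cos (th * r) * c th + sin (th * r) * s th).
  have b1 := bmf_cosg mg th; have b2 := bmf_sing mg th.
  have b3 := bmfM (bmf_cst (cos (th * r))) b1; have b4 := bmfM (bmf_cst (sin (th * r))) b2.
  rewrite -csumZ// -csumZ// -csumD// -csumZ; last exact: bmfD.
  congr (csum _ n w); apply/funext => u.
  by rewrite /K /= -/e mulrBr cosB.
have e1 : `|e| <= 1.
  by rewrite ger0_norm ?expR_ge0// -expR0 ler_expR mulNr oppr_le0 mulr_ge0// ltW.
rewrite normrM -[leRHS]mul1r; apply: ler_pM => //.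
apply: (le_trans (ler_normD _ _)); rewrite !normrM; apply: lerD.
  by rewrite -[leRHS]mul1r ler_wpM2r// ler_norml cos_geN1 cos_le1.
by rewrite -[leRHS]mul1r ler_wpM2r// ler_norml sin_geN1 sin_le1.
Qed.

Lemma csum_kernel (r : R) : `|csum (fun u => kern (r - g u)) n w| <= Jbound.
Proof.
apply/ler_addgt0Pr => e e0.
(* The truncation error is at most [4 n / (sig ^ 2 * N)], by [exp (- sig * N) <= 1 / (sig * N)];
   this [N] brings it below [e], and the 1 keeps it positive. *)
pose N : R := 4 * n%:R / (sig ^+ 2 * e) + 1.
have N0 : 0 < N by rewrite ltr_wpDl// divr_ge0// ?mulr_ge0// ?sqr_ge0// ltW.
have bEK : bmf (fun u => N * Ex (uniform_prob N0) (fun th => K r (th, u))).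
  apply: bmfM; first exact: bmf_cst.
  exact: (bmf_Ex1 _ mu0 (bK r)).
rewrite (_ : csum _ n w = csum (fun u => N * Ex (uniform_prob N0) (fun th => K r (th, u))) n w -
  csum (fun u => N * Ex (uniform_prob N0) (fun th => K r (th, u)) - kern (r - g u)) n w); last first.
  by rewrite csumB// opprB addrC subrK.
apply: (le_trans (ler_normB _ _)); apply: lerD; first exact: csum_truncated_kernel.
have bd : bmf (fun u => N * Ex (uniform_prob N0) (fun th => K r (th, u)) - kern (r - g u)).
  exact: bmfB.
have hb u : `|N * Ex (uniform_prob N0) (fun th => K r (th, u)) - kern (r - g u)| <=
    expR (- sig * N) * (2 / sig).
  by rewrite (Ex_laplace_cos (r - g u) N0 s0); exact: cauchy_truncation.
apply: (le_trans (csum_bound bd hb)).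
have sN : 0 < sig * N by rewrite mulr_gt0.
have eN : expR (- sig * N) <= (sig * N)^-1.
  rewrite mulNr expRN lef_pV2 ?posrE ?expR_gt0//.
  by rewrite (le_trans _ (expR_ge1Dx _))// lerDr.
apply: (@le_trans _ _ (n%:R * ((sig * N)^-1 * (2 / sig) + (sig * N)^-1 * (2 / sig)))).
  by rewrite ler_wpM2l// lerD// ler_wpM2r// divr_ge0// ltW.
rewrite (_ : n%:R * _ = 4 * n%:R / sig ^+ 2 / N); last by field; rewrite !gt_eqF.
rewrite ler_pdivrMr// /N mulrDr mulr1 (_ : e * _ = 4 * n%:R / sig ^+ 2).
  by rewrite lerDl ltW.
by field; rewrite (gt_eqF e0) gt_eqF.
Qed.

(** The difference of arctangents is the kernel integrated over [[x, y]], so the bound of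
    [csum_kernel], uniform in position and scale, is multiplied by the length. *)
Lemma csum_atan (x y : R) : x < y ->
  `|csum (fun u => atan ((y - g u) / sig)) n w - csum (fun u => atan ((x - g u) / sig)) n w| <=
  (y - x) * Jbound.
Proof.
move=> xy; have yx : 0 < y - x by rewrite subr_gt0.
rewrite -csumB; [|exact: bmf_atanM..].
have bk : bmf (fun z : measR * seqT R => kern (z.1 - g z.2)).
  apply: (bmf_comp _ bkern); apply: measurable_funB; first exact: measurable_fst.
  exact: (measurableT_comp mgT).
rewrite (_ : (fun u => _) =
    (fun u => (y - x) * Ex (uniform_prob xy) (fun r => kern (r - g u)))); last first.
  by apply/funext => u; rewrite Ex_cauchy// [RHS]mulrC divfK// gt_eqF.
rewrite csumZ; last exact: (bmf_Ex1 _ mu0 bk).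
rewrite normrM (gtr0_norm yx) ler_pM2l//.
rewrite (csum_Fubini (uniform_prob xy) bk).
apply: Ex_bound; first exact: (bmf_pair1 w (bmf_csum_joint iid bk n)).
by move=> r; exact: csum_kernel.
Qed.

End kernel.

Hypothesis noatom : forall (i : nat) (x : R),
  mu0 [set t | g (smerge 1 (Xi i%:Z w) t) = x] = 0%E.
Hypothesis noatom0 : forall x : R, mu0 [set t | g t = x] = 0%E.

(** Each summand is centred, so the constants [pi / 2] of the two limits cancel. *)
Lemma cvg_csum_atan (x : R) :
  (fun j : nat => csum (fun u => atan ((x - g u) / j.+1%:R^-1)) n w) @ \oo -->
  pi * csum (leg g x) n w.
Proof.
rewrite (_ : pi * csum (leg g x) n w = \sum_(i < n) ((pi * cE mu0 1 (leg g x) (Xi i%:Z w) - pi / 2) -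
  (pi * Ex mu0 (leg g x) - pi / 2))); last first.
  by rewrite mulr_sumr; apply: eq_bigr => i _; ring.
have h0 := cvg_Ex_atan mgT (noatom0 x).
have hi (i : nat) := @cvg_Ex_atan _ _ R mu0 (fun t => g (smerge 1 (Xi i%:Z w) t))
  (measurableT_comp mgT (@measurable_smerge _ 1 _ _ (fun=> Xi i%:Z w) id
     (measurable_cst _) (@measurable_id _ _ _))) x (noatom i x).
rewrite /csum; elim: n => [|m ih].
  rewrite big_ord0 (_ : (fun j : nat => _) = fun=> 0); first exact: cvg_cst.
  by apply/funext => j; rewrite big_ord0.
rewrite big_ord_recr /=.
rewrite (_ : (fun j : nat => _) = (fun j : nat => \sum_(i < m)
   (cE mu0 1 (fun u => atan ((x - g u) / j.+1%:R^-1)) (Xi i%:Z w) -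
    Ex mu0 (fun u => atan ((x - g u) / j.+1%:R^-1))) +
   (cE mu0 1 (fun u => atan ((x - g u) / j.+1%:R^-1)) (Xi m%:Z w) -
    Ex mu0 (fun u => atan ((x - g u) / j.+1%:R^-1))))); last first.
  by apply/funext => j; rewrite big_ord_recr.
by apply: cvgD => //; apply: cvgB; [exact: (hi m)|exact: h0].
Qed.

Lemma csum_leg_lipschitz (x y : R) : x <= y ->
  `|csum (leg g y) n w - csum (leg g x) n w| <= (y - x) * Num.sqrt (fine (Lam g iid n w)).
Proof.
rewrite le_eqVlt => /predU1P[->|xy]; first by rewrite !subrr normr0 mul0r.
have : `|pi * csum (leg g y) n w - pi * csum (leg g x) n w| <= (y - x) * Jbound.
  have hl : (fun j : nat => `|csum (fun u => atan ((y - g u) / j.+1%:R^-1)) n w -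
      csum (fun u => atan ((x - g u) / j.+1%:R^-1)) n w|) @ \oo -->
      `|pi * csum (leg g y) n w - pi * csum (leg g x) n w|.
    by apply: cvg_norm; apply: cvgB; exact: cvg_csum_atan.
  apply: (cvgr_to_le hl).
  by apply: nearW => j /=; apply: csum_atan => //; rewrite invr_gt0.
rewrite -mulrBr normrM ger0_norm ?pi_ge0//.
set D := `|_ - _| => h.
(* The factor 2 in [Jbound] is absorbed by [pi >= 2]. *)
have D2 : 2 * D <= pi * D by apply: ler_wpM2r; [exact: normr_ge0|exact: pi_ge2].
have := le_trans D2 h; by rewrite /Jbound mulrCA ler_pM2l.
Qed.

End inversion.

(** * Decomposition of the empirical process *)

Section conclusion.
Context {d} {Omega : measurableType d} {R : realType} (P : probability Omega R).
Variables (eps : int -> Omega -> R) (eps0' : Omega -> R) (g : seqT R -> R).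
Hypothesis iid : iid_family P (fam eps eps0').
Hypothesis mg : seq_measurable g.
Local Notation mu0 := (xilaw iid).
Local Notation Xi := (Xi eps eps0').
Local Notation Mt := (Mt g iid).
Local Notation cgap := (cgap g iid).
Local Notation csum := (csum iid).
Local Notation Lam := (Lam g iid).
Let mgT : measurable_fun setT g := measurable_g mg.
Let F := distF P g eps.

(** The compensators subtracted in [Mt] are those that [csum] adds back, with the index shifted by
    one. *)
Lemma Gn_increment n w x y : (0 < n)%N ->
  Gn g eps F n w y - Gn g eps F n w x =
  (Num.sqrt n%:R)^-1 * (Mt n x y w + (csum (leg g y) n w - csum (leg g x) n w)).
Proof.
move=> n0.
have n0' : 0 < n%:R :> R by rewrite ltr0n.
have r0 : 0 < Num.sqrt n%:R :> R by rewrite sqrtr_gt0.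
have r2 : Num.sqrt n%:R ^+ 2 = n%:R :> R by rewrite sqr_sqrtr// ltW.
have E : Mt n x y w + (csum (leg g y) n w - csum (leg g x) n w) =
    \sum_(1 <= i < n.+1) leg g y (Xi i%:Z w) - \sum_(1 <= i < n.+1) leg g x (Xi i%:Z w) -
    n%:R * (F y - F x).
  rewrite /Mt sumrB; set S1 := \sum_(_ <= _ < _) gap _ _ _ _.
  have -> : S1 = \sum_(1 <= i < n.+1) leg g y (Xi i%:Z w) -
      \sum_(1 <= i < n.+1) leg g x (Xi i%:Z w) by rewrite -sumrB.
  have -> : csum (leg g y) n w - csum (leg g x) n w =
      \sum_(1 <= i < n.+1) cgap x y (Xi (i%:Z - 1) w) - n%:R * (F y - F x).
    rewrite big_add1 big_mkord /= -sumrB.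
    rewrite (_ : n%:R * (F y - F x) = \sum_(i < n) (F y - F x)); last first.
      by rewrite sumr_const card_ord mulr_natl.
    rewrite -sumrB; apply: eq_bigr => i _.
    rewrite /F !(distFE iid mg) /cgap (_ : i.+1%:Z - 1 = i%:Z); last by lia.
    by ring.
  by ring.
have FnE z : Fn g eps n w z = n%:R^-1 * \sum_(1 <= i < n.+1) leg g z (Xi i%:Z w) by [].
rewrite E /Gn !FnE; set r := Num.sqrt n%:R in r0 r2 *.
by rewrite -r2; field; rewrite gt_eqF.
Qed.

Lemma Deltan_le n w (bn M : R) : 0 < bn ->
  (forall x y, x <= y -> y - x <= bn -> `|Gn g eps F n w y - Gn g eps F n w x| <= M) ->
  Deltan g eps F n bn w <= M.
Proof.
move=> b0 h; apply: sup_le_ub.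
  exists `|Gn g eps F n w 0 - Gn g eps F n w 0|, 0, 0; split => //.
  by rewrite subrr normr0 ltW.
move=> _ [x [y [xyb ->]]]; have [xy|/ltW yx] := leP x y.
  by rewrite distrC; apply: h => //; rewrite (le_trans _ xyb)// distrC ler_norm.
by apply: h => //; rewrite (le_trans _ xyb)// ler_norm.
Qed.

Variables (c0 : R) (c0_gt0 : 0 < c0).

Lemma measure0_small d' (T : measurableType d') (Q : probability T R) (A : set T) (k : R) :
  measurable A -> 0 < k -> (forall e : R, 0 < e -> fine (Q A) <= k * e) -> Q A = 0%E.
Proof.
move=> mA k0 h; rewrite -[LHS]fineK; last exact: fin_num_measure.
congr EFin; apply/eqP; rewrite eq_le fine_ge0// andbT.
apply/ler_addgt0Pr => e e0; rewrite add0r.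
have := h (e / k); rewrite (mulrC k) divfK ?gt_eqF//; apply.
by rewrite divr_gt0.
Qed.

Lemma measurable_level d' (T : measurableType d') (Z : T -> R) (x : R) :
  measurable_fun setT Z -> measurable [set t | Z t = x].
Proof. by move=> mZ; rewrite -[X in measurable X]setTI; exact: (mZ measurableT [set x]). Qed.

Lemma level_le_gap (x e : R) u : 0 < e -> (g u == x)%:R <= gap g (x - e) x u.
Proof.
move=> e0; rewrite /gap /leg; have [->|_] := eqVneq (g u) x.
  by rewrite lexx (_ : (x <= x - e) = false) ?subr0//; apply/negbTE; rewrite -ltNge ltrBlDr ltrDl.
by rewrite subr_ge0 ler_nat; case: (leP (g u) (x - e)) => // h; rewrite (le_trans h)// gerBl ltW.
Qed.

Lemma fine_level d' (T : measurableType d') (Q : probability T R) (Z : T -> R) x :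
  measurable_fun setT Z -> fine (Q [set t | Z t = x]) = Ex Q (fun t => (Z t == x)%:R).
Proof.
move=> mZ; rewrite Ex_bool; last exact: measurable_fun_eqr.
by congr (fine (Q _)); apply/seteqP; split=> t /= /eqP.
Qed.

(** The level set [g = x] lies in [x - e < g <= x], of conditional probability at most [c0 * e]. *)
Lemma noatom_of_lip (s : seqT R) (x : R) :
  (forall x y : R, x <= y -> cgap x y s <= c0 * (y - x)) ->
  mu0 [set t | g (smerge 1 s t) = x] = 0%E.
Proof.
move=> lip.
have mZ : measurable_fun setT (fun t => g (smerge 1 s t)).
  by apply: (measurableT_comp mgT); apply: (@measurable_smerge _ 1 _ _ (fun=> s) id).
apply: (measure0_small _ c0_gt0); first exact: (measurable_level x mZ).
move=> e e0; rewrite (fine_level _ _ mZ).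
have xe : x - e <= x by rewrite gerBl ltW.
have := lip _ _ xe; rewrite subKr; apply: le_trans.
rewrite /cgap /cE -ExB; [|by apply: bmf_smerge; exact: bmf_leg..].
apply: Ex_le.
- by apply: bmf_bool; exact: measurable_fun_eqr.
- by apply: bmfB; apply: bmf_smerge; exact: bmf_leg.
- by move=> t; exact: level_le_gap.
Qed.

Lemma noatom_xilaw (x : R) :
  (forall a c : R, a <= c -> {ae mu0, forall s, cgap a c s <= c0 * (c - a)}) ->
  mu0 [set t | g t = x] = 0%E.
Proof.
move=> lip.
apply: (measure0_small _ c0_gt0); first exact: (measurable_level x mgT).
move=> e e0; rewrite (fine_level _ _ mgT).
have xe : x - e <= x by rewrite gerBl ltW.
apply: (@le_trans _ _ (Ex mu0 (gap g (x - e) x))).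
  apply: Ex_le.
  - by apply: bmf_bool; exact: measurable_fun_eqr.
  - exact: bmf_gap.
  - by move=> t; exact: level_le_gap.
rewrite -(Ex_step (pi_inv iid) (bmf_gap mg _ _)) step_gap//.
rewrite -[leRHS](Ex_cst mu0); apply: ae_Ex_le.
- exact: bmf_cgap.
- exact: bmf_cst.
- by have := lip _ _ xe; rewrite subKr.
Qed.

End conclusion.

(** * Assembly of the two parts *)

Theorem theorem2p1 (d : measure_display) (Omega : measurableType d)
  (R : realType) (P : probability Omega R)
  (eps : int -> Omega -> R) (eps0' : Omega -> R) (g : (nat -> R) -> R)
  (f : R -> R) (b : nat -> R) (c0 : R) :
  iid_family P (fam eps eps0') ->
  seq_measurable g ->
  (* F has a density f, square integrable, with square integrable derivative *)
  measurable_fun setT f -> (forall x, 0 <= f x) ->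
  (forall x, (distF P g eps x)%:E =
     (\int[@lebesgue_measure R]_(t in `]-oo, x]) (f t)%:E)%E) ->
  (@lebesgue_measure R).-integrable setT (fun t => (f t ^+ 2)%:E) ->
  (forall x, derivable f x 1) ->
  (@lebesgue_measure R).-integrable setT (fun t => (derive1 f t ^+ 2)%:E) ->
  (* conditional distribution functions are a.s. differentiable *)
  (forall k : nat, (1 <= k)%N ->
     {ae P, forall w, forall x : R, derivable (condF P g eps k (xi0 eps w)) x 1}) ->
  (* bandwidths *)
  (forall n, 0 < b n) -> b @ \oo --> 0 ->
  (exists C : R, \forall n \near \oo, ln (n%:R : R) <= C * (n%:R * b n)) ->
  (* bounded conditional density f_1 *)
  0 < c0 ->
  {ae P, forall w, forall x : R, derive1 (condF P g eps 1 (xi0 eps w)) x <= c0} ->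
  (* summability condition on conditional characteristic functions *)
  (forall k : nat, (1 <= k)%N -> (Ik P g eps eps0' k < +oo)%E) ->
  cvg (series (fun k : nat => Num.sqrt (fine (Ik P g eps eps0' k.+1))) @ \oo) ->
  exists A B : nat -> Omega -> R,
    (forall (n : nat) (w : Omega),
       Deltan g eps (distF P g eps) n (b n) w <= A n w + B n w) /\
    {ae P, forall w, exists C : R,
       \forall n \near \oo, A n w / Num.sqrt (b n * ln (n%:R : R)) <= C} /\
    {ae P, forall w,
       (fun n : nat => B n w / (b n * iota_fun n)) @ \oo --> (0 : R)}.
Proof.
move=> iid mg mf f0 Ff If2 df Idf2 dcondF b0 bto0 bC c0_gt0 condF_le Ifin Isum.
have dcond1 := dcondF 1%N isT.
pose Lam := Lam g iid.
(* [B] is the Lipschitz bound of the predictable part at distance [b n]. An infinite [Lam] would be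
   read as 0 by [fine], but [growth] makes it finite for all large [n] almost surely. [A] is
   whatever remains, so the splitting itself is an identity. *)
pose B n w := b n * (Num.sqrt n%:R)^-1 * Num.sqrt (fine (Lam n w)).
pose A n w := Deltan g eps (distF P g eps) n (b n) w - B n w.
exists A, B; split; first by move=> n w; rewrite subrK.
have [C C0 LC] := integral_Lmax iid mg Ifin Isum.
have growth := ae_growth (measurable_Lmax iid mg) (Lmax_ge0 g iid) C0 LC
  (fun m n w => Lam_le_Lmax iid mg w (m := m) (n := n)).
split; last first.
  apply: filterS growth => w hw; apply/cvgrPdist_le => e e0.
  (* Squared because [B] contains the square root of [Lam]. *)
  have := hw (e ^+ 2); rewrite exprn_gt0// => /(_ isT) hn.
  near=> n.
  have Ln : (Lam n w <= (e ^+ 2 * (n%:R * ln (n%:R : R) * ln (ln (n%:R : R)) ^+ 2))%:E)%E.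
    by near: n.
  have n0 : 0 < n%:R :> R by rewrite ltr0n; near: n; exact: nbhs_infty_gt.
  have l1 : 1 <= ln (n%:R : R) by near: n; exact: near_ln_ge.
  have ll1 : 1 <= ln (ln (n%:R : R)) by near: n; exact: near_lnln_ge.
  set l := ln (n%:R : R) in l1 ll1 Ln; set ll := ln l in ll1 Ln.
  have l0 : 0 < l by rewrite (lt_le_trans _ l1).
  have ll0 : 0 < ll by rewrite (lt_le_trans _ ll1).
  have rn : 0 < Num.sqrt (n%:R : R) by rewrite sqrtr_gt0.
  have rl : 0 < Num.sqrt l by rewrite sqrtr_gt0.
  have LL : Num.sqrt (fine (Lam n w)) <= e * (Num.sqrt n%:R * Num.sqrt l * ll).
    apply: (@le_trans _ _ (Num.sqrt ((e * (Num.sqrt n%:R * Num.sqrt l * ll)) ^+ 2))).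
      rewrite ler_wsqrtr// -lee_fin fineK; last first.
        by rewrite ge0_fin_numE ?Lam_ge0// (le_lt_trans Ln)// ltry.
      by rewrite !exprMn !sqr_sqrtr// ltW.
    by rewrite sqrtr_sqr ger0_norm// !mulr_ge0// ltW.
  rewrite sub0r normrN ger0_norm; last first.
    rewrite divr_ge0 ?mulr_ge0 ?sqrtr_ge0 ?invr_ge0 ?(ltW (b0 n))//.
    by rewrite /iota_fun -/l -/ll ltW.
  rewrite /iota_fun -/l -/ll /B ler_pdivrMr ?mulr_gt0//.
  rewrite mulrAC mulrA ler_pdivrMr// -!mulrA [e * _]mulrCA ler_pM2l//.
  by apply: (le_trans LL); rewrite le_eqVlt; apply/orP; left; apply/eqP; ring.
have [K K0 osc] := martingale_oscillation iid mg c0_gt0 dcond1 condF_le b0 bC.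
have lip := ae_cgap_le iid mg c0_gt0 dcond1 condF_le.
have lip0 := cgap_le iid mg dcond1 condF_le.
have : {ae P, forall w, \forall n \near \oo, A n w / Num.sqrt (b n * ln (n%:R : R)) <= K + 2 * c0}.
  apply: filterS3 osc lip growth => w oscw lipw growthw.
  have hn := growthw 1 ltr01.
  near=> n.
  have n0' : (0 < n)%N by near: n; exact: nbhs_infty_gt.
  have n0 : 0 < n%:R :> R by rewrite ltr0n.
  have n1 : 1 <= n%:R :> R by rewrite ler1n.
  have l1 : 1 <= ln (n%:R : R) by near: n; exact: near_ln_ge.
  have b1 : b n <= 1.
    have : `|0 - b n| <= 1 by near: n; move/cvgrPdist_le : bto0 => /(_ _ ltr01).
    by rewrite sub0r normrN => /(le_trans (ler_norm _)).
  have oscn : forall x y : R, x <= y -> y - x <= b n -> `|Mt g iid n x y w| <=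
      K * Num.sqrt (n%:R * b n * ln (n%:R : R)) + 2 * c0 * b n by near: n.
  have Ln : (Lam n w <= (1 * (n%:R * ln (n%:R : R) * ln (ln (n%:R : R)) ^+ 2))%:E)%E.
    by near: n.
  have Lfin : (Lam n w < +oo)%E by exact: le_lt_trans Ln (ltry _).
  set l := ln (n%:R : R) in l1 oscn *.
  have bn := b0 n; have l0 : 0 < l by rewrite (lt_le_trans _ l1).
  have bl : 0 < b n * l by rewrite mulr_gt0.
  have rn : 1 <= Num.sqrt (n%:R : R) by rewrite -[leLHS]sqrtr1 ler_wsqrtr.
  have rn0 : 0 < Num.sqrt (n%:R : R) by rewrite (lt_le_trans _ rn).
  rewrite ler_pdivrMr ?sqrtr_gt0// lerBlDr.
  apply: Deltan_le => // x y xy yxb.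
  rewrite (Gn_increment iid mg)// normrM ger0_norm ?invr_ge0 ?(ltW rn0)//.
  rewrite ler_pdivrMl// (le_trans (ler_normD _ _))//.
  rewrite mulrDr; apply: lerD.
    apply: (le_trans (oscn x y xy yxb)).
    rewrite -(mulrA n%:R) sqrtrM ?(ltW n0)//.
    set r := Num.sqrt n%:R in rn rn0 *; set v := Num.sqrt (b n * l).
    (* The discretization error [2 * c0 * b n] is absorbed in the main term, since eventually
       [b n <= 1 <= ln n]. *)
    have bv : b n <= v.
      rewrite -[leLHS](ger0_norm (ltW bn)) -sqrtr_sqr ler_wsqrtr//.
      by rewrite expr2 ler_pM2l// (le_trans b1).
    rewrite [leRHS](_ : _ = K * (r * v) + 2 * c0 * (r * v)); last by ring.
    rewrite lerD2l ler_pM2l ?mulr_gt0//; apply: (le_trans bv).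
    by rewrite -[leLHS]mul1r ler_wpM2r// sqrtr_ge0.
  have noat i z : xilaw iid [set t | g (smerge 1 (Xi eps eps0' i%:Z w) t) = z] = 0%E.
    by apply: (noatom_of_lip mg c0_gt0) => u v uv; exact: lipw.
  have noat0 z : xilaw iid [set t | g t = z] = 0%E by exact: (noatom_xilaw mg c0_gt0 _ lip0).
  apply: (le_trans (csum_leg_lipschitz mg Lfin noat noat0 xy)).
  rewrite /B -!mulrA mulrCA mulVKf ?gt_eqF//.
  by rewrite ler_wpM2r// sqrtr_ge0.
by apply: filterS => w hw; exists (K + 2 * c0).
Unshelve. all: by end_near. Qed.
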